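(* Let $M$ be a von Neumann algebra on a complex Hilbert space $H$, with commutant $M'$. Consider the following statements. (i) The weak$^*$ topology on $M'$ coincides with the weak operator topology, that is, every normal positive linear functional on $M'$ is a finite sum of functionals of the form $\omega'_\zeta : M'\ni x'\mapsto (x'\zeta\,|\,\zeta)$, $\zeta\in H$. (ii) For every sequence $(\xi_k)_{k\ge1}$ in $H$ there exist $n\ge 1$ and $\zeta_1,\dots,\zeta_n\in H$ such that $\xi_k$ belongs to the closure of $\sum_{j=1}^n M\zeta_j$ for each $k\ge 1$. (iii) For any Banach space $X$, any bounded real linear map $\Phi: M\to B(X)$, and any additive operators $T_1,T_2:H\to X$ satisfying the intertwining condition $$T_1x=\Phi(x)\,T_2,\qquad x\in M,$$ the operator $T_1$ and the composition of $T_2$ with the canonical map of $X$ onto the quotient Banach space $X\big/\bigcap_{x\in M}\mathrm{Ker}\,\Phi(x)$ (this composition being identifiable with $\bigvee_{x\in M} r(\Phi(x))\,T_2$ if $X$ is a Hilbert space) are both necessarily real linear and bounded. Then (i) $\Longrightarrow$ (ii) $\Longrightarrow$ (iii).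
   Context: $B(X)$ is the Banach space of all bounded linear operators on $X$. ''Additive'' means only $T(\xi+\eta)=T\xi+T\eta$; no homogeneity or continuity is assumed. $(\cdot|\cdot)$ is the inner product of $H$. $\sum_{j=1}^n M\zeta_j=\{\sum_{j=1}^n x_j\zeta_j : x_j\in M\}$, with closure in norm. For a bounded operator $y$ on a Hilbert space, $r(y)$ is its right support projection, i.e. the orthogonal projection onto $(\mathrm{Ker}\,y)^\perp$, and $\bigvee$ is the supremum of projections. *)

(* Defs.v *)
From mathcomp Require Import all_boot all_order all_algebra.
From mathcomp Require Import all_classical all_reals all_analysis.
From mathcomp Require Import complex.
Set Implicit Arguments.
Unset Strict Implicit.
Unset Printing Implicit Defensive.
Import Order.TTheory GRing.Theory Num.Theory.
Import numFieldNormedType.Exports.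
Local Open Scope classical_set_scope.
Local Open Scope ring_scope.
Local Open Scope complex_scope.

(* A Banach space is a [completeNormedModType K] with [K = R] or [K = R[i]].
   Operators are plain functions; sets of operators have type [set (X -> X)].
   The norm of a module over [R[i]] takes its values in [R[i]]. *)

(* [ip v w] is linear in [v] and [conj]-linear in [w]. *)
Record inner_product (K : numFieldType) (conj : K -> K)
    (X : normedModType K) := InnerProduct {
  ip_form :> {dot X for conj};
  ip_norm : forall v : X, `|v| ^+ 2 = ip_form v v }.

Definition bounded_op (K : numFieldType) (X : normedModType K) : set (X -> X) :=
  [set f | linear f /\ exists c : K, forall v, `|f v| <= c * `|v|].

Definition adjoint_of (K : numFieldType) (conj : K -> K) (X : normedModType K)
    (ip : inner_product conj X) (f g : X -> X) : Prop :=
  forall v w, ip (f v) w = ip v (g w).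

Section Projections.
Context {K : numFieldType} {conj : K -> K} {X : normedModType K}.
Variable ip : inner_product conj X.

Definition projection (p : X -> X) : Prop :=
  [/\ bounded_op p, p \o p = p & adjoint_of ip p p].

Definition orthogonal_complement (A : set X) : set X :=
  [set v | forall w, A w -> ip v w = 0].

Definition ker (f : X -> X) : set X := [set v | f v = 0].

Definition right_support (f p : X -> X) : Prop :=
  projection p /\ range p = orthogonal_complement (ker f).

Definition projection_sup (P : set (X -> X)) (p : X -> X) : Prop :=
  [/\ projection p,
      forall q, P q -> range q `<=` range p
    & forall p', projection p' -> (forall q, P q -> range q `<=` range p') ->
        range p `<=` range p'].

End Projections.

Section Quotient.
Context {R : realType} {K : numFieldType} {X : normedModType K}.
Variable re : K -> R.

(* The canonical map of [X] onto [X / N], with cosets as sets. *)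
Definition coset_map (N : set X) (v : X) : set X := [set w | N (w - v)].

Definition quotient_norm (A : set X) : R := inf [set re `|w| | w in A].

End Quotient.

Section VonNeumann.
Variables (R : realType) (H : completeNormedModType R[i]).
Variable ip : inner_product (@Num.conj R[i]) H.
Implicit Types M N : set (H -> H).

Definition commutant N : set (H -> H) :=
  [set y | bounded_op y /\ forall x, N x -> y \o x = x \o y].

Record von_neumann_algebra M : Prop := VonNeumannAlgebra {
  vna_bounded : M `<=` @bounded_op _ H;
  vna_one : M idfun;
  vna_lin : forall (a : R[i]) x y, M x -> M y -> M (a *: x + y);
  vna_mul : forall x y, M x -> M y -> M (x \o y);
  vna_adj : forall x, M x -> exists2 y, M y & adjoint_of ip x y;
  vna_bicommutant : commutant (commutant M) = M }.

(* Both topologies on [N] are initial topologies: for the functionals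
   [x |-> (x xi | eta)], resp. [x |-> \sum_k (x xi_k | eta_k)] with
   [\sum_k |xi_k|^2] and [\sum_k |eta_k|^2] finite; the latter functionals
   form the predual when [N] is a von Neumann algebra. *)
Definition wot_coord N (x : set_type N) : {ptws (H * H)%type -> R[i]^o} :=
  fun p => ip (val x p.1) p.2.

Definition wot N : topologicalType := initial_topology (@wot_coord N).

Definition square_summable : set (nat -> H) :=
  [set u | cvgn (series (fun k => (complex.Re `|u k|) ^+ 2 : R))].

Definition weak_star_coord N (x : set_type N) :
    {ptws set_type (square_summable `*` square_summable) -> R[i]^o} :=
  fun p => limn (series (fun k => ip (val x ((val p).1 k)) ((val p).2 k)
                                  : R[i]^o)).

Definition weak_star N : topologicalType :=
  initial_topology (@weak_star_coord N).

Definition weak_star_eq_wot N : Prop :=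
  forall U : set (set_type N), @open (weak_star N) U <-> @open (wot N) U.

(* Only the values of [phi] on [N] matter. *)
Record normal_positive_functional N (phi : (H -> H) -> R[i]) : Prop := {
  npf_linear : forall (a : R[i]) x y, N x -> N y ->
    phi (a *: x + y) = a * phi x + phi y;
  npf_positive : forall x, N x -> (forall v, 0 <= ip (x v) v) -> 0 <= phi x;
  npf_normal :
    continuous ((fun x => phi (val x)) : weak_star N -> R[i]^o) }.

Definition normal_positive_finite_sums N : Prop :=
  forall phi, normal_positive_functional N phi ->
  exists (n : nat) (zeta : 'I_n -> H),
    forall x, N x -> phi x = \sum_(j < n) ip (x (zeta j)) (zeta j).

Definition finite_module_span M (n : nat) (zeta : 'I_n -> H) : set H :=
  [set \sum_(j < n) x j (zeta j) | x in [set x | forall j, M (x j)]].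

Definition sequences_finitely_generated M : Prop :=
  forall xi : nat -> H, exists (n : nat) (zeta : 'I_n -> H),
    (1 <= n)%N /\ forall k, closure (finite_module_span M zeta) (xi k).

Definition opnorm (x : H -> H) : R :=
  sup [set complex.Re `|x v| | v in [set v | `|v| <= 1]].

(* [inK] embeds [R] in the scalars of [X], [re] takes norms back to [R];
   see [intertwiners_automatically_bounded] for the two instances. *)
Section Intertwiners.
Variables (K : numFieldType) (inK : R -> K) (re : K -> R) (conj : K -> K).

Definition additive_map (X : normedModType K) (T : H -> X) : Prop :=
  forall xi eta, T (xi + eta) = T xi + T eta.

Definition real_linear_bounded (X : normedModType K) (T : H -> X) : Prop :=
  [/\ additive_map T,
      forall (r : R) xi, T (r%:C *: xi) = inK r *: T xi
    & exists c : R, forall xi, re `|T xi| <= c * complex.Re `|xi|].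

(* The same for [coset_map N \o T], where [N] is a closed subspace; sums and
   scalar multiples in [X / N] are computed on representatives. *)
Definition real_linear_bounded_mod (X : normedModType K) (N : set X)
    (T : H -> X) : Prop :=
  [/\ forall xi eta, coset_map N (T (xi + eta)) = coset_map N (T xi + T eta),
      forall (r : R) xi,
        coset_map N (T (r%:C *: xi)) = coset_map N (inK r *: T xi)
    & exists c : R, forall xi,
        quotient_norm re (coset_map N (T xi)) <= c * complex.Re `|xi|].

Record bounded_real_linear_map M (X : normedModType K)
    (Phi : (H -> H) -> (X -> X)) : Prop := {
  brl_op : forall x, M x -> bounded_op (Phi x);
  brl_add : forall x y, M x -> M y -> Phi (x + y) = Phi x + Phi y;
  brl_scale : forall (r : R) x, M x -> Phi (r%:C *: x) = inK r *: Phi x;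
  brl_bounded : exists c : R, forall x, M x -> forall v,
    re `|Phi x v| <= c * opnorm x * re `|v| }.

Definition common_kernel M (X : normedModType K) (Phi : (H -> H) -> (X -> X)) :
    set X :=
  [set v | forall x, M x -> ker (Phi x) v].

(* [p] is the supremum of the right supports of the [Phi x], and
   [coset_map N v |-> p v], with [N] the common kernel, is a well-defined
   isometric bijection of [X / N] onto [range p]. *)
Definition quotient_projection M (X : normedModType K)
    (ip : inner_product conj X) (Phi : (H -> H) -> (X -> X)) (p : X -> X) :
    Prop :=
  let N := common_kernel M Phi in
  [/\ projection_sup ip [set q | exists2 x, M x & right_support ip (Phi x) q] p,
      forall v w, coset_map N v = coset_map N w <-> p v = p w
    & forall v, quotient_norm re (coset_map N v) = re `|p v|].

Definition intertwiners_bounded_over M : Prop :=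
  forall (X : completeNormedModType K) (Phi : (H -> H) -> (X -> X))
    (T1 T2 : H -> X),
  bounded_real_linear_map M Phi ->
  additive_map T1 -> additive_map T2 ->
  (forall x, M x -> T1 \o x = Phi x \o T2) ->
  [/\ real_linear_bounded T1,
      real_linear_bounded_mod (common_kernel M Phi) T2
    & forall ipX : inner_product conj X,
        exists p, quotient_projection M ipX Phi p /\
                  real_linear_bounded (p \o T2)].

End Intertwiners.

Definition intertwiners_automatically_bounded M : Prop :=
  @intertwiners_bounded_over R idfun idfun idfun M /\
  @intertwiners_bounded_over R[i] (real_complex R) (@complex.Re R)
    (@Num.conj R[i]) M.

End VonNeumann.

(* Main.v *)
Require Import Defs.
From mathcomp Require Import all_boot all_order all_algebra.
From mathcomp Require Import all_classical all_reals all_analysis.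
From mathcomp Require Import complex.
From mathcomp Require Import ring lra.
Set Implicit Arguments.
Unset Strict Implicit.
Unset Printing Implicit Defensive.
Import Order.TTheory GRing.Theory Num.Theory.
Import numFieldNormedType.Exports.
Local Open Scope classical_set_scope.
Local Open Scope ring_scope.

(** The operators needed below all come from one version of the Riesz
    representation theorem, [riesz_sequence], and from the square roots of
    positive contractions, [square_root].

    Topologies. If the weak* and weak operator topologies agree on [M'], a
    weak* continuous functional [phi] satisfies an estimate
    [|phi x| <= c sum |(x a | b)|] with finitely many pairs
    ([weak_star_functional_bound]). If moreover [phi] is positive, the
    estimate shows that [phi] is dominated by the vector functional of a tuple
    [c], and the Radon-Nikodym argument of [positive_functional_vector] turns
    it into the vector functional of another tuple, that is a finite sum of
    vector functionals. The converse is polarization.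

    From topologies to generators. Rescale a sequence to be square summable and
    apply the estimate to [x |-> sum (x u_k | u_k)]. The projection onto the
    closed module generated by the vectors [a] lies in [M'], and its complement
    kills the right side of the estimate, so the sequence lies in that module.

    From generators to intertwiners. Real homogeneity of [T1 = Phi 1 T2] is
    immediate from the intertwining relation, as is that of [T2] modulo the
    common kernel. The core is [bounded_factorization]: a sequence [xi_k] that
    decreases rapidly and lies in a finitely generated closed module can be
    written [xi_k = sum_j x_kj z_j] with finitely many vectors [z_j] and
    uniformly bounded [x_kj] in [M]. Since [T1 (x z) = Phi x (T2 z)] is bounded
    in terms of the norm of [x], an unbounded [T1] would give a contradiction.
    The factorization comes from an unbounded positive operator,
    [(1 + sum Y* Y)^(1/2)] for suitable rows [Y] over [M], handled through its
    bounded inverse [g] ([increasing_forms_factorization],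
    [family_factorization]): [g] is in the matrix algebra over [M] since it
    commutes with the diagonal action of [M'], and the bicommutant property
    brings its rows back to [M].

    Once [T1] is bounded, the graph of [T2] modulo the common kernel is closed,
    and a closed graph theorem with values in a quotient
    ([closed_graph_quotient]) bounds it. When the target is a Hilbert space,
    the quotient map is the projection onto the complement of the common
    kernel, which is the supremum of the right supports
    ([projection_onto_support]). *)

(** * Positive symmetric forms over the reals *)

Lemma quadratic_disc (R : realType) (p q s : R) : 0 <= p ->
  (forall t : R, 0 <= p * t ^+ 2 + 2 * q * t + s) -> q ^+ 2 <= p * s.
Proof.
move=> p_ge0 h.
have [p0|p0] := eqVneq p 0.
  rewrite p0 mul0r; suff -> : q = 0 by rewrite expr0n.
  apply/eqP/negPn/negP => q0.
  have := h (- (s + 1) / (2 * q)); rewrite p0.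
  have -> : 0 * (- (s + 1) / (2 * q)) ^+ 2 + 2 * q * (- (s + 1) / (2 * q)) + s
    = -1 by field.
  lra.
have pp : 0 < p by rewrite lt_neqAle eq_sym p0.
have := h (- q / p).
have -> : p * (- q / p) ^+ 2 + 2 * q * (- q / p) + s = s - q ^+ 2 / p by field.
by rewrite subr_ge0 ler_pdivrMr// mulrC.
Qed.

Lemma cvg_seq_ub (R : realType) (u : nat -> R) (l c : R) :
  u @ \oo --> l -> (forall n, u n <= c) -> l <= c.
Proof. by move=> ul uc; apply: (cvgr_to_le ul); exact: nearW. Qed.

Lemma cvg_seq_lb (R : realType) (u : nat -> R) (l c : R) :
  u @ \oo --> l -> (forall n, c <= u n) -> c <= l.
Proof. by move=> ul uc; apply: (cvgr_to_ge ul); exact: nearW. Qed.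

Lemma cvg_seq_unique (R : realType) (u : nat -> R) (l m : R) :
  u @ \oo --> l -> u @ \oo --> m -> l = m.
Proof.
by move=> ul um; apply: (@cvg_unique _ (@Rhausdorff R) _ _ _ _ ul um).
Qed.

Section RealForms.
Context {R : realType} {K : pzRingType} {inK : {rmorphism R -> K}}.
Context {V : lmodType K}.

(** A positive semidefinite form on the real vector space underlying a
    [K]-module, real scalars acting through [inK]. A complex Hilbert space
    enters through the real part of its inner product; complex linearity is
    recovered whenever an operator commutes with the scalars, which belong to
    all the algebras considered. *)
Record rform := RForm {
  rf :> V -> V -> R;
  rf_sym : forall u v, rf u v = rf v u;
  rfDl : forall u v w, rf (u + v) w = rf u w + rf v w;
  rfZl : forall r u v, rf (inK r *: u) v = r * rf u v;
  rf_ge0 : forall u, 0 <= rf u u }.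

Definition real_subspace (D : set V) :=
  [/\ D 0, forall u v, D u -> D v -> D (u + v)
    & forall r u, D u -> D (inK r *: u)].

Section OneForm.
Variable a : rform.
Implicit Types (u v w : V) (r : R).

Lemma rfDr u v w : a u (v + w) = a u v + a u w.
Proof. by rewrite rf_sym rfDl !(rf_sym a u). Qed.
Lemma rfZr r u v : a u (inK r *: v) = r * a u v.
Proof. by rewrite rf_sym rfZl (rf_sym a u). Qed.
Lemma rf0l v : a 0 v = 0.
Proof. by have := rfZl a 0 0 v; rewrite rmorph0 scale0r => ->; rewrite mul0r. Qed.
Lemma rf0r v : a v 0 = 0.
Proof. by rewrite rf_sym rf0l. Qed.
Lemma rfNl u v : a (- u) v = - a u v.
Proof. by apply/eqP; rewrite -addr_eq0 -rfDl addNr rf0l. Qed.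
Lemma rfNr u v : a u (- v) = - a u v.
Proof. by rewrite rf_sym rfNl (rf_sym a u). Qed.
Lemma rfBr u v w : a u (v - w) = a u v - a u w.
Proof. by rewrite rfDr rfNr. Qed.

Definition rfE := (rfDl, rfDr, rfNl, rfNr, rfZl, rfZr).

Lemma real_subspaceN (D : set V) u : real_subspace D -> D u -> D (- u).
Proof.
case=> _ _ DZ Du; have := DZ (-1) u Du.
by rewrite rmorphN rmorph1 scaleN1r.
Qed.

Lemma real_subspaceB (D : set V) u v : real_subspace D -> D u -> D v -> D (u - v).
Proof. by move=> DD Du Dv; case: (DD) => _ DA _; apply: DA => //; exact: real_subspaceN. Qed.

Lemma cauchy_schwarz_sqr u v : a u v ^+ 2 <= a u u * a v v.
Proof.
rewrite mulrC; apply: quadratic_disc => [|t]; first exact: rf_ge0.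
have := rf_ge0 a (u + inK t *: v).
by rewrite !rfE (rf_sym a v u); congr (_ <= _); ring.
Qed.

Definition rnorm v : R := Num.sqrt (a v v).

Lemma rnorm_ge0 v : 0 <= rnorm v. Proof. exact: sqrtr_ge0. Qed.
Hint Resolve rnorm_ge0 : core.
Lemma sqr_rnorm v : rnorm v ^+ 2 = a v v.
Proof. by rewrite sqr_sqrtr// rf_ge0. Qed.

Lemma cauchy_schwarz u v : `|a u v| <= rnorm u * rnorm v.
Proof.
rewrite -(@ler_pXn2r _ 2)// ?nnegrE ?mulr_ge0//.
by rewrite real_normK ?num_real// exprMn !sqr_rnorm cauchy_schwarz_sqr.
Qed.

Lemma rnorm_le v (c : R) : 0 <= c -> a v v <= c ^+ 2 -> rnorm v <= c.
Proof.
by move=> c0 h; rewrite -(@ler_pXn2r _ 2)// ?nnegrE// sqr_rnorm.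
Qed.

Lemma rnormD u v : rnorm (u + v) <= rnorm u + rnorm v.
Proof.
apply: rnorm_le; first by rewrite addr_ge0.
have := ler_norml (a u v) (rnorm u * rnorm v).
rewrite cauchy_schwarz => /esym/andP[_ h].
rewrite !rfE (rf_sym a v u) sqrrD !sqr_rnorm mulr2n; lra.
Qed.

Lemma rnorm0 : rnorm 0 = 0. Proof. by rewrite /rnorm rf0l sqrtr0. Qed.
Lemma rnormN v : rnorm (- v) = rnorm v.
Proof. by rewrite /rnorm rfNl rfNr opprK. Qed.
Lemma rnorm_distC u v : rnorm (u - v) = rnorm (v - u).
Proof. by rewrite -rnormN opprB. Qed.
Lemma rnormZ r v : rnorm (inK r *: v) = `|r| * rnorm v.
Proof.
by rewrite /rnorm rfZl rfZr mulrA -expr2 sqrtrM ?sqr_ge0// sqrtr_sqr.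
Qed.
Lemma rnorm_sub_trans w u v : rnorm (u - v) <= rnorm (u - w) + rnorm (w - v).
Proof. by rewrite -[u - v](subrKA w) rnormD. Qed.

Definition rcauchy (x : nat -> V) :=
  forall e : R, 0 < e -> exists N, forall i j, (N <= i)%N -> (N <= j)%N ->
    rnorm (x i - x j) <= e.

Definition rlim (x : nat -> V) (l : V) :=
  (fun n => rnorm (x n - l)) @ \oo --> (0 : R).

Lemma rlimP x l : rlim x l <->
  forall e : R, 0 < e -> exists N, forall n, (N <= n)%N -> rnorm (x n - l) <= e.
Proof.
split=> [/cvgrPdist_le h e /h [N _ hN]|h].
  by exists N => n /hN /=; rewrite sub0r normrN ger0_norm.
apply/cvgrPdist_le => e /h [N hN]; exists N => // n /hN /=.
by rewrite sub0r normrN ger0_norm.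
Qed.

Lemma rlim_le (x : nat -> V) l (e : nat -> R) :
  (forall n, rnorm (x n - l) <= e n) -> e @ \oo --> 0 -> rlim x l.
Proof.
move=> h e0; apply: (@squeeze_cvgr _ _ _ _ (fun=> 0) e) => //; last exact: cvg_cst.
by apply: nearW => n; rewrite rnorm_ge0 h.
Qed.

Lemma rlim_cst l : rlim (fun=> l) l.
Proof.
rewrite /rlim; under eq_fun do rewrite subrr rnorm0.
exact: cvg_cst.
Qed.

Lemma rlimD x y l m : rlim x l -> rlim y m -> rlim (fun n => x n + y n) (l + m).
Proof.
move=> xl ym.
apply: (@rlim_le _ _ (fun n => rnorm (x n - l) + rnorm (y n - m))).
  by move=> n; rewrite opprD addrACA rnormD.
by rewrite -[X in _ --> X](addr0 0); exact: cvgD.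
Qed.

Lemma rlimZ r x l : rlim x l -> rlim (fun n => inK r *: x n) (inK r *: l).
Proof.
move=> xl; apply: (@rlim_le _ _ (fun n => `|r| * rnorm (x n - l))).
  by move=> n; rewrite -scalerBr rnormZ.
by rewrite -[X in _ --> X](mulr0 `|r|); apply: cvgM => //; exact: cvg_cst.
Qed.

Lemma rlimN x l : rlim x l -> rlim (fun n => - x n) (- l).
Proof.
move=> /(rlimZ (-1)); rewrite rmorphN rmorph1 scaleN1r.
by under eq_fun do rewrite scaleN1r.
Qed.

Lemma rlimB x y l m : rlim x l -> rlim y m -> rlim (fun n => x n - y n) (l - m).
Proof. by move=> xl /rlimN; exact: rlimD. Qed.

Lemma rlim_form x y l m : rlim x l -> rlim y m ->
  (fun n => a (x n) (y n)) @ \oo --> a l m.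
Proof.
move=> xl ym; apply/subr_cvg0.
have h n : a (x n) (y n) - a l m =
    a (x n - l) (y n - m) + a (x n - l) m + a l (y n - m).
  by rewrite !rfE; ring.
pose e n := rnorm (x n - l) * rnorm (y n - m) + rnorm (x n - l) * rnorm m
    + rnorm l * rnorm (y n - m).
have he n : `|a (x n) (y n) - a l m| <= e n.
  rewrite h; apply: le_trans (ler_normD _ _) _; apply: lerD; last exact: cauchy_schwarz.
  by apply: le_trans (ler_normD _ _) _; apply: lerD; exact: cauchy_schwarz.
have e0 : e @ \oo --> 0.
  have -> : 0 = 0 * 0 + 0 * rnorm m + rnorm l * 0 :> R by rewrite !mul0r mulr0 !addr0.
  by apply: cvgD; [apply: cvgD; apply: cvgM => //; exact: cvg_cst|
    apply: cvgM => //; exact: cvg_cst].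
apply: (@squeeze_cvgr _ _ _ _ (fun n => - e n) e) => //.
  by apply: nearW => n; rewrite -ler_norml.
by rewrite -oppr0; apply: cvgN.
Qed.

Lemma rlim_forml x l w : rlim x l -> (fun n => a (x n) w) @ \oo --> a l w.
Proof. by move=> xl; apply: rlim_form => //; exact: rlim_cst. Qed.
Lemma rlim_formr x l w : rlim x l -> (fun n => a w (x n)) @ \oo --> a w l.
Proof. by move=> xl; apply: rlim_form => //; exact: rlim_cst. Qed.

Lemma rlim_rnorm_le x l (c : R) : rlim x l -> (forall n, rnorm (x n) <= c) ->
  rnorm l <= c.
Proof.
move=> xl h; have c0 : 0 <= c by apply: le_trans (h 0%N).
apply: rnorm_le => //.
apply: (cvg_seq_ub (rlim_form xl xl)) => n.
by rewrite -sqr_rnorm ler_pXn2r ?nnegrE.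
Qed.

(** The functional [a u u - 2 f u] is bounded below on [D]. By the
    parallelogram identity a minimizing sequence is Cauchy, and comparing its
    values with those at [x n + t w] shows that [a w (x n)] tends to [f w].
    The conclusion is a Cauchy sequence rather than a limit, so that the lemma
    applies to forms pulled back along maps whose range is not closed. *)
Lemma riesz_sequence (D : set V) (f : V -> R) (c : R) :
  real_subspace D ->
  (forall u v, D u -> D v -> f (u + v) = f u + f v) ->
  (forall r u, D u -> f (inK r *: u) = r * f u) ->
  (forall u, D u -> f u ^+ 2 <= c * a u u) ->
  exists x : nat -> V, [/\ forall n, D (x n), rcauchy x
    & forall w, D w -> (fun n => a w (x n)) @ \oo --> f w].
Proof.
move=> DD fD fZ fb; case: (DD) => D0 DA DZ.
pose J u := a u u - 2 * f u.
have Jb u : D u -> - `|c| <= J u.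
  move=> Du; rewrite /J.
  have := fb u Du; have := rf_ge0 a u; have := ler_norm c.
  set A := a u u; set F := f u => hc hA h.
  have [|FA] := lerP F 0; first by have := normr_ge0 c; lra.
  have : F ^+ 2 <= `|c| * A by apply: le_trans h _; rewrite ler_wpM2r.
  have := sqr_ge0 (A - `|c|); have := normr_ge0 c; nra.
have hasi : has_inf [set J u | u in D].
  split; first by exists (J 0), 0.
  by exists (- `|c|) => _ [u Du <-]; exact: Jb.
set I := inf [set J u | u in D].
have /choice[x xP] : forall n, exists u, D u /\ J u <= I + n.+1%:R^-1.
  move=> n.
  have [|_ [u Du <-] Ju] := @inf_adherent _ _ n.+1%:R^-1 _ hasi.
    by rewrite invr_gt0.
  by exists u; split => //; exact: ltW.
have ID u : D u -> I <= J u by move=> Du; apply: ge_inf; [exact: hasi.2|exists u].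
exists x; split; first by move=> n; case: (xP n).
- move=> e e0; near \oo => N; exists N => i j Ni Nj.
  apply: rnorm_le; first exact: ltW.
  have [Di Ji] := xP i; have [Dj Jj] := xP j.
  have : I <= J (inK 2^-1 *: (x i + x j)) by apply: ID; apply/DZ/DA.
  rewrite /J fZ; last exact: DA.
  rewrite fD// !rfE; move: Ji Jj; rewrite /J.
  rewrite (rf_sym a (x j) (x i)) => Ji Jj hI.
  have Nn k : (N <= k)%N -> k.+1%:R^-1 <= 4^-1 * e ^+ 2.
    move=> Nk; apply: (@le_trans _ _ N.+1%:R^-1).
      by rewrite lef_pV2 ?posrE// ler_nat.
    near: N; near=> N; apply/ltW; near: N.
    apply: near_infty_natSinv_lt (PosNum (_ : 0 < 4^-1 * e ^+ 2)).
    by rewrite mulr_gt0 ?exprn_gt0.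
  move: (Nn i Ni) (Nn j Nj) Ji Jj hI.
  move: (i.+1%:R^-1) (j.+1%:R^-1) (e ^+ 2) => p q E.
  move: (a (x i) (x i)) (a (x j) (x j)) (a (x i) (x j)) => A B C.
  by move: (f (x i)) (f (x j)) => F G; clear; lra.
- move=> w Dw; apply/subr_cvg0.
  have h n : (a w (x n) - f w) ^+ 2 <= a w w * n.+1%:R^-1.
    apply: quadratic_disc => [|t]; first exact: rf_ge0.
    have [Dx Jx] := xP n.
    have : I <= J (x n + inK t *: w) by apply: ID; apply: DA => //; exact: DZ.
    rewrite /J fD//; last exact: DZ.
    rewrite fZ// !rfE (rf_sym a (x n) w); move: Jx; rewrite /J.
    move: (n.+1%:R^-1) (a (x n) (x n)) (a w (x n)) (a w w) => z A B C.
    by move: (f (x n)) (f w) => F G; clear; nra.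
  apply/norm_cvg0P; apply: (@squeeze_cvgr _ _ _ _ (fun=> 0)
     (fun n => Num.sqrt (a w w * n.+1%:R^-1))); last 2 first.
  + exact: cvg_cst.
  + have -> : 0 = Num.sqrt (a w w * 0) :> R by rewrite mulr0 sqrtr0.
    apply: continuous_cvg; first exact: sqrt_continuous.
    by apply: cvgM; [exact: cvg_cst|exact: cvg_harmonic].
  + apply: nearW => n; rewrite normr_ge0/=.
    by rewrite -sqrtr_sqr ler_sqrt// mulr_ge0// ?rf_ge0// invr_ge0.
Unshelve. all: by end_near. Qed.

End OneForm.
End RealForms.

Arguments real_subspace {R K} inK {V} D.

(** * Real Hilbert spaces: projections and square roots *)

Section Hilbert.
Context {R : realType} {K : pzRingType} {inK : {rmorphism R -> K}}.

Definition rlinear (V W : lmodType K) (S : V -> W) :=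
  (forall u v, S (u + v) = S u + S v) /\
  (forall r u, S (inK r *: u) = inK r *: S u).

Lemma rlinear0 (V W : lmodType K) (S : V -> W) : rlinear S -> S 0 = 0.
Proof. by case=> SD _; apply: (addIr (S 0)); rewrite -SD !add0r. Qed.
Lemma rlinearN (V W : lmodType K) (S : V -> W) u : rlinear S -> S (- u) = - S u.
Proof.
move=> SL; apply/eqP; rewrite -addr_eq0; case: (SL) => <- _.
by rewrite addNr (rlinear0 SL).
Qed.
Lemma rlinearB (V W : lmodType K) (S : V -> W) u v :
  rlinear S -> S (u - v) = S u - S v.
Proof. by move=> SL; rewrite -(rlinearN _ SL); case: SL. Qed.

Definition rbounded (V W : lmodType K) (a : @rform R K inK V)
  (b : @rform R K inK W) (c : R) (S : V -> W) :=
  forall v, rnorm b (S v) <= c * rnorm a v.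

Lemma rlim_op (V W : lmodType K) (a : @rform R K inK V)
    (b : @rform R K inK W) c S x l :
  rlinear S -> rbounded a b c S -> rlim a x l -> rlim b (S \o x) (S l).
Proof.
move=> SL Sb xl; apply: (@rlim_le _ _ _ _ _ _ _ (fun n => c * rnorm a (x n - l))).
  by move=> n; rewrite /= -(rlinearB _ _ SL).
by rewrite -[X in _ --> X](mulr0 c); apply: cvgM => //; exact: cvg_cst.
Qed.

Definition hilbert (V : lmodType K) (a : @rform R K inK V) :=
  (forall v, a v v = 0 -> v = 0) /\
  (forall x, rcauchy a x -> exists l, rlim a x l).

Definition pullback_form (V W : lmodType K) (b : @rform R K inK W)
  (S : V -> W) (SL : rlinear S) : @rform R K inK V.
Proof.
apply: (@RForm _ _ _ _ (fun u v => b (S u) (S v))).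
- by move=> u v; rewrite rf_sym.
- by move=> u v w; case: SL => -> _; rewrite rfDl.
- by move=> r u v; case: SL => _ ->; rewrite rfZl.
- by move=> u; exact: rf_ge0.
Defined.

Section OneSpace.
Context {V : lmodType K} {a : @rform R K inK V}.
Hypothesis Ha : hilbert a.

Lemma rnorm_eq0 v : rnorm a v = 0 -> v = 0.
Proof. by move=> v0; apply Ha; rewrite -sqr_rnorm v0 expr0n. Qed.

Lemma rlim_unique x l m : rlim a x l -> rlim a x m -> l = m.
Proof.
move=> xl xm; apply/eqP; rewrite -subr_eq0; apply/eqP/rnorm_eq0.
have := rlimB xl xm; rewrite /rlim; under eq_fun do rewrite subrr sub0r rnormN.
by move=> h; apply: (cvg_seq_unique _ h); exact: cvg_cst.
Qed.

Lemma form_ext u v : (forall w, a w u = a w v) -> u = v.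
Proof.
move=> h; apply/eqP; rewrite -subr_eq0; apply/eqP; apply Ha.
by rewrite rfBr h subrr.
Qed.

Definition adherent (D : set V) (p : V) :=
  exists2 x : nat -> V, forall n, D (x n) & rlim a x p.

Lemma adherent_sub (D : set V) v : D v -> adherent D v.
Proof. by move=> Dv; exists (fun=> v) => //; exact: rlim_cst. Qed.

Lemma adherent_subspace (D : set V) :
  real_subspace inK D -> real_subspace inK (adherent D).
Proof.
case=> D0 DA DZ; split.
- exact: adherent_sub.
- move=> u v [x Dx xu] [y Dy yv]; exists (fun n => x n + y n).
    by move=> n; apply: DA.
  exact: rlimD.
- move=> r u [x Dx xu]; exists (fun n => inK r *: x n).
    by move=> n; apply: DZ.
  exact: rlimZ.
Qed.

Lemma adherent_orth (D : set V) p v :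
  adherent D p -> (forall w, D w -> a w v = 0) -> a p v = 0.
Proof.
move=> [x Dx xp] h; have := rlim_forml (w := v) xp.
under eq_fun do rewrite h//.
by move=> h1; apply: (cvg_seq_unique h1); exact: cvg_cst.
Qed.

(** Elements of a closed span are determined by their products with the
    generators; all the linear and commuting maps below get their properties
    from this uniqueness. *)
Lemma adherent_eq0 (D : set V) p :
  adherent D p -> (forall w, D w -> a w p = 0) -> p = 0.
Proof. by move=> Dp h; apply Ha; exact: adherent_orth Dp h. Qed.

Lemma adherent_op (D E : set V) c S : rlinear S -> rbounded a a c S ->
  (forall v, D v -> E (S v)) -> forall v, adherent D v -> adherent E (S v).
Proof.
move=> SL Sb SD v [x Dx xv]; exists (S \o x); first by move=> n; exact: SD.
exact: rlim_op Sb xv.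
Qed.

Definition projects_onto (D : set V) (P : V -> V) :=
  forall v, adherent D (P v) /\ forall w, D w -> a w (P v) = a w v.

Lemma projection_exists (D : set V) : real_subspace inK D ->
  exists P, projects_onto D P.
Proof.
move=> DD; suff : forall v, exists p, adherent D p /\ forall w, D w -> a w p = a w v.
  by move=> /choice[P PP]; exists P.
move=> v.
have [|||x [Dx xc xv]] := @riesz_sequence _ _ _ _ a D (fun w => a w v) (a v v) DD.
- by move=> u w _ _; rewrite rfDl.
- by move=> r u _; rewrite rfZl.
- by move=> u _; rewrite mulrC cauchy_schwarz_sqr.
have [p xp] := Ha.2 _ xc; exists p; split; first by exists x.
by move=> w Dw; apply: (cvg_seq_unique (rlim_formr (w := w) xp)); exact: xv.
Qed.

Section Projection.
Variables (D : set V) (P : V -> V).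
Hypotheses (DD : real_subspace inK D) (PP : projects_onto D P).

Lemma proj_uniq v p :
  adherent D p -> (forall w, D w -> a w p = a w v) -> P v = p.
Proof.
move=> Dp h; apply/eqP; rewrite -subr_eq0; apply/eqP.
apply: (@adherent_eq0 D).
  by apply: (real_subspaceB (adherent_subspace DD)) => //; apply PP.
by move=> w Dw; rewrite rfBr h// (PP v).2// subrr.
Qed.

Lemma proj_linear : rlinear P.
Proof.
have [_ AA AZ] := adherent_subspace DD.
split=> [u v|r u]; apply: proj_uniq.
- by apply: AA; apply PP.
- by move=> w Dw; rewrite !rfDr !(PP _).2.
- by apply: AZ; apply PP.
- by move=> w Dw; rewrite !rfZr !(PP _).2.
Qed.

Lemma proj_id v : adherent D v -> P v = v.
Proof. by move=> Dv; apply: proj_uniq. Qed.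

Lemma proj_orth w v : adherent D w -> a w (v - P v) = 0.
Proof.
move=> Dw; apply: (adherent_orth Dw) => u Du.
by rewrite rfBr (PP v).2// subrr.
Qed.

Lemma proj_formr w v : adherent D w -> a w (P v) = a w v.
Proof. by move=> /(proj_orth v); rewrite rfBr => /eqP; rewrite subr_eq0 => /eqP. Qed.

Lemma proj_sym u v : a (P u) v = a u (P v).
Proof.
by rewrite -(proj_formr v (PP u).1) rf_sym (proj_formr u (PP v).1) rf_sym.
Qed.

Lemma proj_le : rbounded a a 1 P.
Proof.
move=> v; rewrite mul1r -(@ler_pXn2r _ 2)// ?nnegrE ?rnorm_ge0// !sqr_rnorm.
have := rf_ge0 a (v - P v); rewrite !rfE (rf_sym a (P v) v).
by rewrite -proj_sym (proj_formr v (PP v).1); lra.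
Qed.

Lemma proj_commute S S' c : rlinear S -> rbounded a a c S ->
  (forall u v, a (S' u) v = a u (S v)) ->
  (forall v, D v -> D (S v)) -> (forall v, D v -> D (S' v)) ->
  forall v, P (S v) = S (P v).
Proof.
move=> SL Sb adj SD S'D v; apply: proj_uniq.
  by apply: (adherent_op SL Sb SD); apply PP.
by move=> w Dw; rewrite -!adj (PP v).2//; exact: S'D.
Qed.

End Projection.

Lemma rlinear_lim (x : nat -> V -> V) (S : V -> V) :
  (forall n, rlinear (x n)) -> (forall v, rlim a (x^~ v) (S v)) -> rlinear S.
Proof.
move=> xL xS; split=> [u v|r u].
  apply: (rlim_unique (xS _)); under eq_fun do rewrite (xL _).1.
  exact: rlimD.
apply: (rlim_unique (xS _)); under eq_fun do rewrite (xL _).2.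
exact: rlimZ.
Qed.

Lemma symmetric_lim (x : nat -> V -> V) (S : V -> V) :
  (forall n u v, a (x n u) v = a u (x n v)) ->
  (forall v, rlim a (x^~ v) (S v)) -> forall u v, a (S u) v = a u (S v).
Proof.
move=> xs xS u v; have := rlim_forml (w := v) (xS u).
under eq_fun do rewrite xs.
by move=> h; apply: (cvg_seq_unique h); exact: rlim_formr.
Qed.

Lemma commute_lim (x : nat -> V -> V) (S U : V -> V) c :
  rlinear U -> rbounded a a c U ->
  (forall n v, x n (U v) = U (x n v)) ->
  (forall v, rlim a (x^~ v) (S v)) -> forall v, S (U v) = U (S v).
Proof.
move=> UL Ub xU xS v; apply: (rlim_unique (xS _)).
under eq_fun do rewrite xU.
exact: rlim_op Ub (xS v).
Qed.

(** Squared distances bounded by the increments of a bounded monotone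
    sequence: this covers the square root iteration and the monotone limits of
    positive operators. *)
Lemma monotone_cauchy (x : nat -> V) (t : nat -> R) c :
  (forall n, t n <= c) ->
  (forall i j, (i <= j)%N -> a (x i - x j) (x i - x j) <= t j - t i) ->
  rcauchy a x.
Proof.
move=> tc h e e0.
have hs : has_sup (range t).
  by split; [exists (t 0%N), 0%N|exists c => _ [n _ <-]].
have [|_ [N _ <-] hN] := @sup_adherent _ _ (e ^+ 2) _ hs; first by rewrite exprn_gt0.
exists N; suff hw i j : (N <= i)%N -> (i <= j)%N -> rnorm a (x i - x j) <= e.
  move=> i j Ni Nj; case: (leqP i j) => ij; first exact: hw.
  by rewrite rnorm_distC; apply: hw => //; exact: ltnW.
move=> Ni ij; apply: rnorm_le; first exact: ltW.
apply: le_trans (h _ _ ij) _.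
have : t j <= sup (range t) by apply: ub_le_sup; [exact: hs.2|exists j].
have := h _ _ Ni; have := rf_ge0 a (x N - x i); lra.
Qed.

Section SquareRoot.
Variable T : V -> V.
Hypotheses (TL : rlinear T) (Tsym : forall u v, a (T u) v = a u (T v)).
Hypothesis Tcontr : forall v, a (T v) (T v) <= a (T v) v.

Let A v := v - T v.
(** With [A = 1 - T], the iteration [B := (A + B^2) / 2] converges to
    [1 - sqrt T]. Replacing [A] by the scalar 1 gives the sequence
    [sqrt_bound], which increases to a limit at most 1, and norms are dominated
    by it: [|B n v| <= beta n |v|] and
    [|B n.+1 v - B n v| <= (beta n.+1 - beta n) |v|]. Convergence in norm
    follows, and [sqrt T] commutes with all that commutes with [T]. *)
Fixpoint sqrt_iter n v :=
  if n is k.+1 then inK 2^-1 *: (A v + sqrt_iter k (sqrt_iter k v)) else 0.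
Fixpoint sqrt_bound n : R :=
  if n is k.+1 then 2^-1 * (1 + sqrt_bound k ^+ 2) else 0.
Local Notation B := sqrt_iter.
Local Notation beta := sqrt_bound.

Let AL : rlinear A.
Proof.
split=> [u v|r u]; rewrite /A.
  by rewrite TL.1 opprD addrACA.
by rewrite TL.2 scalerBr.
Qed.

Let A_le v : rnorm a (A v) <= rnorm a v.
Proof.
rewrite -(@ler_pXn2r _ 2)// ?nnegrE ?rnorm_ge0// !sqr_rnorm /A.
by rewrite !rfE (rf_sym a v (T v)); have := Tcontr v; have := rf_ge0 a (T v); lra.
Qed.

Let beta01 n : 0 <= beta n <= 1.
Proof. by elim: n => [|n /andP[b0 b1]] /=; [by rewrite lexx ler01|apply/andP; split; nra]. Qed.

Let beta_le n : beta n <= beta n.+1.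
Proof. by have := beta01 n; have := sqr_ge0 (1 - beta n); rewrite /=; nra. Qed.

Let BS n v : B n.+1 v = inK 2^-1 *: (A v + B n (B n v)). Proof. by []. Qed.

Let BL n : rlinear (B n).
Proof.
elim: n => [|n [IHD IHZ]] /=.
  by split=> *; rewrite ?addr0 ?scaler0.
split=> [u v|r u].
  by rewrite AL.1 !IHD -scalerDr addrACA.
by rewrite AL.2 !IHZ -scalerDr !scalerA -!rmorphM mulrC.
Qed.

Let Bcomm S : rlinear S -> (forall v, S (A v) = A (S v)) ->
  forall n v, B n (S v) = S (B n v).
Proof.
move=> SL SA; elim=> [|n IH] v /=; first by rewrite (rlinear0 SL).
by rewrite SL.2 SL.1 SA !IH.
Qed.

Let B_le n v : rnorm a (B n v) <= beta n * rnorm a v.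
Proof.
elim: n v => [|n IH] v /=; first by rewrite rnorm0 mul0r.
rewrite rnormZ ger0_norm//.
rewrite -mulrA ler_wpM2l// mulrDl mul1r; apply: le_trans (rnormD _ _ _) _.
apply: lerD; first exact: A_le.
apply: le_trans (IH _) _; rewrite expr2 -mulrA ler_wpM2l//.
by have /andP[] := beta01 n.
Qed.

Let BS_le n v :
  rnorm a (B n.+1 v - B n v) <= (beta n.+1 - beta n) * rnorm a v.
Proof.
elim: n v => [|n IH] v.
  by rewrite !subr0; have := B_le 1 v.
rewrite [B n.+2 v]BS [X in _ - X]BS -scalerBr opprD addrACA subrr add0r.
rewrite rnormZ ger0_norm//.
have -> : beta n.+2 - beta n.+1 =
  2^-1 * ((beta n.+1 - beta n) * beta n.+1 + (beta n.+1 - beta n) * beta n).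
  have e k : beta k.+1 = 2^-1 * (1 + beta k ^+ 2) by [].
  by rewrite e [X in _ - X = _]e; ring.
rewrite -mulrA ler_wpM2l//.
rewrite -(subrKA (B n (B n.+1 v))).
apply: le_trans (rnormD _ _ _) _; rewrite mulrDl; apply: lerD.
  apply: le_trans (IH _) _; rewrite -mulrA ler_wpM2l ?B_le//.
  by rewrite subr_ge0 beta_le.
rewrite -(rlinearB _ _ (BL n)); apply: le_trans (B_le _ _) _.
rewrite [X in _ <= X]mulrAC [X in _ <= X]mulrC ler_wpM2l//.
by have /andP[] := beta01 n.
Qed.

Let B_dist v i j : (i <= j)%N ->
  rnorm a (B i v - B j v) <= (beta j - beta i) * rnorm a v.
Proof.
move=> /subnK <-; elim: (j - i)%N => [|k IH].
  by rewrite !add0n !subrr mul0r rnorm0.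
rewrite addSn; apply: le_trans (rnorm_sub_trans _ (B (k + i) v) _ _) _.
have -> : beta (k + i).+1 - beta i =
  (beta (k + i) - beta i) + (beta (k + i).+1 - beta (k + i)) by ring.
by rewrite mulrDl; apply: lerD => //; rewrite rnorm_distC; exact: BS_le.
Qed.

Let beta_mono i j : (i <= j)%N -> beta i <= beta j.
Proof.
by move=> /subnK <-; elim: (j - i)%N => // k IH; exact: le_trans (beta_le _).
Qed.

Let B_cauchy v : rcauchy a (B^~ v).
Proof.
apply: (@monotone_cauchy _ (fun n => beta n * a v v) (a v v)) => [n|i j ij].
  by rewrite ler_piMl ?rf_ge0//; have /andP[] := beta01 n.
rewrite -sqr_rnorm -mulrBl -(sqr_rnorm a v).
apply: (@le_trans _ _ (((beta j - beta i) * rnorm a v) ^+ 2)).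
  by rewrite ler_pXn2r ?nnegrE ?mulr_ge0 ?rnorm_ge0 ?subr_ge0 ?beta_mono// B_dist.
rewrite exprMn ler_wpM2r ?sqr_ge0//.
have := beta_mono ij; have /andP[? ?] := beta01 i; have /andP[? ?] := beta01 j.
by nra.
Qed.

Lemma square_root : exists g : V -> V,
  [/\ rlinear g, forall u v, a (g u) v = a u (g v), forall v, g (g v) = T v
    & forall S c, rlinear S -> rbounded a a c S ->
        (forall v, T (S v) = S (T v)) -> forall v, g (S v) = S (g v)].
Proof.
have /choice[b bP] : forall v, exists l, rlim a (B^~ v) l.
  by move=> v; apply: Ha.2; exact: B_cauchy.
have bL : rlinear b by exact: rlinear_lim bP.
have B1 n : rbounded a a 1 (B n).
  move=> v; apply: le_trans (B_le n v) _; rewrite ler_wpM2r ?rnorm_ge0//.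
  by have /andP[] := beta01 n.
have Bsym n u v : a (B n u) v = a u (B n v).
  elim: n u v => [|n IH] u v /=; first by rewrite rf0l rf0r.
  by rewrite rfZl rfZr /A !rfE Tsym !IH.
have bsym : forall u v, a (b u) v = a u (b v) by exact: symmetric_lim bP.
have bfix v : b v = inK 2^-1 *: (A v + b (b v)).
  have bS : rlim a (fun n => B n.+1 v) (b v).
    by have := bP v; rewrite /rlim -(cvg_shiftS (fun n => rnorm a (B n v - b v))).
  apply: (rlim_unique bS); under eq_fun do rewrite BS.
  apply/rlimZ/rlimD; first exact: rlim_cst.
  apply: (@rlim_le _ _ _ _ _ _ _ (fun n => rnorm a (B n v - b v)
    + rnorm a (B n (b v) - b (b v)))).
    move=> n; apply: le_trans (rnorm_sub_trans _ (B n (b v)) _ _) _.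
    rewrite lerD2r -(rlinearB _ _ (BL n)).
    by have := B1 n (B n v - b v); rewrite mul1r.
  by rewrite -[X in _ --> X](addr0 0); apply: cvgD; exact: bP.
have bfix2 v : b (b v) = b v + b v - (v - T v).
  rewrite -/(A v); apply: (@addrI _ (A v)).
  rewrite [RHS]addrC subrK [in RHS]bfix -scalerDl -rmorphD.
  by rewrite (_ : 2^-1 + 2^-1 = 1) ?rmorph1 ?scale1r//; field.
exists (fun v => v - b v); split.
- split=> [u v|r u]; first by rewrite bL.1 opprD addrACA.
  by rewrite bL.2 scalerBr.
- by move=> u v; rewrite !rfE bsym.
- move=> v; rewrite (rlinearB _ _ bL) bfix2.
  by rewrite opprB [_ - b v in X in _ + X]addrAC addrK addrA subrK subKr.
- move=> S c SL Sb TS v; rewrite (rlinearB _ _ SL); congr (_ - _).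
  apply: (commute_lim SL Sb) bP _ => n w; apply: Bcomm => // u.
  by rewrite /A (rlinearB _ _ SL) TS.
Qed.

End SquareRoot.
End OneSpace.
End Hilbert.

Arguments rlinear {R K} inK {V W} S.

(** * Inverting an increasing sequence of forms *)

Section InverseForm.
Context {R : realType} {K : pzRingType} {inK : {rmorphism R -> K}}.
Context {V : lmodType K} {a : @rform R K inK V}.
Hypothesis Ha : hilbert a.

Lemma rsubspaceT : real_subspace inK [set: V].
Proof. by []. Qed.

(** Riesz representation of [a _ v] for the equivalent form [e]; as an
    operator, [T] is the inverse of the one that represents [e]. *)
Lemma form_inverse (e : @rform R K inK V) C :
  (forall v, a v v <= e v v) -> (forall v, e v v <= C * a v v) ->
  exists T : V -> V, forall v w, e w (T v) = a w v.
Proof.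
move=> ae eC; suff : forall v, exists u, forall w, e w u = a w v.
  by move=> /choice[T TP]; exists T.
move=> v; have [|||x [_ xc xv]] := @riesz_sequence _ _ _ _ e setT (a^~ v) (a v v) rsubspaceT.
- by move=> u w _ _; rewrite rfDl.
- by move=> r u _; rewrite rfZl.
- move=> u _; apply: le_trans (cauchy_schwarz_sqr a u v) _.
  by rewrite mulrC ler_wpM2l ?rf_ge0.
have aen u : rnorm a u <= rnorm e u by rewrite ler_wsqrtr.
have [|u xu] := Ha.2 x.
  move=> d d0; have [N NP] := xc d d0; exists N => i j Ni Nj.
  exact: le_trans (aen _) (NP i j Ni Nj).
exists u => w; apply: (cvg_seq_unique _ (xv w I)).
apply: rlim_formr.
apply: (@rlim_le _ _ _ _ _ _ _ (fun n => Num.sqrt `|C| * rnorm a (x n - u))).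
  move=> n; rewrite -sqrtrM// ler_wsqrtr//; apply: le_trans (eC _) _.
  by rewrite ler_wpM2r ?rf_ge0// ler_norm.
by rewrite -[X in _ --> X](mulr0 (Num.sqrt `|C|)); apply: cvgM => //; exact: cvg_cst.
Qed.

Section IncreasingForms.
Variable e : nat -> @rform R K inK V.
Hypothesis ae : forall m v, a v v <= e m v v.
Hypothesis eb : forall m, exists C, forall v, e m v v <= C * a v v.
Hypothesis eS : forall m v, e m v v <= e m.+1 v v.

Let e_mono i j v : (i <= j)%N -> e i v v <= e j v v.
Proof.
by move=> /subnK <-; elim: (j - i)%N => // k IH; exact: le_trans (eS _ _).
Qed.

(** Let [t m] represent [a] with respect to [e m]. For [i <= j],
    [|t i v - t j v|^2 <= a (t i v) v - a (t j v) v], because the left side is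
    at most [e i] of the difference and [e i <= e j]; hence [t m] decreases
    strongly to some [T], which plays the role of the inverse of the possibly
    infinite supremum of the [e m]. A vector [z] with [e m z z] bounded is in
    the domain of that supremum, and Cauchy-Schwarz for [e m] yields
    [a z v ^+ 2 <= C * a (t m v) v], which passes to the limit. *)
Lemma increasing_forms_inverse : exists T : V -> V,
  [/\ rlinear inK T, forall u v, a (T u) v = a u (T v),
      forall m v, e m (T v) (T v) <= a (T v) v,
      forall z C, (forall m, e m z z <= C) ->
        forall v, a z v ^+ 2 <= C * a (T v) v
    & forall S S' c, rlinear inK S -> rbounded a a c S ->
        (forall u v, a (S' u) v = a u (S v)) ->
        (forall m u v, e m (S' u) v = e m u (S v)) ->
        forall v, T (S v) = S (T v)].
Proof.
have /choice[t tP] : forall m, exists T : V -> V, forall v w, e m w (T v) = a w v.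
  by move=> m; have [C eC] := eb m; exact: form_inverse eC.
have tuniq m u v : (forall w, e m w u = a w v) -> u = t m v.
  move=> h; apply/eqP; rewrite -subr_eq0; apply/eqP; apply Ha.
  apply/eqP; rewrite eq_le rf_ge0 andbT; apply: le_trans (ae m _) _.
  by rewrite rfBr h tP subrr.
have tL m : rlinear inK (t m).
  split=> [u v|r u]; apply/esym/tuniq => w; first by rewrite !rfDr !tP.
  by rewrite !rfZr tP.
have tsym m u v : a (t m u) v = a u (t m v).
  by rewrite -(tP m v) rf_sym tP rf_sym.
have tt m v : e m (t m v) (t m v) = a (t m v) v by rewrite tP.
have t_ge0 m v : 0 <= a (t m v) v by rewrite -tt rf_ge0.
have tdist i j v : (i <= j)%N ->
    a (t i v - t j v) (t i v - t j v) <= a (t i v) v - a (t j v) v.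
  move=> ij; apply: le_trans (ae i _) _.
  rewrite !rfE tP (rf_sym (e i) (t i v)) tP.
  by have := e_mono (t j v) ij; rewrite tt; lra.
have /choice[T TP] : forall v, exists l, rlim a (t^~ v) l.
  move=> v; apply: Ha.2.
  apply: (@monotone_cauchy _ _ _ _ a _ (fun m => - a (t m v) v) 0).
    by move=> n; rewrite oppr_le0.
  by move=> i j /tdist h; apply: le_trans (h v) _; rewrite opprK addrC.
have TL : rlinear inK T by exact: rlinear_lim TP.
have Tv v : (fun m => a (t m v) v) @ \oo --> a (T v) v by exact: rlim_forml.
have elim_ m x l : rlim a x l -> rlim (e m) x l.
  have [C eC] := eb m => xl.
  apply: (@rlim_le _ _ _ _ _ _ _ (fun n => Num.sqrt `|C| * rnorm a (x n - l))).
    move=> n; rewrite -sqrtrM// ler_wsqrtr//; apply: le_trans (eC _) _.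
    by rewrite ler_wpM2r ?rf_ge0// ler_norm.
  by rewrite -[X in _ --> X](mulr0 (Num.sqrt `|C|)); apply: cvgM => //; exact: cvg_cst.
exists T; split => //.
- exact: symmetric_lim TP.
- move=> m v.
  have h1 : (fun k => e m (t (k + m)%N v) (t (k + m)%N v)) @ \oo --> e m (T v) (T v).
    rewrite (cvg_shiftn m (fun k => e m (t k v) (t k v))).
    exact: (rlim_form (elim_ m _ _ (TP v)) (elim_ m _ _ (TP v))).
  have h2 : (fun k => a (t (k + m)%N v) v) @ \oo --> a (T v) v.
    by rewrite (cvg_shiftn m (fun k => a (t k v) v)).
  rewrite -subr_ge0; apply: (cvg_seq_lb (cvgB h2 h1)) => k.
  by rewrite /= subr_ge0 -tt e_mono// leq_addl.
- move=> z C hC v; rewrite -subr_ge0.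
  have h2 : (fun m => C * a (t m v) v - a z v ^+ 2) @ \oo --> C * a (T v) v - a z v ^+ 2.
    by apply: cvgB; [apply: cvgM; [exact: cvg_cst|]|exact: cvg_cst].
  apply: (cvg_seq_lb h2) => m.
  rewrite subr_ge0 -(tP m v) -tt; apply: le_trans (cauchy_schwarz_sqr _ _ _) _.
  by rewrite ler_wpM2r ?rf_ge0.
- move=> S S' c SL Sb adj eadj; apply: (commute_lim Ha SL Sb _ TP) => m v.
  by apply/esym/tuniq => w; rewrite -eadj tP adj.
Qed.

(** The range criterion of Douglas: if [a z v] is controlled by the norm of
    [g v], then [g v |-> a z v] is a bounded functional on the range of [g],
    represented by some [z'], and [g z' = z] by symmetry of [g]. *)
Lemma range_of_symmetric (g : V -> V) z C :
  rlinear inK g -> rbounded a a 1 g -> (forall u v, a (g u) v = a u (g v)) ->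
  (forall v, a z v ^+ 2 <= C * a (g v) (g v)) -> exists z', g z' = z.
Proof.
move=> gL gb gs zb.
have [|||x [_ xc xv]] :=
  @riesz_sequence _ _ _ _ (pullback_form a gL) setT (a z) C rsubspaceT.
- by move=> u v _ _; rewrite rfDr.
- by move=> r u _; rewrite rfZr.
- by move=> u _; exact: zb.
have [|z' xz] := Ha.2 (g \o x).
  move=> d /xc[N NP]; exists N => i j Ni Nj /=.
  by rewrite -(rlinearB _ _ gL); exact: NP.
exists z'; apply: (form_ext Ha) => w.
rewrite -gs; apply/esym; rewrite rf_sym; apply: (cvg_seq_unique (xv w I)).
exact: rlim_formr.
Qed.

(** Take for [g] the square root of the operator [T] of
    [increasing_forms_inverse]: formally [g] is the inverse square root of the
    supremum of the forms, so its range is the set of vectors on which they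
    stay bounded. *)
Lemma increasing_forms_factorization : exists g : V -> V,
  [/\ rlinear inK g, forall u v, a (g u) v = a u (g v), rbounded a a 1 g,
      forall m v, e m (g (g v)) (g (g v)) <= a (g v) (g v)
    & (forall z C, (forall m, e m z z <= C) -> exists z', g z' = z) /\
      forall S S' c, rlinear inK S -> rbounded a a c S ->
        (forall u v, a (S' u) v = a u (S v)) ->
        (forall m u v, e m (S' u) v = e m u (S v)) ->
        forall v, g (S v) = S (g v)].
Proof.
have [T [TL Tsym Te Tz Tcomm]] := increasing_forms_inverse.
have [|g [gL gs gg gcomm]] := square_root Ha TL Tsym.
  by move=> v; apply: le_trans (Te 0%N v); exact: ae.
have g2 v : a (g v) (g v) = a (T v) v by rewrite gs gg rf_sym.
have gb : rbounded a a 1 g.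
  move=> v; rewrite mul1r; apply: rnorm_le; first exact: rnorm_ge0.
  rewrite sqr_rnorm g2.
  have h : a (T v) (T v) <= a (T v) v by apply: le_trans (Te 0%N v); exact: ae.
  have := rf_ge0 a (v - T v); rewrite !rfE (rf_sym a v (T v)).
  by have := rf_ge0 a (T v); lra.
exists g; split => //.
- by move=> m v; rewrite gg g2.
split=> [z C zC|S S' c SL Sb adj eadj].
  by apply: (range_of_symmetric gL gb gs) => v; rewrite g2; exact: Tz zC v.
by apply: (gcomm _ _ SL Sb); exact: Tcomm Sb adj eadj.
Qed.

End IncreasingForms.
End InverseForm.

(** * Scalars, norms, and finite powers of a Hilbert space *)

(** What [R] and [R[i]] have in common as scalars of a normed module. The
    intertwiners take values in real or in complex Banach spaces, and one
    argument serves both. *)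
Record real_scalars (R : realType) (K : numFieldType)
    (inK : {rmorphism R -> K}) (re : K -> R) : Prop := RealScalars {
  reD : forall x y, re (x + y) = re x + re y;
  re_inKM : forall r x, re (inK r * x) = r * re x;
  re1 : re 1 = 1;
  inK_re : forall x, 0 <= x -> inK (re x) = x;
  inK_ge0 : forall r, (0 <= inK r) = (0 <= r) }.

Section ScalarNorm.
Context {R : realType} {K : numFieldType} {inK : {rmorphism R -> K}}.
Context {re : K -> R}.
Hypothesis KK : real_scalars inK re.

Lemma re_inK r : re (inK r) = r.
Proof. by rewrite -[inK r]mulr1 (re_inKM KK) (re1 KK) mulr1. Qed.
Lemma ler_inK r s : (inK r <= inK s) = (r <= s).
Proof. by rewrite -subr_ge0 -rmorphB (inK_ge0 KK) subr_ge0. Qed.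
Lemma ltr_inK r s : (inK r < inK s) = (r < s).
Proof. by rewrite !lt_neqAle ler_inK (inj_eq (fmorph_inj inK)). Qed.
Lemma inK_norm r : `|inK r| = inK `|r|.
Proof.
have [r0|r0] := leP 0 r; first by rewrite !ger0_norm ?(inK_ge0 KK).
by rewrite (ltr0_norm r0) ltr0_norm ?rmorphN// -(rmorph0 inK) ltr_inK.
Qed.

Definition re_norm (X : normedModType K) (v : X) : R := re `|v|.

Local Notation nrm := re_norm.

Section Norm.
Context {X : normedModType K}.
Implicit Types u v : X.

Lemma inK_nrm v : inK (nrm v) = `|v|.
Proof. by rewrite (inK_re KK). Qed.
Lemma nrm_ge0 v : 0 <= nrm v.
Proof. by rewrite -(inK_ge0 KK) inK_nrm. Qed.
Lemma nrmD u v : nrm (u + v) <= nrm u + nrm v.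
Proof. by rewrite -ler_inK rmorphD !inK_nrm ler_normD. Qed.
Lemma nrm0 : nrm (0 : X) = 0.
Proof. by apply: (fmorph_inj inK); rewrite inK_nrm normr0 rmorph0. Qed.
Lemma nrm_eq0 v : nrm v = 0 -> v = 0.
Proof. by move=> h; apply/eqP; rewrite -normr_eq0 -inK_nrm h rmorph0. Qed.
Lemma nrmN v : nrm (- v) = nrm v.
Proof. by rewrite /nrm normrN. Qed.
Lemma nrm_distC u v : nrm (u - v) = nrm (v - u).
Proof. by rewrite /nrm distrC. Qed.
Lemma nrmZ r v : nrm (inK r *: v) = `|r| * nrm v.
Proof. by apply: (fmorph_inj inK); rewrite inK_nrm normrZ inK_norm rmorphM inK_nrm. Qed.
Lemma nrm_sub_trans w u v : nrm (u - v) <= nrm (u - w) + nrm (w - v).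
Proof. by rewrite -[u - v](subrKA w) nrmD. Qed.
Lemma nrm_sum (I : Type) (r : seq I) (P : pred I) (F : I -> X) :
  nrm (\sum_(i <- r | P i) F i) <= \sum_(i <- r | P i) nrm (F i).
Proof.
elim/big_rec2: _ => [|i y1 y2 _ h]; first by rewrite nrm0.
by apply: le_trans (nrmD _ _) _; rewrite lerD2l.
Qed.

Lemma closure_nrm (A : set X) v :
  closure A v <-> forall e : R, 0 < e -> exists2 w, A w & nrm (v - w) < e.
Proof.
split=> [Av e e0|h].
  have [|w [Aw vw]] := Av (ball v (inK e)).
    by apply: nbhsx_ballx; rewrite -(rmorph0 inK) ltr_inK.
  by exists w => //; move: vw; rewrite -ball_normE /ball_ /= -inK_nrm ltr_inK.
move=> B /nbhs_ballP[e /= e0 vB].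
have ee : inK (re e) = e by rewrite (inK_re KK)// ltW.
have [|w Aw vw] := h (re e); first by rewrite -ltr_inK ee rmorph0.
exists w; split => //; apply: vB.
by rewrite -ball_normE /ball_ /= -inK_nrm -ee ltr_inK.
Qed.

End Norm.

Lemma nrm_complete (X : completeNormedModType K) (x : nat -> X) :
  (forall e : R, 0 < e -> exists N, forall i j, (N <= i)%N -> (N <= j)%N ->
    nrm (x i - x j) <= e) ->
  exists l, forall e : R, 0 < e -> exists N, forall n, (N <= n)%N ->
    nrm (x n - l) <= e.
Proof.
move=> xc.
have reP (e : K) : 0 < e -> 0 < re e /\ inK (re e) = e.
  move=> e0; have ee : inK (re e) = e by rewrite (inK_re KK)// ltW.
  by rewrite -ltr_inK ee rmorph0.
have xcvg : cvg (x @ \oo).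
  apply: cauchy_cvg; apply: cauchy_exP => e /reP[e0 ee].
  have [|N NP] := xc (re e / 2); first by rewrite divr_gt0.
  exists (x N); exists N => // n /= Nn.
  rewrite -ball_normE /ball_ /= -inK_nrm -ee ltr_inK.
  by apply: le_lt_trans (NP _ _ (leqnn N) Nn) _; rewrite ltr_pdivrMr// ltr_pMr// ltr1n.
exists (lim (x @ \oo)) => e e0.
have /cvgrPdist_le/(_ (inK e)) := xcvg.
rewrite -{1}(rmorph0 inK) ltr_inK => /(_ e0)[N _ NP].
by exists N => n /NP /=; rewrite -inK_nrm ler_inK nrm_distC.
Qed.

Section InnerForm.
Context {conj : K -> K} {X : normedModType K} (ip : inner_product conj X).
Hypothesis re_conj : forall x, re (conj x) = re x.

Lemma ip_sym u v : ip u v = conj (ip v u).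
Proof.
have := @hermitian_subproof _ _ _ _ ip u v.
by rewrite expr0 mul1r.
Qed.

Definition re_form : @rform R K inK X.
Proof.
apply: (@RForm _ _ _ _ (fun u v => re (ip u v))).
- by move=> u v; rewrite ip_sym re_conj.
- by move=> u v w; rewrite linearDl /= (reD KK).
- by move=> r u v; rewrite linearZl_LR /= (re_inKM KK).
- by move=> u; rewrite -ip_norm -inK_nrm -rmorphXn re_inK sqr_ge0.
Defined.

Lemma rnorm_re_form v : rnorm re_form v = nrm v.
Proof.
rewrite /rnorm /= -ip_norm -inK_nrm -rmorphXn re_inK sqrtr_sqr ger0_norm//.
exact: nrm_ge0.
Qed.

End InnerForm.

Lemma re_form_hilbert (conj : K -> K) (X : completeNormedModType K)
   (ip : inner_product conj X) (re_conj : forall x, re (conj x) = re x) :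
  hilbert (re_form ip re_conj).
Proof.
split=> [v v0|x xc].
  by apply: nrm_eq0; rewrite -(rnorm_re_form ip re_conj) /rnorm v0 sqrtr0.
have [|l xl] := @nrm_complete X x.
  move=> e /xc[N NP]; exists N => i j Ni Nj.
  by rewrite -(rnorm_re_form ip re_conj); exact: NP.
exists l; apply/rlimP => e /xl[N NP]; exists N => n Nn.
by rewrite rnorm_re_form; exact: NP.
Qed.

End ScalarNorm.

Lemma cvg_seq_sum (R : realType) (I : Type) (r : seq I) (f : I -> nat -> R)
    (l : I -> R) : (forall i, f i @ \oo --> l i) ->
  (fun n => \sum_(i <- r) f i n) @ \oo --> \sum_(i <- r) l i.
Proof.
move=> fl; elim: r => [|i r IH].
  by rewrite big_nil; under eq_fun do rewrite big_nil; exact: cvg_cst.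
by rewrite big_cons; under eq_fun do rewrite big_cons; exact: cvgD.
Qed.

Section Power.
Context {R : realType} {K : pzRingType} {inK : {rmorphism R -> K}}.
Context {V : lmodType K} (a : @rform R K inK V) (n : nat).
Local Notation W := ('I_n -> V).

Definition power_form : @rform R K inK W.
Proof.
apply: (@RForm _ _ _ W (fun u v => \sum_j a (u j) (v j))).
- by move=> u v; apply: eq_bigr => j _; rewrite rf_sym.
- by move=> u v w; rewrite -big_split /=; apply: eq_bigr => j _; rewrite -rfDl.
- by move=> r u v; rewrite mulr_sumr; apply: eq_bigr => j _; rewrite -rfZl.
- by move=> u; apply: sumr_ge0 => j _; exact: rf_ge0.
Defined.

Lemma power_formE (u v : W) : power_form u v = \sum_j a (u j) (v j).
Proof. by []. Qed.

Lemma rnorm_coord (u : W) j : rnorm a (u j) <= rnorm power_form u.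
Proof.
rewrite ler_wsqrtr// power_formE (bigD1 j)//= lerDl.
by apply: sumr_ge0 => i _; exact: rf_ge0.
Qed.

Lemma power_hilbert : hilbert a -> hilbert power_form.
Proof.
move=> [a0 ac]; split=> [v v0|x xc].
  apply/funext => j; apply: a0; apply/eqP; rewrite eq_le rf_ge0 andbT.
  rewrite -v0 power_formE (bigD1 j)//= lerDl.
  by apply: sumr_ge0 => i _; exact: rf_ge0.
have /choice[l xl] : forall j, exists l, rlim a (fun k => x k j) l.
  move=> j; apply: ac => e /xc[N NP]; exists N => p q Np Nq.
  by apply: le_trans (NP p q Np Nq); exact: (rnorm_coord (x p - x q) j).
exists l; pose d k := Num.sqrt (power_form (x k - l) (x k - l)).
apply: (@rlim_le _ _ _ _ _ _ _ d) => //.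
rewrite [X in _ --> X](_ : 0 = Num.sqrt 0); last by rewrite sqrtr0.
apply: continuous_cvg; first exact: sqrt_continuous.
rewrite (_ : 0 = \sum_(j < n) (0 : R)); last by rewrite big1.
under eq_fun do rewrite power_formE.
apply: cvg_seq_sum => j; under eq_fun do rewrite -sqr_rnorm expr2.
have xj : (fun k => rnorm a (x k j - l j)) @ \oo --> (0 : R) := xl j.
by have := cvgM xj xj; rewrite mulr0; exact.
Qed.

End Power.

(** * Bounded operators and geometric estimates *)

(** The hypothesis controls [Y g] on the range of [g]. Its adjoint satisfies
    [|g (Y' h)|^2 = b (Y (g (g (Y' h)))) h <= |g (Y' h)| |h|], so it is a
    contraction on the whole space, and then so is [Y g]. *)
Lemma rescaled_row_contraction (R : realType) (K : pzRingType)
    (inK : {rmorphism R -> K}) (V W : lmodType K)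
    (a : @rform R K inK V) (b : @rform R K inK W)
    (g : V -> V) (Y : V -> W) (Y' : W -> V) :
  (forall u v, a (g u) v = a u (g v)) ->
  (forall u h, b (Y u) h = a u (Y' h)) ->
  (forall v, rnorm b (Y (g (g v))) <= rnorm a (g v)) ->
  rbounded a b 1 (Y \o g).
Proof.
move=> gs adj Yg u; rewrite mul1r /=.
have gY h : rnorm a (g (Y' h)) <= rnorm b h.
  set z := Y' h; have [->|gz0] := eqVneq (rnorm a (g z)) 0; first exact: rnorm_ge0.
  have gzp : 0 < rnorm a (g z) by rewrite lt_neqAle eq_sym gz0 rnorm_ge0.
  rewrite -(ler_pM2l gzp) -expr2 sqr_rnorm -gs -adj.
  apply: le_trans (ler_norm _) _; apply: le_trans (cauchy_schwarz _ _ _) _.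
  by rewrite ler_wpM2r ?rnorm_ge0.
set h := Y (g u); have [->|h0] := eqVneq (rnorm b h) 0; first exact: rnorm_ge0.
have hp : 0 < rnorm b h by rewrite lt_neqAle eq_sym h0 rnorm_ge0.
rewrite -(ler_pM2r hp) -expr2 sqr_rnorm adj gs.
apply: le_trans (ler_norm _) _; apply: le_trans (cauchy_schwarz _ _ _) _.
by rewrite ler_wpM2l ?rnorm_ge0.
Qed.

Section Operators.
Context {R : realType} {K : numFieldType} {inK : {rmorphism R -> K}}.
Context {re : K -> R}.
Hypothesis KK : real_scalars inK re.
Local Notation nrm := (re_norm (re := re)).

Lemma linearD_of (V W : lmodType K) (f : V -> W) u v : linear f -> f (u + v) = f u + f v.
Proof. by move=> fl; have := fl 1 u v; rewrite !scale1r. Qed.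
Lemma linear0_of (V W : lmodType K) (f : V -> W) : linear f -> f 0 = 0.
Proof. by move=> fl; apply: (addIr (f 0)); rewrite -linearD_of// !add0r. Qed.
Lemma linearZ_of (V W : lmodType K) (f : V -> W) c u : linear f -> f (c *: u) = c *: f u.
Proof. by move=> fl; have := fl c u 0; rewrite (linear0_of fl) !addr0. Qed.

Lemma linear_rlinear (V W : lmodType K) (f : V -> W) : linear f -> rlinear inK f.
Proof. by move=> fl; split=> *; [exact: linearD_of|exact: linearZ_of]. Qed.

Lemma bounded_opP (X : normedModType K) (f : X -> X) :
  bounded_op f <->
  linear f /\ exists2 c : R, 0 <= c & forall v, nrm (f v) <= c * nrm v.
Proof.
split=> [[fl [c fc]]|[fl [c c0 fc]]]; split => //; last first.
  by exists (inK c) => v; rewrite -!(inK_nrm KK) -rmorphM (ler_inK KK).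
exists (re `|c|) => [|v].
  by rewrite -(inK_ge0 KK) (inK_re KK).
rewrite -(ler_inK KK) rmorphM !(inK_nrm KK) ?(inK_re KK)//.
have h := fc v; have p : 0 <= c * `|v| by apply: le_trans h.
by move: p h => /ger0_norm; rewrite normrM normr_id => ->.
Qed.

Lemma geometric_cauchy (X : normedModType K) (x : nat -> X) (c : R) :
  (forall n, nrm (x n.+1 - x n) <= c * 2^-1 ^+ n) ->
  (forall n, nrm (x n - x 0%N) <= 2 * c) /\
  (forall e : R, 0 < e -> exists N, forall i j, (N <= i)%N -> (N <= j)%N ->
    nrm (x i - x j) <= e).
Proof.
move=> h.
have c0 : 0 <= c by have := h 0%N; rewrite expr0 mulr1; apply: le_trans; exact: (nrm_ge0 KK).
have dist i k : nrm (x (k + i)%N - x i) <= 2 * c * (2^-1 ^+ i - 2^-1 ^+ (k + i)).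
  elim: k => [|k IH]; first by rewrite !subrr mulr0 (nrm0 KK).
  rewrite addSn; apply: le_trans (nrm_sub_trans KK (x (k + i)%N) _ _) _.
  by have := h (k + i)%N; rewrite exprS; lra.
have half_ge0 i : 0 <= 2^-1 ^+ i :> R by rewrite exprn_ge0.
split=> [n|e e0].
  have := dist 0%N n; rewrite addn0 expr0 => /le_trans; apply.
  by have := half_ge0 n; nra.
have : (fun n => 2 * c * 2^-1 ^+ n) @ \oo --> (0 : R).
  rewrite -[X in _ --> X](mulr0 (2 * c)); apply: cvgM; first exact: cvg_cst.
  by apply: cvg_expr; rewrite ger0_norm// invf_lt1// ltr1n.
move=> /cvgrPdist_le/(_ e e0)[N _ NP]; exists N.
have hw i j : (N <= i)%N -> (i <= j)%N -> nrm (x j - x i) <= e.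
  move=> Ni /subnK <-; apply: le_trans (dist _ _) _.
  have := NP i Ni; rewrite /= sub0r normrN ger0_norm ?mulr_ge0//.
  by have := half_ge0 (j - i + i)%N; nra.
move=> i j Ni Nj; case: (leqP i j) => ij; last exact: hw (ltnW ij).
by rewrite nrm_distC; exact: hw.
Qed.

End Operators.

Section Complex.
Context {R : realType}.

Lemma complex_scalars : real_scalars (real_complex R) (@complex.Re R).
Proof.
split.
- by move=> [a b] [c d].
- by move=> r [a b] /=; rewrite mul0r subr0.
- by [].
- by move=> x x0; apply: RRe_real; exact: ger0_real.
- by move=> r; rewrite ler0c.
Qed.

Lemma real_real_scalars : real_scalars (idfun : {rmorphism R -> R}) idfun.
Proof. by split. Qed.

Lemma conjcE (x : R[i]) : Num.conj x = conjc x.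
Proof. by []. Qed.

Lemma Re_conjK (x : R[i]) : complex.Re (Num.conj x) = complex.Re x.
Proof. by case: x. Qed.

Lemma Im_Re (x : R[i]) : complex.Im x = - complex.Re ('i * x).
Proof. by case: x => a b /=; rewrite mul0r mul1r sub0r opprK. Qed.

End Complex.

(** * Von Neumann algebras and their commutants *)

Section VNFacts.
Context {R : realType} {H : completeNormedModType R[i]}.
Variable ip : inner_product (@Num.conj R[i]) H.
Local Notation inC := (real_complex R).
Local Notation CC := (@complex_scalars R).
Local Notation nrm := (re_norm (re := @complex.Re R)).

Definition hform : @rform R _ inC H := re_form complex_scalars ip (@Re_conjK R).
Local Notation Hb := hform.

Lemma hform_hilbert : hilbert Hb. Proof. exact: re_form_hilbert. Qed.
Lemma rnorm_hform v : rnorm Hb v = nrm v. Proof. exact: rnorm_re_form. Qed.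
Lemma hformE u v : Hb u v = complex.Re (ip u v). Proof. by []. Qed.

Lemma ip_ext (c d : R[i]) :
  (forall l : R[i], complex.Re (l * c) = complex.Re (l * d)) -> c = d.
Proof.
move=> h; have := h 1; rewrite !mul1r => hr; have hi := h 'i.
by rewrite [c]complexE [d]complexE hr !Im_Re hi.
Qed.

(** For a complex linear [x] the imaginary part of [ip (x v) w] is the real
    part at [- 'i v], so real adjoints are complex adjoints. *)
Lemma adjoint_hform x y : linear x ->
  adjoint_of ip x y <-> forall v w, Hb (x v) w = Hb v (y w).
Proof.
move=> xl; split=> [h v w|h v w]; first by rewrite !hformE h.
apply: ip_ext => l.
by rewrite -!linearZl_LR /= -linearZ_of//; exact: h.
Qed.

Lemma bounded_op_rbounded x : bounded_op x ->
  rlinear inC x /\ exists2 c, 0 <= c & rbounded Hb Hb c x.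
Proof.
move=> /(bounded_opP CC)[xl [c c0 xc]]; split; first exact: linear_rlinear.
by exists c => // v; rewrite !rnorm_hform.
Qed.

Lemma adjoint_exists x : bounded_op x -> exists2 y, bounded_op y & adjoint_of ip x y.
Proof.
move=> xb; have [xL [c c0 xc]] := bounded_op_rbounded xb.
have xl : linear x by case: xb.
have : forall w, exists u, forall v, Hb v u = Hb (x v) w.
  move=> w.
  have [|||s [_ sc sP]] := @riesz_sequence _ _ _ _ Hb setT
    (fun v => Hb (x v) w) (c ^+ 2 * Hb w w) (rsubspaceT).
  - by move=> u v _ _; rewrite xL.1 rfDl.
  - by move=> r u _; rewrite xL.2 rfZl.
  - move=> u _; apply: le_trans (cauchy_schwarz_sqr _ _ _) _.
    rewrite mulrC [c ^+ 2 * _]mulrC -mulrA ler_wpM2l ?rf_ge0//.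
    rewrite -!sqr_rnorm -exprMn ler_pXn2r ?nnegrE ?mulr_ge0 ?rnorm_ge0//.
  have [u su] := hform_hilbert.2 _ sc; exists u => v.
  by apply: (cvg_seq_unique (rlim_formr (w := v) su)); exact: sP.
move=> /choice[y yP].
have yadj : adjoint_of ip x y by apply/adjoint_hform => // v w; rewrite yP.
exists y => //.
have yadj' v w : ip v (y w) = ip (x v) w by rewrite yadj.
apply/(bounded_opP CC); split.
  move=> a u v; apply: (form_ext hform_hilbert) => w; rewrite !hformE.
  by rewrite linearDr linearZr_LR /= !yadj' linearDr linearZr_LR.
exists c => // v; rewrite -!rnorm_hform.
have [->|y0] := eqVneq (rnorm Hb (y v)) 0; first by rewrite mulr_ge0 ?rnorm_ge0.
have yp : 0 < rnorm Hb (y v) by rewrite lt_neqAle eq_sym y0 rnorm_ge0.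
rewrite -(ler_pM2l yp) -expr2 sqr_rnorm yP.
apply: le_trans (ler_norm _) _; apply: le_trans (cauchy_schwarz _ _ _) _.
rewrite mulrCA mulrA ler_wpM2r ?rnorm_ge0//; exact: xc.
Qed.

Variable M : set (H -> H).
Hypothesis vnM : von_neumann_algebra ip M.
Local Notation N := (commutant M).

Lemma vn_linear x : M x -> linear x.
Proof. by move=> /(vna_bounded vnM)[]. Qed.

Lemma vn_zero : M 0.
Proof.
have := vna_lin vnM (-1) (vna_one vnM) (vna_one vnM).
by rewrite scaleN1r addNr.
Qed.
Lemma vn_add x y : M x -> M y -> M (x + y).
Proof. by move=> Mx My; have := vna_lin vnM 1 Mx My; rewrite scale1r. Qed.
Lemma vn_scale c x : M x -> M (c *: x).
Proof. by move=> Mx; have := vna_lin vnM c Mx vn_zero; rewrite addr0. Qed.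
Lemma vn_sub x y : M x -> M y -> M (x - y).
Proof. by move=> Mx My; rewrite -scaleN1r; apply: vn_add => //; exact: vn_scale. Qed.

Lemma commutantE s x v : N s -> M x -> s (x v) = x (s v).
Proof. by move=> [_ h] Mx; have := h x Mx => /(congr1 (fun f => f v)). Qed.

Lemma commutant_linear s : N s -> linear s.
Proof. by move=> [[]]. Qed.

Lemma commutant_scalar c : N (fun v => c *: v).
Proof.
split=> [|x Mx]; last by apply/funext => v /=; rewrite linearZ_of//; exact: vn_linear.
split=> [l u v|]; last by exists `|c| => v; rewrite normrZ.
by rewrite scalerDr !scalerA mulrC.
Qed.

Lemma commutant_lin c x y : N x -> N y -> N (c *: x + y).
Proof.
move=> Nx Ny; have E v : (c *: x + y) v = c *: x v + y v by [].
split=> [|z Mz]; last first.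
  apply/funext => v /=; have zl := vn_linear Mz.
  rewrite !E (commutantE _ Nx Mz) (commutantE _ Ny Mz).
  by rewrite (linearD_of _ _ zl) (linearZ_of _ _ zl).
have /(bounded_opP CC)[xl [cx cx0 xb]] := Nx.1.
have /(bounded_opP CC)[yl [cy cy0 yb]] := Ny.1.
apply/(bounded_opP CC); split.
  move=> l u v; rewrite !E xl yl !scalerDr !scalerA mulrC.
  by rewrite addrACA -!scalerA.
have nc0 : 0 <= complex.Re `|c| by rewrite -(inK_ge0 CC) (inK_re CC).
exists (complex.Re `|c| * cx + cy) => [|v]; first by rewrite addr_ge0 ?mulr_ge0.
rewrite E; apply: le_trans (nrmD CC _ _) _.
rewrite mulrDl lerD//.
have -> : nrm (c *: x v) = complex.Re `|c| * nrm (x v).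
  apply: complexI; rewrite (inK_nrm CC) normrZ rmorphM.
  by rewrite (inK_nrm CC) (inK_re CC).
by rewrite -mulrA ler_wpM2l.
Qed.

Lemma commutant_comp x y : N x -> N y -> N (x \o y).
Proof.
move=> Nx Ny; split=> [|z Mz]; last first.
  by apply/funext => v /=; rewrite !(commutantE _ _ Mz).
have /(bounded_opP CC)[xl [cx cx0 xb]] := Nx.1.
have /(bounded_opP CC)[yl [cy cy0 yb]] := Ny.1.
apply/(bounded_opP CC); split; first by move=> l u v /=; rewrite yl xl.
exists (cx * cy) => [|v] /=; first exact: mulr_ge0.
by apply: le_trans (xb _) _; rewrite -mulrA ler_wpM2l.
Qed.

Lemma commutant_adjoint x : N x -> exists2 y, N y & adjoint_of ip x y.
Proof.
move=> Nx; have [y yb xy] := adjoint_exists Nx.1; exists y => //.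
split=> // z Mz; have [z' Mz' zz'] := vna_adj vnM Mz.
apply/funext => v /=; apply: (form_ext hform_hilbert) => w; rewrite !hformE.
have zz'' a b : ip a (z b) = ip (z' a) b.
  by rewrite (ip_sym ip) zz' -(ip_sym ip).
by rewrite -xy zz'' zz'' -xy (commutantE _ Nx Mz').
Qed.

(** The form in which the bicommutant property is used: to belong to [M] it
    is enough to be bounded and to commute with the commutant. *)
Lemma bicommutantP x : linear x ->
  (exists2 c : R, 0 <= c & forall v, nrm (x v) <= c * nrm v) ->
  (forall s v, N s -> x (s v) = s (x v)) -> M x.
Proof.
move=> xl xb xs; rewrite -(vna_bicommutant vnM); split.
  exact/(bounded_opP CC).
by move=> s Ns; apply/funext => v /=; exact: xs.
Qed.

End VNFacts.

(** * Bounding a summable family of operators by a change of vector *)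

Section FamilyFactorization.
Context {R : realType} {K : pzRingType} {inK : {rmorphism R -> K}}.
Context {V W : lmodType K} {a : @rform R K inK V} {b : @rform R K inK W}.
Hypothesis Ha : hilbert a.
Variable Y : nat -> nat -> V -> W.
Hypothesis YL : forall k l, rlinear inK (Y k l).
Hypothesis Yb : forall k l, exists c, rbounded a b c (Y k l).
Hypothesis Yadj : forall k l, exists Y', forall u h, b (Y k l u) h = a u (Y' h).

Definition partial_graph_form (m : nat) : @rform R K inK V.
Proof.
apply: (@RForm _ _ _ V (fun u v =>
  a u v + \sum_(k < m) \sum_(l < m) b (Y k l u) (Y k l v))).
- move=> u v; rewrite rf_sym; congr (_ + _).
  by apply: eq_bigr => k _; apply: eq_bigr => l _; rewrite rf_sym.
- move=> u v w; rewrite rfDl addrACA -big_split; congr (_ + _) => /=.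
  apply: eq_bigr => k _; rewrite -big_split; apply: eq_bigr => l _ /=.
  by rewrite (YL _ _).1 rfDl.
- move=> r u v; rewrite rfZl mulrDr mulr_sumr; congr (_ + _).
  apply: eq_bigr => k _; rewrite mulr_sumr; apply: eq_bigr => l _.
  by rewrite (YL _ _).2 rfZl.
- move=> u; rewrite addr_ge0 ?rf_ge0//.
  by apply: sumr_ge0 => k _; apply: sumr_ge0 => l _; exact: rf_ge0.
Defined.
Local Notation e := partial_graph_form.

Lemma partial_graph_formE m u v :
  e m u v = a u v + \sum_(k < m) \sum_(l < m) b (Y k l u) (Y k l v).
Proof. by []. Qed.

Lemma geometric_sum_le (m : nat) : \sum_(k < m) 4^-1 ^+ k <= 2 :> R.
Proof.
suff : \sum_(k < m) 4^-1 ^+ k + 2 * 4^-1 ^+ m <= 2 :> R.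
  by apply: le_trans; rewrite lerDl mulr_ge0// exprn_ge0.
elim: m => [|m IH]; first by rewrite big_ord0 expr0; lra.
rewrite big_ord_recr /=; apply: le_trans _ IH; rewrite -addrA lerD2l exprS.
by have : 0 <= 4^-1 ^+ m :> R; [rewrite exprn_ge0|lra].
Qed.

(** If [|Y k l z|^2] is dominated by a geometric double sequence, it is
    summable. The positive operator
    [1 + sum Y* Y] may be unbounded, but [z] is in the domain of its square
    root, so [z] is the image under the bounded inverse square root [g] of a
    vector [z'], and every [Y k l] composed with [g] is a contraction. The
    partial sums are the increasing forms to which
    [increasing_forms_factorization] applies. *)
Lemma family_factorization : exists g : V -> V,
  [/\ rlinear inK g, rbounded a a 1 g,
      forall k l, rbounded a b 1 (Y k l \o g),
      forall z C, 0 <= C ->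
        (forall k l, b (Y k l z) (Y k l z) <= C * (4^-1 ^+ k * 4^-1 ^+ l)) ->
        exists z', g z' = z
    & forall S S' T T' c, rlinear inK S -> rbounded a a c S ->
        (forall u v, a (S' u) v = a u (S v)) ->
        (forall u v, b (T' u) v = b u (T v)) ->
        (forall k l u, Y k l (S u) = T (Y k l u)) ->
        (forall k l u, Y k l (S' u) = T' (Y k l u)) ->
        forall v, g (S v) = S (g v)].
Proof.
have bY0 k l u : 0 <= b (Y k l u) (Y k l u) by exact: rf_ge0.
have ae m v : a v v <= e m v v.
  rewrite partial_graph_formE lerDl.
  by apply: sumr_ge0 => k _; apply: sumr_ge0.
have eb m : exists C, forall v, e m v v <= C * a v v.
  have /choice[c cP] : forall p : nat * nat, exists c, rbounded a b c (Y p.1 p.2).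
    by move=> [k l]; exact: Yb.
  exists (1 + \sum_(k < m) \sum_(l < m) (c (k : nat, l : nat)) ^+ 2) => v.
  rewrite partial_graph_formE mulrDl mul1r lerD2l mulr_suml.
  apply: ler_sum => k _; rewrite mulr_suml; apply: ler_sum => l _.
  rewrite -!sqr_rnorm -exprMn; have := cP (k : nat, l : nat) v => h.
  have h0 := rnorm_ge0 b (Y k l v).
  by rewrite ler_pXn2r ?nnegrE// (le_trans h0).
have eS m v : e m v v <= e m.+1 v v.
  rewrite !partial_graph_formE lerD2l big_ord_recr /= -[leLHS]addr0.
  apply: lerD; last exact: sumr_ge0.
  by apply: ler_sum => k _; rewrite big_ord_recr /= lerDl.
have [g [gL gs gb ge [gz gcomm]]] := increasing_forms_factorization Ha ae eb eS.
exists g; split => //.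
- move=> k l; have [Y' YY'] := Yadj k l.
  apply: (rescaled_row_contraction gs YY') => v.
  rewrite ler_wsqrtr//; apply: le_trans (ge (maxn k l).+1 v).
  have kP : (k < (maxn k l).+1)%N by rewrite ltnS leq_maxl.
  have lP : (l < (maxn k l).+1)%N by rewrite ltnS leq_maxr.
  rewrite partial_graph_formE (bigD1 (Ordinal kP))//= (bigD1 (Ordinal lP))//=.
  rewrite addrCA -[leLHS]addr0 -!addrA lerD2l !addr_ge0 ?rf_ge0//.
    by apply: sumr_ge0.
  by apply: sumr_ge0 => i _; apply: sumr_ge0.
- move=> z C C0 zC; apply: (gz z (a z z + C * 4)) => m.
  rewrite partial_graph_formE lerD2l.
  apply: (@le_trans _ _ (\sum_(k < m) \sum_(l < m) C * (4^-1 ^+ k * 4^-1 ^+ l))).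
    by apply: ler_sum => k _; apply: ler_sum.
  under eq_bigr do rewrite -mulr_sumr -mulr_sumr.
  rewrite -mulr_sumr ler_wpM2l// -mulr_suml.
  have := geometric_sum_le m.
  have : 0 <= \sum_(k < m) 4^-1 ^+ k :> R by apply: sumr_ge0 => k _; rewrite exprn_ge0.
  by move: (\sum_(k < m) _) => x; nra.
- move=> S S' T T' c SL Sb aS bT YS YS'; apply: (gcomm S S' c SL Sb aS) => m u v.
  rewrite !partial_graph_formE aS; congr (_ + _).
  apply: eq_bigr => k _; apply: eq_bigr => l _.
  by rewrite YS YS' bT.
Qed.

End FamilyFactorization.

(** * Rows of operators *)

Section Rows.
Context {R : realType} {H : completeNormedModType R[i]}.
Variable ip : inner_product (@Num.conj R[i]) H.
Variable M : set (H -> H).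
Hypothesis vnM : von_neumann_algebra ip M.
Local Notation inC := (real_complex R).
Local Notation CC := (@complex_scalars R).
Local Notation nrm := (re_norm (re := @complex.Re R)).
Local Notation Hb := (hform ip).
Local Notation N := (commutant M).
Variable n : nat.
Local Notation W := ('I_n -> H).
Local Notation Wb := (power_form Hb n).

Definition row_op (r : 'I_n -> H -> H) (u : W) : H := \sum_j r j (u j).
Definition diag_op (s : H -> H) (u : W) : W := fun j => s (u j).

Lemma row_op_linear r : (forall j, M (r j)) -> linear (row_op r).
Proof.
move=> Mr c u v; rewrite /row_op scaler_sumr -big_split; apply: eq_bigr => j _ /=.
by rewrite -(vn_linear vnM (Mr j)).
Qed.

Lemma row_op_bounded r : (forall j, M (r j)) -> exists c, rbounded Wb Hb c (row_op r).
Proof.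
move=> Mr.
have /choice[c cP] : forall j, exists c, 0 <= c /\ rbounded Hb Hb c (r j).
  move=> j; have [_ [c c0 h]] := bounded_op_rbounded ip (vna_bounded vnM (Mr j)).
  by exists c.
exists (\sum_j c j) => u; rewrite rnorm_hform mulr_suml.
apply: le_trans (nrm_sum CC _ _ _) _; apply: ler_sum => j _.
rewrite -(rnorm_hform ip); apply: le_trans ((cP j).2 _) _.
by rewrite ler_wpM2l ?rnorm_coord//; case: (cP j).
Qed.

Lemma row_op_adjoint r : (forall j, M (r j)) ->
  exists r' : H -> W, forall u h, Hb (row_op r u) h = Wb u (r' h).
Proof.
move=> Mr.
have /choice[r' rP] : forall j, exists y, forall v w, Hb (r j v) w = Hb v (y w).
  move=> j; have [y _ ry] := vna_adj vnM (Mr j); exists y.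
  by apply/adjoint_hform => //; exact: vn_linear vnM _ (Mr j).
exists (fun h j => r' j h) => u h.
rewrite power_formE (big_morph (Hb^~ h) (fun x y => rfDl Hb x y h) (rf0l Hb h)).
by apply: eq_bigr => j _; rewrite -rP.
Qed.

Lemma row_op_diag r s u : N s -> (forall j, M (r j)) ->
  row_op r (diag_op s u) = s (row_op r u).
Proof.
move=> Ns Mr; have sl := commutant_linear Ns.
rewrite /row_op (big_morph s (fun x y => linearD_of x y sl) (linear0_of sl)).
by apply: eq_bigr => j _; rewrite /diag_op (commutantE _ Ns (Mr j)).
Qed.

Lemma diag_op_linear s : N s -> rlinear inC (diag_op s).
Proof.
move=> /commutant_linear/(linear_rlinear (inK := inC)) [sD sZ].
by split=> [u v|r u]; apply/funext => j; [exact: sD|exact: sZ].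
Qed.

Lemma diag_op_bounded s : N s -> exists c, rbounded Wb Wb c (diag_op s).
Proof.
move=> [sb _]; have [_ [c c0 h]] := bounded_op_rbounded ip sb.
exists c => u; apply: rnorm_le; first by rewrite mulr_ge0 ?rnorm_ge0.
rewrite exprMn sqr_rnorm !power_formE mulr_sumr; apply: ler_sum => j _.
rewrite -!sqr_rnorm -exprMn ler_pXn2r ?nnegrE ?mulr_ge0 ?rnorm_ge0//.
exact: h.
Qed.

Lemma diag_op_adjoint s s' : (forall v w, Hb (s v) w = Hb v (s' w)) ->
  forall u v, Wb (diag_op s u) v = Wb u (diag_op s' v).
Proof. by move=> h u v; rewrite !power_formE; apply: eq_bigr => j _; rewrite h. Qed.

Definition place (j : 'I_n) (h : H) : W := fun i => if i == j then h else 0.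

Lemma sum_place (u : W) : u = \sum_j place j (u j).
Proof.
apply/funext => i; rewrite fct_sumE (bigD1 i)//= /place eqxx big1 ?addr0// => j ji.
by rewrite eq_sym (negbTE ji).
Qed.

Lemma diag_place s j h : linear s -> diag_op s (place j h) = place j (s h).
Proof.
move=> sl; apply/funext => i; rewrite /diag_op /place.
by case: ifP => // _; exact: linear0_of.
Qed.

Lemma rnorm_place j h : rnorm Wb (place j h) = nrm h.
Proof.
rewrite -(rnorm_hform ip) /rnorm power_formE (bigD1 j)//= /place eqxx big1 ?addr0//.
by move=> i /negbTE ->; rewrite /= linear0l.
Qed.

(** A bounded map from a finite power of [H] to [H] that commutes with the
    commutant is a row of elements of [M], by the bicommutant property applied
    to its restrictions to the coordinates. *)
Lemma equivariant_rowP (X : W -> H) (c : R) : 0 <= c ->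
  (forall u v, X (u + v) = X u + X v) ->
  (forall u, nrm (X u) <= c * rnorm Wb u) ->
  (forall s u, N s -> X (diag_op s u) = s (X u)) ->
  exists x, [/\ forall j, M (x j), forall j v, nrm (x j v) <= c * nrm v
    & forall u, X u = \sum_j x j (u j)].
Proof.
move=> c0 XD Xb Xs.
have placeD j g h : place j (g + h) = place j g + place j h.
  apply/funext => i; have -> : (place j g + place j h) i = place j g i + place j h i by [].
  by rewrite /place; case: ifP => // _; rewrite addr0.
have xb j v : nrm (X (place j v)) <= c * nrm v by rewrite -(rnorm_place j v); exact: Xb.
exists (fun j h => X (place j h)); split => //; last first.
  move=> u; have X0 : X 0 = 0 by apply: (addIr (X 0)); rewrite -XD !add0r.
  rewrite {1}[u]sum_place (big_morph X XD X0). by [].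
move=> j; apply: (bicommutantP vnM); last 2 first.
- by exists c.
- by move=> s v Ns; rewrite -diag_place ?Xs//; exact: commutant_linear Ns.
move=> l u v; rewrite placeD XD; congr (_ + _).
rewrite -(Xs _ _ (commutant_scalar vnM l)); congr X.
by rewrite diag_place//; exact: commutant_linear (commutant_scalar vnM l).
Qed.

End Rows.

(** * Factorization of rapidly decreasing sequences *)

Section BoundedFactorization.
Context {R : realType} {H : completeNormedModType R[i]}.
Variable ip : inner_product (@Num.conj R[i]) H.
Variable M : set (H -> H).
Hypothesis vnM : von_neumann_algebra ip M.
Local Notation inC := (real_complex R).
Local Notation CC := (@complex_scalars R).
Local Notation nrm := (re_norm (re := @complex.Re R)).
Local Notation Hb := (hform ip).
Local Notation N := (commutant M).

(** The decisive use of finitely many generators. Each [xi k] is the sum of a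
    series of vectors [row_op (y k l) zeta] with [y k l] a row over [M], and
    these vectors decrease so fast that the rows, even when multiplied by large
    weights, satisfy the summability required in [family_factorization]. After
    replacing [zeta] by [z'], the series of the operators [row_op (y k l) \o g]
    itself converges in norm, and its sum is a row over [M], bounded uniformly
    in [k], which maps [z'] to [xi k]. *)
Lemma bounded_factorization (n : nat) (zeta : 'I_n -> H) (xi : nat -> H) :
  (forall k, closure (finite_module_span M zeta) (xi k)) ->
  (forall k, nrm (xi k) <= 4^-1 ^+ k) ->
  exists zeta' : 'I_n -> H, forall k, exists x : 'I_n -> H -> H,
    [/\ forall j, M (x j), forall j v, nrm (x j v) <= 3 * nrm v
      & xi k = \sum_j x j (zeta' j)].
Proof.
move=> xic xi_le.
pose h (k : nat) : R := 2^-1 ^+ k.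
have h_gt0 k : 0 < h k by rewrite exprn_gt0.
have h_le1 k : h k <= 1 by rewrite exprn_ile1// invf_le1// ler1n.
have hS k : h k.+1 = 2^-1 * h k by rewrite /h exprS.
have h4 k : 4^-1 ^+ k = h k ^+ 2.
  by rewrite /h -exprM mulnC exprM; congr (_ ^+ _); field.
have /choice[s sP] : forall p : nat * nat, exists r : 'I_n -> H -> H,
    (forall j, M (r j)) /\ nrm (xi p.1 - row_op r zeta) <= (h p.1 * h p.2) ^+ 2.
  move=> [k l]; have /(closure_nrm CC)/(_ ((h k * h l) ^+ 2)) := xic k.
  rewrite exprn_gt0 ?mulr_gt0// => /(_ isT)[_ [r Mr <-]] /ltW rP.
  by exists r; split.
pose y k l : 'I_n -> H -> H :=
  if l is l'.+1 then (fun j => s (k, l) j - s (k, l') j) else s (k, 0%N).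
have My k l j : M (y k l j).
  case: l => [|l]; first exact: (sP (k, 0%N)).1.
  by apply: (vn_sub vnM); [exact: (sP (k, l.+1)).1|exact: (sP (k, l)).1].
have yS k l u : row_op (y k l.+1) u = row_op (s (k, l.+1)) u - row_op (s (k, l)) u.
  by rewrite /row_op -sumrB.
have y_le k l : nrm (row_op (y k l) zeta) <= 8 * (h k * h l) ^+ 2.
  case: l => [|l].
    have := (sP (k, 0%N)).2; have := xi_le k; rewrite h4 /h expr0 mulr1 -/(h k).
    have := nrm_sub_trans CC (xi k) (row_op (y k 0%N) zeta) 0.
    rewrite !subr0 (nrm_distC (_ : H) (xi k)) /=.
    by have := sqr_ge0 (h k); lra.
  rewrite yS; apply: le_trans (nrm_sub_trans CC (xi k) _ _) _.
  rewrite nrm_distC.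
  have := (sP (k, l.+1)).2; have := (sP (k, l)).2; rewrite /= hS !exprMn.
  have := mulr_ge0 (sqr_ge0 (h k)) (sqr_ge0 (h l)); lra.
(* The vectors [row_op (y k l) zeta] are of order [4^-(k + l)]; the weight
   [2^(k + l)] keeps their squares summable and forces [row_op (y k l) \o g]
   to have norm at most [2^-(k + l)]. *)
pose z k l : 'I_n -> H -> H := fun j => inC (h k * h l)^-1 *: y k l j.
have Mz k l j : M (z k l j) by exact: (vn_scale vnM).
have zE k l u : row_op (z k l) u = inC (h k * h l)^-1 *: row_op (y k l) u.
  by rewrite /row_op scaler_sumr.
have h2_gt0 k l : 0 < h k * h l by rewrite mulr_gt0.
have [||||g [gL gb zg gz gcomm]] := @family_factorization _ _ inC _ _
  (power_form Hb n) Hb _ (fun k l => row_op (z k l)).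
- exact/power_hilbert/hform_hilbert.
- by move=> k l; apply/linear_rlinear/(row_op_linear vnM).
- by move=> k l; exact: (row_op_bounded vnM).
- by move=> k l; exact: (row_op_adjoint vnM).
have yg k l u : nrm (row_op (y k l) (g u)) <= h k * h l * rnorm (power_form Hb n) u.
  have := zg k l u; rewrite mul1r /= zE rnorm_hform (nrmZ CC).
  by rewrite gtr0_norm ?invr_gt0// mulrC ler_pdivrMr// mulrC.
have [//|k l|z' z'P] := gz zeta 64.
  have hh0 := ltW (h2_gt0 k l).
  rewrite -sqr_rnorm rnorm_hform zE (nrmZ CC) gtr0_norm ?invr_gt0//.
  rewrite !h4 -exprMn (_ : 64 = 8 ^+ 2); last by rewrite -natrX.
  rewrite -exprMn ler_pXn2r ?nnegrE ?mulr_ge0 ?invr_ge0 ?(ltW (h_gt0 _)) ?(nrm_ge0 CC)//.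
  rewrite mulrC ler_pdivrMr//; apply: le_trans (y_le k l) _.
  by rewrite expr2 !mulrA.
exists z' => k.
pose x m u := row_op (s (k, m)) (g u).
have xS m u : x m.+1 u - x m u = row_op (y k m.+1) (g u) by rewrite yS.
have xg u : (forall m, nrm (x m u) <= 3 * rnorm (power_form Hb n) u) /\
    rcauchy Hb (x^~ u).
  have u0 := rnorm_ge0 (power_form Hb n) u.
  have [m|x_le xc] := @geometric_cauchy _ _ _ _ CC _ (x^~ u) (rnorm (power_form Hb n) u).
    rewrite xS; apply: le_trans (yg _ _ _) _; rewrite mulrC ler_wpM2l//.
    rewrite hS -/(h m) mulrA; have := h_le1 k; have := h_gt0 k; have := h_gt0 m; nra.
  split=> [m|e /xc[N' NP]]; last first.
    by exists N' => i j Ni Nj; rewrite rnorm_hform; exact: NP.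
  have -> : 3 * rnorm (power_form Hb n) u =
    2 * rnorm (power_form Hb n) u + rnorm (power_form Hb n) u by ring.
  rewrite -[x m u](subrK (x 0%N u)); apply: le_trans (nrmD CC _ _) _.
  apply: lerD => //; apply: le_trans (yg k 0%N u) _.
  rewrite ler_piMl//; have := h_le1 k; have := h_le1 0%N; have := h_gt0 k; nra.
have /choice[X XP] : forall u, exists l, rlim Hb (x^~ u) l.
  by move=> u; apply: (hform_hilbert ip).2; exact: (xg u).2.
have srow m : rlinear inC (row_op (s (k, m))).
  by apply/linear_rlinear/(row_op_linear vnM) => j; exact: (sP (k, m)).1.
have [||||w [Mw w_le Xw]] := equivariant_rowP (ip := ip) vnM (X := X) (c := 3).
- by [].
- move=> u v; apply: (rlim_unique (hform_hilbert ip) (XP _)).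
  under eq_fun do rewrite /x gL.1 (srow _).1.
  by apply: rlimD; exact: XP.
- move=> u; rewrite -(rnorm_hform ip); apply: (rlim_rnorm_le (XP u)) => m.
  by rewrite rnorm_hform; exact: (xg u).1.
- move=> t u Nt; apply: (rlim_unique (hform_hilbert ip) (XP _)).
  have [t' Nt' tt'] := commutant_adjoint vnM Nt.
  have /(adjoint_hform ip _ (commutant_linear Nt)) adj := tt'.
  have [c tb] := diag_op_bounded ip n Nt.
  have gt : forall v, g (diag_op t v) = diag_op t (g v).
    apply: (gcomm _ (diag_op t') t t' c) => //.
    + exact: diag_op_linear Nt.
    + by move=> u' v'; rewrite rf_sym -(diag_op_adjoint adj) rf_sym.
    + by move=> u' v'; rewrite rf_sym -adj rf_sym.
    + by move=> k' l' u'; apply: (row_op_diag _ Nt).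
    + by move=> k' l' u'; apply: (row_op_diag _ Nt').
  have [tL [d _ td]] := bounded_op_rbounded ip Nt.1.
  rewrite (_ : (fun m => x m (diag_op t u)) = t \o (x^~ u)).
    exact: rlim_op tL td (XP u).
  apply/funext => m /=; rewrite /x gt (row_op_diag (g u) Nt)//.
  exact: (sP (k, m)).1.
exists w; split => //; rewrite -Xw; apply: (rlim_unique (hform_hilbert ip) _ (XP z')).
rewrite /x z'P.
apply: (@rlim_le _ _ _ _ _ _ _ h).
  move=> m; rewrite rnorm_hform nrm_distC; apply: le_trans (sP (k, m)).2 _ => /=.
  have p_le : h k * h m <= h m by rewrite ler_piMl// ltW.
  by have := h2_gt0 k m; have := h_le1 m; nra.
by apply: cvg_expr; rewrite ger0_norm// invf_lt1// ltr1n.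
Qed.

End BoundedFactorization.

(** * A closed graph theorem modulo a subspace *)

Lemma subr_common (V : zmodType) (x y z t : V) :
  (x + y - z) - (x - t) = y - (z - t).
Proof. by rewrite -[x + y - z]addrA opprB addrAC [x + _]addrC subrK opprB addrCA. Qed.

Lemma subr_subr (V : zmodType) (x y z : V) : x - (y - z) = x + z - y.
Proof. by rewrite opprB addrA. Qed.

Lemma subrACA (V : zmodType) (x y z t : V) : (x - y) - (z - t) = (x - z) - (y - t).
Proof. by rewrite !opprB addrACA [- y - z]addrC addrACA. Qed.

Section ClosedGraph.
Context {R : realType} {K L : numFieldType}.
Context {inK : {rmorphism R -> K}} {re : K -> R}.
Context {inL : {rmorphism R -> L}} {reL : L -> R}.
Hypotheses (KK : real_scalars inK re) (LL : real_scalars inL reL).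
Context {H : completeNormedModType L} {X : completeNormedModType K}.
Local Notation nH := (re_norm (re := reL)).
Local Notation nX := (re_norm (re := re)).

Variables (T : H -> X) (N : set X).
Hypothesis NN : real_subspace inK N.
Hypothesis TD : forall u v, T (u + v) = T u + T v.
Hypothesis TZ : forall r u, N (T (inL r *: u) - inK r *: T u).
Hypothesis graph_closed : forall (s : nat -> H) (x : nat -> X) u v,
  (forall e : R, 0 < e -> exists m, forall n, (m <= n)%N -> nH (s n - u) <= e) ->
  (forall e : R, 0 < e -> exists m, forall n, (m <= n)%N -> nX (x n - v) <= e) ->
  (forall n, N (x n - T (s n))) -> N (v - T u).

Let quot_le u (c : R) := exists v, N (v - T u) /\ nX v <= c.

Let T0 : T 0 = 0.
Proof. by apply: (addIr (T 0)); rewrite -TD !add0r. Qed.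
Let TN u : T (- u) = - T u.
Proof. by apply/eqP; rewrite -addr_eq0 -TD addNr T0. Qed.

(** Baire's argument for the sets of points whose image has distance at most
    [m] from [N]: were none of their closures to contain a ball, one could
    build nested balls whose common point lies in none of the sets. *)
Lemma level_set_somewhere_dense : exists (m : nat) (x0 : H) (r : R), 0 < r /\
  forall x, nH (x - x0) <= r ->
    forall e : R, 0 < e -> exists y, nH (x - y) < e /\ quot_le y m%:R.
Proof.
apply: contrapT => hn.
have /choice[f fP] : forall q : nat * H * R, exists z : H * R,
    0 < q.2 -> [/\ nH (z.1 - q.1.2) <= q.2, 0 < z.2 &
      forall y, nH (z.1 - y) < z.2 -> ~ quot_le y q.1.1%:R].
  move=> [[m x0] r] /=; apply: contrapT => hz; apply: hn; exists m, x0, r.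
  have r0 : 0 < r.
    by apply: contrapT => r0; apply: hz; exists (0, 0) => /r0.
  split=> // x xr e e0; apply: contrapT => hy; apply: hz; exists (x, e) => _.
  split=> // y xy Qy; apply: hy; exists y; split => //.
(* Halving the radius before and after applying [f] keeps the closed balls
   nested and the last one strictly inside the set avoided by level [m]. *)
pose step (m : nat) (z : H * R) : H * R :=
  let z' := f (m, z.1, z.2 / 2) in (z'.1, Num.min (z.2 / 2) (z'.2 / 2)).
pose z := fix z m := if m is k.+1 then step k (z k) else (0 : H, 1 : R).
have zS m : z m.+1 = step m (z m) by [].
have r_gt0 m : 0 < (z m).2.
  elim: m => [//|m IH]; rewrite zS /step /= lt_min divr_gt0//=.
  have [|_ h _] := fP (m, (z m).1, (z m).2 / 2); first by rewrite /= divr_gt0.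
  by rewrite divr_gt0.
have zP m : [/\ nH ((z m.+1).1 - (z m).1) <= (z m).2 / 2,
    (z m.+1).2 <= (z m).2 / 2 &
    forall y, nH ((z m.+1).1 - y) <= (z m.+1).2 -> ~ quot_le y m%:R].
  have [|h1 h2 h3] := fP (m, (z m).1, (z m).2 / 2); first by rewrite /= divr_gt0.
  rewrite zS /step /=; split => //; first by rewrite ge_min lexx.
  move=> y yz; apply: h3; apply: le_lt_trans yz _.
  by rewrite gt_min orbC ltr_pdivrMr// ltr_pMr// ltr1n.
have r_le m : (z m).2 <= 2^-1 ^+ m.
  elim: m => [|m IH]; first by rewrite expr0.
  by have [_ h _] := zP m; rewrite exprS; apply: le_trans h _; rewrite mulrC ler_wpM2l.
have [m|_ zc] := @geometric_cauchy _ _ _ _ LL _ (fun m => (z m).1) 1.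
  have [h _ _] := zP m; apply: le_trans h _; rewrite mul1r.
  by have := r_le m; have := r_gt0 m; lra.
have [x xP] := nrm_complete LL zc.
have zk m k : nH ((z (k + m)%N).1 - (z m).1) <= (z m).2 - (z (k + m)%N).2.
  elim: k => [|k IH]; first by rewrite !subrr (nrm0 LL).
  rewrite addSn; have [h1 h2 _] := zP (k + m)%N.
  apply: le_trans (nrm_sub_trans LL (z (k + m)%N).1 _ _) _; lra.
have xz m : nH ((z m).1 - x) <= (z m).2.
  apply/ler_addgt0Pr => e /xP[m' m'P].
  apply: le_trans (nrm_sub_trans LL (z (m' + m)%N).1 _ _) _; rewrite nrm_distC.
  have := m'P (m' + m)%N (leq_addr _ _).
  by have := zk m m'; have := r_gt0 (m' + m)%N; lra.
have [m mP] : exists m : nat, nX (T x) <= m%:R.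
  by exists (Num.bound (nX (T x))); apply/ltW/archi_boundP/(nrm_ge0 KK).
have [_ _ /(_ x (xz _))] := zP m; apply; exists (T x); split=> //.
by rewrite subrr; case: NN.
Qed.

(** Subtracting the approximations of two points of the ball found above
    centres it at the origin, and homogeneity makes the estimate proportional
    to the norm. *)
Lemma approximate_lift : exists C : R, forall u, exists y v,
  [/\ nH (u - y) <= 2^-1 * nH u, N (v - T y) & nX v <= C * nH u].
Proof.
have [m [x0 [r [r0 mP]]]] := level_set_somewhere_dense.
have [N0 ND NZ] := NN.
exists (2 * m%:R / r) => u.
have [u0|u0] := eqVneq (nH u) 0.
  have -> := nrm_eq0 LL u0; exists 0, 0.
  by rewrite T0 !subrr !(nrm0 LL) (nrm0 KK) !mulr0; split.
have up : 0 < nH u by rewrite lt_neqAle eq_sym u0 (nrm_ge0 LL).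
(* [x0 + t u] stays in the ball, and the precision [r / 4] leaves an error
   [r / 2], that is [nH u / 2] after division by [t]. *)
pose t := r / nH u; have t0 : 0 < t by rewrite divr_gt0.
have e0 : 0 < r / 4 by rewrite divr_gt0.
have [||y1 [y1u [v1 [Nv1 v1m]]]] := mP (x0 + inL t *: u) _ (r / 4).
- rewrite addrC addKr.
  by rewrite (nrmZ LL) gtr0_norm// /t divfK.
- by [].
have [||y2 [y2u [v2 [Nv2 v2m]]]] := mP x0 _ (r / 4).
- by rewrite subrr (nrm0 LL) ltW.
- by [].
exists (inL t^-1 *: (y1 - y2)), (inK t^-1 *: (v1 - v2)); split.
- have -> : u - inL t^-1 *: (y1 - y2) =
      inL t^-1 *: ((x0 + inL t *: u - y1) - (x0 - y2)).
    rewrite subr_common [RHS]scalerBr scalerA -rmorphM mulVf ?gt_eqF//.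
    by rewrite rmorph1 scale1r.
  rewrite (nrmZ LL) gtr0_norm ?invr_gt0//.
  have := nrmD LL (x0 + inL t *: u - y1) (- (x0 - y2)).
  rewrite (nrmN (re := reL)) => h.
  rewrite mulrC ler_pdivrMr//.
  have -> : 2^-1 * nH u * t = r / 2 by rewrite /t; field.
  lra.
- have -> : inK t^-1 *: (v1 - v2) - T (inL t^-1 *: (y1 - y2)) =
    inK t^-1 *: ((v1 - T y1) - (v2 - T y2)) -
      (T (inL t^-1 *: (y1 - y2)) - inK t^-1 *: T (y1 - y2)).
    rewrite [T (y1 - y2)]TD TN [RHS]subr_subr; congr (_ - _).
    by rewrite -scalerDr subrACA subrK.
  apply: (real_subspaceB NN) => //; apply: NZ.
  exact: (real_subspaceB NN).
- rewrite (nrmZ KK) gtr0_norm ?invr_gt0// mulrC ler_pdivrMr//.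
  have -> : 2 * m%:R / r * nH u * t = 2 * m%:R.
    by rewrite /t; field; rewrite u0 gt_eqF.
  apply: le_trans (nrmD KK _ _) _; rewrite (nrmN (re := re)); lra.
Qed.

(** Iterating [approximate_lift] on the successive remainders writes [u] as a
    series whose images modulo [N] have representatives of geometrically
    decreasing norm; their sum represents [T u] because the graph is closed.
    The quotient space itself is never formed: its norm is expressed by a
    choice of representatives. *)
Lemma closed_graph_quotient : exists C : R, forall u, exists v,
  N (v - T u) /\ nX v <= C * nH u.
Proof.
have [C CP] := approximate_lift; have [N0 ND NZ] := NN.
have /choice[F FP] : forall u, exists p : H * X,
    [/\ nH (u - p.1) <= 2^-1 * nH u, N (p.2 - T p.1) & nX p.2 <= C * nH u].
  by move=> u; have [y [v h]] := CP u; exists (y, v).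
exists (2 * `|C|) => u.
pose r := fix r n := if n is k.+1 then r k - (F (r k)).1 else u.
have r_le n : nH (r n) <= 2^-1 ^+ n * nH u.
  elim: n => [|n IH]; first by rewrite expr0 mul1r.
  by have [h _ _] := FP (r n); rewrite exprS -mulrA; apply: le_trans h _; rewrite ler_wpM2l.
pose x n := \sum_(k < n) (F (r k)).2.
have xP n : N (x n - T (u - r n)).
  elim: n => [|n IH]; first by rewrite /x big_ord0 subrr T0 subrr.
  rewrite /x big_ord_recr /= -/(x n) subr_subr [u + _ - _]addrAC TD opprD addrACA.
  by apply: ND; have [_ h _] := FP (r n) => //.
have [n|x_le xc] := @geometric_cauchy _ _ _ _ KK _ x (`|C| * nH u).
  rewrite /x big_ord_recr /= addrAC subrr add0r; have [_ _ h] := FP (r n).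
  apply: le_trans h _; rewrite -mulrA mulrC [_ * 2^-1 ^+ n]mulrC mulrC.
  apply: (@le_trans _ _ (`|C| * nH (r n))).
    by rewrite mulrC [leRHS]mulrC ler_wpM2l ?ler_norm ?(nrm_ge0 LL).
  by rewrite ler_wpM2l.
have [v vP] := nrm_complete KK xc.
exists v; split.
  apply: (graph_closed (s := fun n => u - r n) (x := x)) => // e e0.
  have : (fun n => 2^-1 ^+ n * nH u) @ \oo --> (0 : R).
    rewrite -[X in _ --> X](mul0r (nH u)); apply: cvgM; last exact: cvg_cst.
    by apply: cvg_expr; rewrite ger0_norm// invf_lt1// ltr1n.
  move=> /cvgrPdist_le/(_ e e0)[m _ mP]; exists m => n /mP /=.
  rewrite sub0r normrN ger0_norm ?mulr_ge0 ?exprn_ge0 ?(nrm_ge0 LL)//.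
  by move=> h; rewrite addrAC subrr sub0r (nrmN (re := reL)); exact: le_trans (r_le n) h.
apply/ler_addgt0Pr => e /vP[m mP].
have := mP m (leqnn m); have := x_le m; rewrite {2}/x big_ord0 subr0 => h1 h2.
have := nrm_sub_trans KK (x m) v 0; rewrite !subr0 nrm_distC; lra.
Qed.

End ClosedGraph.

(** * Projections onto closed subspaces *)

Section ClosedSubspaceProjection.
Context {R : realType} {K : numFieldType} {inK : {rmorphism R -> K}}.
Context {re : K -> R} {conj : K -> K}.
Hypothesis KK : real_scalars inK re.
Hypothesis re_conj : forall x, re (conj x) = re x.
Hypothesis re_conjM : forall x, re (conj x * x) = 0 -> x = 0.
Context {X : completeNormedModType K} (ip : inner_product conj X).
Local Notation nX := (re_norm (re := re)).
Local Notation b := (re_form KK ip re_conj).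

Lemma re0 : re 0 = 0.
Proof. by rewrite -(mul0r 0) -(rmorph0 inK) (re_inKM KK) mul0r. Qed.

Definition closed_in_norm (N : set X) := forall v,
  (forall e : R, 0 < e -> exists2 w, N w & nX (v - w) <= e) -> N v.

(** On a [K]-subspace, orthogonality for the real part of the inner product
    implies orthogonality: multiply [w] by the conjugate of [ip w v]. *)
Lemma ip_orth (v : X) (N : set X) : (forall (c : K) w, N w -> N (c *: w)) ->
  (forall w, N w -> re (ip w v) = 0) -> forall w, N w -> ip w v = 0.
Proof.
move=> NZ h w Nw; apply: re_conjM; rewrite -linearZl_LR; apply: h.
exact: NZ.
Qed.

Lemma closed_subspace_projection (N : set X) :
  N 0 -> (forall (c : K) u v, N u -> N v -> N (c *: u + v)) ->
  closed_in_norm N ->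
  exists p : X -> X, [/\ projection ip p, forall v, N v <-> p v = 0,
    range p = orthogonal_complement ip N, forall v, N (p v - v)
    & forall v, nX (p v) <= nX v].
Proof.
move=> N0 NL Ncl.
have NZ (c : K) w : N w -> N (c *: w) by move=> Nw; rewrite -[c *: w]addr0; exact: NL.
have NA u v : N u -> N v -> N (u + v) by move=> Nu Nv; rewrite -[u]scale1r; exact: NL.
have NN : real_subspace inK N by split=> // r u; exact: NZ.
have adhN v : adherent (a := b) N v -> N v.
  move=> [x Nx /rlimP xv]; apply: Ncl => e e0; have [m mP] := xv e e0.
  exists (x m) => //; rewrite nrm_distC -(rnorm_re_form KK ip re_conj).
  exact: mP.
have [P PP] := projection_exists (re_form_hilbert KK ip re_conj) NN.
have NP v : N (P v) by apply/adhN; apply PP.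
have bE u v : b u v = re (ip u v) by [].
have orth v w : N w -> ip w (v - P v) = 0.
  apply: (ip_orth NZ) => u Nu; rewrite -bE.
  by apply: (proj_orth PP); exact: adherent_sub.
have Puniq v q : N q -> (forall w, N w -> ip w (v - q) = 0) -> P v = q.
  move=> Nq h; apply: (proj_uniq (re_form_hilbert KK ip re_conj) NN PP).
    exact: adherent_sub.
  by move=> w Nw; apply/eqP; rewrite eq_sym -subr_eq0 -rfBr bE h// re0.
have ip0 u v : ip u v = 0 -> ip v u = 0.
  move=> h; apply: re_conjM.
  by rewrite -(ip_sym ip u v) h mul0r re0.
pose p v := v - P v.
have p0 v : N v <-> p v = 0.
  split=> [Nv|/eqP]; last by rewrite subr_eq0 => /eqP ->.
  have Pv : P v = v by apply: Puniq => // w _; rewrite subrr linear0r.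
  by rewrite /p Pv subrr.
have PL : linear P.
  move=> c u v; apply: Puniq; first exact: NL.
  move=> w Nw.
  have -> : c *: u + v - (c *: P u + P v) = c *: (u - P u) + (v - P v).
    by rewrite scalerBr opprD addrACA.
  by rewrite linearDr linearZr_LR /= !orth// mulr0 addr0.
have pL : linear p by move=> c u v; rewrite /p PL scalerBr opprD addrACA.
have pP v : nX (p v) <= nX v.
  rewrite -!(rnorm_re_form KK ip re_conj) /rnorm ler_wsqrtr//.
  have h : b (P v) (p v) = 0.
    by apply: (proj_orth PP); exact: (PP v).1.
  have -> : b v v = b (p v + P v) (p v + P v) by rewrite /p subrK.
  rewrite (rfDl b) (rfDr b (p v) (p v)) (rfDr b (P v) (p v)) (rf_sym b (p v) (P v)) h.
  by rewrite addr0 add0r lerDl rf_ge0.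
have pp v : p (p v) = p v.
  have Pp : P (p v) = 0 by apply: Puniq => // w Nw; rewrite subr0; exact: orth.
  by rewrite -[RHS]subr0 -Pp.
have adj u v : ip (p u) v = ip (p u) (p v).
  have {1}-> : v = p v + P v by rewrite /p subrK.
  by rewrite linearDr /= (ip0 _ _ (orth u _ (NP v))) addr0.
exists p; split=> //.
- split=> //.
  + by apply/(bounded_opP KK); split=> //; exists 1 => // v; rewrite mul1r.
  + by apply/funext => v /=.
  + by move=> u v; rewrite (adj u v) [RHS](ip_sym ip) (adj v u) -(ip_sym ip).
- apply/seteqP; split=> [_ [v _ <-] w Nw|v vN] /=; first by rewrite ip0// orth.
  exists v => //; have : P v = 0; last by rewrite /p => ->; rewrite subr0.
  apply: Puniq => // w Nw; rewrite subr0; apply: ip0; exact: vN.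
- by move=> v; rewrite /p addrAC subrr sub0r -scaleN1r; exact: NZ.
Qed.

End ClosedSubspaceProjection.

(** * Automatic boundedness of intertwiners *)

Section Intertwiner.
Context {R : realType} {H : completeNormedModType R[i]}.
Variable ip : inner_product (@Num.conj R[i]) H.
Variable M : set (H -> H).
Hypothesis vnM : von_neumann_algebra ip M.
Hypothesis fgM : sequences_finitely_generated M.
Local Notation inC := (real_complex R).
Local Notation CC := (@complex_scalars R).
Local Notation nH := (re_norm (re := @complex.Re R)).

Lemma opnorm_le (x : H -> H) (c : R) : x 0 = 0 -> 0 <= c ->
  (forall v, nH (x v) <= c * nH v) -> 0 <= opnorm x <= c.
Proof.
move=> x0 c0 xc.
have ub : ubound [set complex.Re `|x v| | v in [set v : H | `|v| <= 1]] c.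
  move=> _ [v /= v1 <-]; apply: le_trans (xc v) _; rewrite ler_piMr//.
  by rewrite -(ler_inK CC) (inK_nrm CC) rmorph1.
have ne : [set complex.Re `|x v| | v in [set v : H | `|v| <= 1]] 0.
  by exists 0; [rewrite /= normr0|rewrite x0 normr0].
apply/andP; split.
  by apply: ub_le_sup => //; exists c.
by apply: ge_sup => //; exists 0.
Qed.

Context {K : numFieldType} {inK : {rmorphism R -> K}}.
Context {re : K -> R} {conj : K -> K}.
Hypothesis KK : real_scalars inK re.
Hypothesis re_conj : forall x, re (conj x) = re x.
Hypothesis re_conjM : forall x, re (conj x * x) = 0 -> x = 0.
Context {X : completeNormedModType K}.
Local Notation nX := (re_norm (re := re)).
Variables (Phi : (H -> H) -> (X -> X)) (T1 T2 : H -> X).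
Hypothesis PhiP : bounded_real_linear_map inK re M Phi.
Hypothesis T1D : forall u v, T1 (u + v) = T1 u + T1 v.
Hypothesis T2D : forall u v, T2 (u + v) = T2 u + T2 v.
Hypothesis T12 : forall x, M x -> T1 \o x = Phi x \o T2.

Let T12E x v : M x -> T1 (x v) = Phi x (T2 v).
Proof. by move=> Mx; have := T12 Mx => /(congr1 (fun f => f v)). Qed.

Lemma scale_in_vn (r : R) x : M x -> M (r%:C%C *: x).
Proof. by move=> Mx; exact: (vn_scale vnM). Qed.

Lemma intertwiner_scale (r : R) v : T1 (r%:C%C *: v) = inK r *: T1 v.
Proof.
have M1 := vna_one vnM.
rewrite -[_ *: v]/((r%:C%C *: idfun : H -> H) v) T12E; last exact: scale_in_vn.
by rewrite (brl_scale PhiP)// -[RHS]/(inK r *: T1 (idfun v)) T12E.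
Qed.

(** Were [T1] unbounded, there would be [eta k] of norm at most [4^-k] with
    [|T1 (eta k)| >= k]. By [bounded_factorization] they can be written
    [sum_j x k j (z' j)] with operators [x k j] of norm at most 3, and
    [T1 (x (z' j)) = Phi x (T2 (z' j))] is bounded independently of [k]. *)
Lemma intertwiner_bounded : exists c : R, forall v, nX (T1 v) <= c * nH v.
Proof.
apply: contrapT => hn.
have T10 : T1 0 = 0 by apply: (addIr (T1 0)); rewrite -T1D !add0r.
(* The factor [4 ^+ k] compensates the normalization of [eta k] to [4^-k]. *)
have /choice[v vP] : forall k : nat, exists v, (k.+1%:R * 4 ^+ k) * nH v < nX (T1 v).
  move=> k; apply: contrapT => hk; apply: hn; exists (k.+1%:R * 4 ^+ k) => v.
  by rewrite leNgt; apply/negP => hv; apply: hk; exists v.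
have v_gt0 k : 0 < nH (v k).
  rewrite lt_neqAle (nrm_ge0 CC) andbT eq_sym; apply/eqP => v0.
  by have := vP k; rewrite v0 (nrm_eq0 CC v0) T10 (nrm0 KK) mulr0 ltxx.
pose eta k := (4^-1 ^+ k / nH (v k))%:C%C *: v k.
have c_gt0 k : 0 < 4^-1 ^+ k / nH (v k) by rewrite divr_gt0// exprn_gt0.
have etaP k : nH (eta k) <= 4^-1 ^+ k.
  by rewrite (nrmZ CC) gtr0_norm// divfK// gt_eqF.
have T1eta k : k%:R <= nX (T1 (eta k)).
  rewrite intertwiner_scale (nrmZ KK) gtr0_norm//.
  rewrite mulrAC ler_pdivlMr//; have := vP k.
  have p4 : 4^-1 ^+ k * 4 ^+ k = 1 :> R by rewrite -exprMn mulVf// expr1n.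
  move=> /ltW; rewrite -(ler_pM2l (_ : 0 < 4^-1 ^+ k)) ?exprn_gt0//.
  apply: le_trans; rewrite !mulrA [4^-1 ^+ k * _]mulrC -[_ * _ * 4 ^+ k]mulrA p4 mulr1.
  by rewrite ler_wpM2r ?(nrm_ge0 CC)// ler_nat.
have [n [zeta [_ zetaP]]] := fgM eta.
have [z' z'P] := bounded_factorization vnM zetaP etaP.
have [c cP] := brl_bounded PhiP.
pose B := \sum_j `|c| * 3 * nX (T2 (z' j)).
have etaB k : nX (T1 (eta k)) <= B.
  have [x [Mx xb ->]] := z'P k.
  rewrite (big_morph T1 T1D T10); apply: le_trans (nrm_sum KK _ _ _) _.
  apply: ler_sum => j _; rewrite T12E//; apply: le_trans (cP _ (Mx j) _) _.
  rewrite ler_wpM2r ?(nrm_ge0 KK)//.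
  have h := opnorm_le (linear0_of (vn_linear vnM (Mx j))) (ler0n _ 3) (xb j).
  have /andP[xo_ge0 xo_le3] := h.
  apply: (@le_trans _ _ (`|c| * opnorm (x j))); first by rewrite ler_wpM2r ?ler_norm.
  by rewrite ler_wpM2l.
have B0 : 0 <= B by apply: le_trans (etaB 0%N); exact: (nrm_ge0 KK).
have := le_trans (T1eta (Num.bound B)) (etaB _).
by rewrite leNgt archi_boundP.
Qed.

Local Notation N := (common_kernel M Phi).

Lemma Phi_linear x : M x -> linear (Phi x).
Proof. by move=> /(brl_op PhiP)[]. Qed.

Lemma common_kernel_linear (c : K) u v : N u -> N v -> N (c *: u + v).
Proof.
move=> Nu Nv x Mx; rewrite /ker /= (Phi_linear Mx).
by rewrite [Phi x u]Nu// [Phi x v]Nv// scaler0 addr0.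
Qed.

Lemma common_kernel0 : N 0.
Proof. by move=> x Mx; rewrite /ker /= (linear0_of (Phi_linear Mx)). Qed.

Lemma common_kernelB u v : N u -> N v -> N (u - v).
Proof. by move=> Nu Nv; rewrite addrC -scaleN1r; exact: common_kernel_linear. Qed.

Lemma common_kernelN u : N u -> N (- u).
Proof. by move=> Nu; rewrite -[- u]add0r; exact: common_kernelB common_kernel0 Nu. Qed.

Lemma ker_closed x : M x -> closed_in_norm (re := re) (ker (Phi x)).
Proof.
move=> Mx v h; have /(bounded_opP KK)[Pl [c c0 Pc]] := brl_op PhiP Mx.
rewrite /ker /=; apply: (nrm_eq0 KK); apply/eqP.
rewrite eq_le (nrm_ge0 KK) andbT; apply/ler_addgt0Pr => e e0; rewrite add0r.
have [|w /= Pw vw] := h (e / (c + 1)); first by rewrite divr_gt0// ltr_wpDl.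
have -> : Phi x v = Phi x (v - w).
  by rewrite (linearD_of _ _ Pl) -scaleN1r (linearZ_of _ _ Pl) [Phi x w]Pw scaler0 addr0.
apply: le_trans (Pc _) _; apply: (@le_trans _ _ (c * (e / (c + 1)))).
  by rewrite ler_wpM2l.
rewrite mulrA ler_pdivrMr ?ltr_wpDl// mulrC ler_wpM2l ?(ltW e0)// lerDl//.
Qed.

Lemma common_kernel_closed : closed_in_norm (re := re) N.
Proof.
move=> v h x Mx; apply: (ker_closed Mx) => e /h[w Nw vw].
by exists w => //; exact: Nw.
Qed.

Lemma coset_eq u v : N (u - v) -> coset_map N u = coset_map N v.
Proof.
move=> uv; apply/seteqP; split=> w h; rewrite /coset_map /= in h *.
  by rewrite -(subrKA u); have := common_kernelB h (common_kernelN uv); rewrite opprK.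
by rewrite -(subrKA v); have := common_kernelB h uv; rewrite opprB.
Qed.

Lemma intertwiner_scale_mod (r : R) v : N (T2 (r%:C%C *: v) - inK r *: T2 v).
Proof.
move=> x Mx; have Pl := Phi_linear Mx; rewrite /ker /= (linearD_of _ _ Pl).
rewrite -scaleN1r (linearZ_of _ _ Pl) -T12E// (linearZ_of _ _ Pl).
rewrite (linearZ_of _ _ (vn_linear vnM Mx)) intertwiner_scale T12E//.
by rewrite scaleN1r subrr.
Qed.

(** The closed graph theorem applies: if [s n] tends to [u] and
    representatives [y n] of [T2 (s n)] tend to [v], then
    [Phi x (y n) = T1 (x (s n))] for all [x] in [M], and since [Phi x] and [T1]
    are continuous, [Phi x v = Phi x (T2 u)]. *)
Lemma intertwiner_bounded_mod : exists C : R, forall v, exists w,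
  N (w - T2 v) /\ nX w <= C * nH v.
Proof.
have NN : real_subspace inK N.
  split; [exact: common_kernel0| |].
    by move=> u v Nu Nv; rewrite -[u]scale1r; exact: common_kernel_linear.
  move=> r u Nu; rewrite -[_ *: u]addr0; apply: common_kernel_linear => //.
  exact: common_kernel0.
apply: (closed_graph_quotient KK CC NN T2D intertwiner_scale_mod).
move=> s y u v su yv sy x Mx.
have /(bounded_opP KK)[Pl [c c0 Pc]] := brl_op PhiP Mx.
have [c1 T1c] := intertwiner_bounded.
have xl := vn_linear vnM Mx.
have /(bounded_opP CC)[_ [c2 c20 xc]] := vna_bounded vnM Mx.
rewrite /ker /=; apply: (nrm_eq0 KK); apply/eqP.
rewrite eq_le (nrm_ge0 KK) andbT; apply/ler_addgt0Pr => e e0; rewrite add0r.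
pose C := c + `|c1| * c2 + 1.
have C0 : 0 < C by rewrite ltr_wpDl// addr_ge0// mulr_ge0.
have eC : 0 < e / C by rewrite divr_gt0.
have [m1 m1P] := su _ eC; have [m2 m2P] := yv _ eC.
set k := maxn m1 m2.
have h1 := m1P k (leq_maxl _ _); have h2 := m2P k (leq_maxr _ _).
have PB a b : Phi x (a - b) = Phi x a - Phi x b.
  by rewrite (linearD_of _ _ Pl) -scaleN1r (linearZ_of _ _ Pl) scaleN1r.
have TB a b : T1 (x (a - b)) = T1 (x a) - T1 (x b).
  rewrite !T12E// (_ : T2 (a - b) = T2 a - T2 b) ?PB//.
  apply/eqP; rewrite eq_sym subr_eq -T2D subrK//.
have -> : Phi x (v - T2 u) = T1 (x (s k - u)) - Phi x (y k - v).
  rewrite TB !PB -!T12E//; have := sy k x Mx; rewrite /ker /= PB => /eqP.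
  by rewrite subr_eq0 -T12E// => /eqP ->; rewrite opprB [RHS]addrC subrKA.
apply: le_trans (nrmD KK _ _) _; rewrite (nrmN (re := re)).
have b1 : nX (T1 (x (s k - u))) <= `|c1| * c2 * (e / C).
  apply: le_trans (T1c _) _; apply: (@le_trans _ _ (`|c1| * nH (x (s k - u)))).
    by rewrite ler_wpM2r ?ler_norm ?(nrm_ge0 CC).
  rewrite -mulrA ler_wpM2l//; apply: le_trans (xc _) _.
  by rewrite ler_wpM2l.
have b2 : nX (Phi x (y k - v)) <= c * (e / C).
  by apply: le_trans (Pc _) _; rewrite ler_wpM2l.
have eE : e = C * (e / C) by rewrite mulrC divfK// gt_eqF.
rewrite [leRHS]eE /C mulrDl mul1r mulrDl -/C; lra.
Qed.

Lemma intertwiner_real_linear_bounded : real_linear_bounded inK re T1.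
Proof.
by split => //; [exact: intertwiner_scale|exact: intertwiner_bounded].
Qed.

Lemma quotient_norm_le v w : N (w - v) -> quotient_norm re (coset_map N v) <= nX w.
Proof.
move=> h; apply: ge_inf; last by exists w.
by exists 0 => _ [u _ <-]; exact: (nrm_ge0 KK).
Qed.

Lemma intertwiner_real_linear_bounded_mod : real_linear_bounded_mod inK re N T2.
Proof.
split=> [u v|r v|]; first by rewrite T2D.
  exact: coset_eq (intertwiner_scale_mod r v).
have [C CP] := intertwiner_bounded_mod; exists C => v.
have [w [Nw wC]] := CP v; apply: le_trans wC; exact: quotient_norm_le.
Qed.

Variable ipX : inner_product conj X.

(** The complement of the common kernel is the smallest closed subspace
    containing all the complements of the kernels: if [p'] dominates the right
    supports and [v] is in the range of [p], then [v - p' v] is orthogonal to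
    every right support, hence lies in the common kernel, to which [v] is
    orthogonal. *)
Lemma projection_onto_support (p : X -> X) : projection ipX p ->
  (forall v, N v <-> p v = 0) -> range p = orthogonal_complement ipX N ->
  projection_sup ipX [set q | exists2 x, M x & right_support ipX (Phi x) q] p.
Proof.
move=> pp p0 pr; split => //.
  move=> q [x Mx [_ ->]]; rewrite pr => v /= h w Nw; apply: h.
  exact: Nw.
move=> p' p'p h _ [v0 _ <-]; set v := p v0.
have vN : orthogonal_complement ipX N v by rewrite -pr; exists v0.
have [/(bounded_opP KK)[p'l _] p'id p'adj] := p'p.
have p'idE a : p' (p' a) = p' a by have := congr1 (fun f => f a) p'id.
have p'B a b : p' (a - b) = p' a - p' b.
  by rewrite (linearD_of _ _ p'l) -scaleN1r (linearZ_of _ _ p'l) scaleN1r.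
have ip0 a : ipX a a = 0 -> a = 0.
  move=> a0; apply/(nrm_eq0 KK).
  by rewrite -(rnorm_re_form KK ipX re_conj) /rnorm /= a0 (re0 KK) sqrtr0.
pose u := v - p' v.
have Nu : N u.
  move=> x Mx.
  have [||q [qp q0 qr _ _]] := closed_subspace_projection KK re_conj re_conjM
    ipX _ _ (ker_closed Mx).
  - by rewrite /ker /= (linear0_of (Phi_linear Mx)).
  - move=> c a b; rewrite /ker /= => a0 b0.
    by rewrite (Phi_linear Mx) a0 b0 scaler0 addr0.
  have [_ qid qadj] := qp.
  apply/q0; apply: ip0.
  have [w _ wq] : range p' (q u) by apply: (h q); [exists x|exists u].
  have qidE : q (q u) = q u by have := congr1 (fun f => f u) qid.
  rewrite qadj qidE -wq -p'adj /u p'B p'idE subrr linear0l//.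
have u0 : u = 0.
  apply: ip0; rewrite {1}/u linearBl /= vN//.
  by rewrite p'adj /u p'B p'idE subrr linear0r subrr.
by exists v => //; apply/eqP; rewrite eq_sym -subr_eq0; apply/eqP.
Qed.

Lemma intertwiner_projection : exists p,
  quotient_projection re M ipX Phi p /\ real_linear_bounded inK re (p \o T2).
Proof.
have [p [pp p0 pr pv p_le]] := closed_subspace_projection KK re_conj re_conjM ipX
  common_kernel0 common_kernel_linear common_kernel_closed.
have [/(bounded_opP KK)[pl _] pid padj] := pp.
have pB a b : p (a - b) = p a - p b.
  by rewrite (linearD_of _ _ pl) -scaleN1r (linearZ_of _ _ pl) scaleN1r.
have pE a b : N (a - b) -> p a = p b.
  by move=> /p0; rewrite pB => /eqP; rewrite subr_eq0 => /eqP.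
exists p; split.
  split; first exact: projection_onto_support.
    move=> v w; split=> [h|h]; last by apply/coset_eq/p0; rewrite pB h subrr.
    apply: pE; have : coset_map N v v by rewrite /coset_map /= subrr; exact: common_kernel0.
    by rewrite h.
  move=> v; apply/eqP; rewrite eq_le; apply/andP; split.
    exact: quotient_norm_le.
  apply: lb_le_inf; first by exists (nX (p v)), (p v) => //; exact: pv.
  move=> _ [w Nw <-]; rewrite -(pE _ _ Nw); exact: p_le.
split=> [u v|r v|] /=.
- by rewrite T2D (linearD_of _ _ pl).
- by rewrite (pE _ _ (intertwiner_scale_mod r v)) (linearZ_of _ _ pl).
- have [C CP] := intertwiner_bounded_mod; exists C => v.
  have [w [Nw wC]] := CP v; apply: le_trans wC.
  by rewrite -(pE _ _ Nw); exact: p_le.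
Qed.

End Intertwiner.

Lemma finitely_generated_automatically_bounded (R : realType)
    (H : completeNormedModType R[i])
    (ip : inner_product (@Num.conj R[i]) H) (M : set (H -> H)) :
  von_neumann_algebra ip M ->
  sequences_finitely_generated M -> intertwiners_automatically_bounded M.
Proof.
move=> vnM fgM; split=> X Phi T1 T2 PhiP T1D T2D T12.
  have conjM (x : R) : idfun (idfun x * x) = 0 -> x = 0.
    by move=> /eqP; rewrite /= mulf_eq0 orbb => /eqP.
  have KK := @real_real_scalars R; split.
  - exact: (intertwiner_real_linear_bounded vnM fgM KK PhiP T1D T12).
  - exact: (intertwiner_real_linear_bounded_mod vnM fgM KK PhiP T1D T2D T12).
  - move=> ipX.
    exact: (intertwiner_projection vnM fgM KK _ conjM PhiP T1D T2D T12).
have conjM (x : R[i]) : complex.Re (Num.conj x * x) = 0 -> x = 0.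
  case: x => r t; rewrite conjcE /= mulNr opprK -!expr2 => /eqP.
  by rewrite paddr_eq0 ?sqr_ge0// !sqrf_eq0 => /andP[/eqP-> /eqP->].
have KK := @complex_scalars R; split.
- exact: (intertwiner_real_linear_bounded vnM fgM KK PhiP T1D T12).
- exact: (intertwiner_real_linear_bounded_mod vnM fgM KK PhiP T1D T2D T12).
- move=> ipX.
  exact: (intertwiner_projection vnM fgM KK (@Re_conjK R) conjM PhiP T1D T2D T12).
Qed.

(** * Positive functionals dominated by a vector functional *)

Section PositiveFunctional.
Context {R : realType} {H : completeNormedModType R[i]}.
Variable ip : inner_product (@Num.conj R[i]) H.
Variable M : set (H -> H).
Hypothesis vnM : von_neumann_algebra ip M.
Local Notation inC := (real_complex R).
Local Notation CC := (@complex_scalars R).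
Local Notation nrm := (re_norm (re := @complex.Re R)).
Local Notation Hb := (hform ip).
Local Notation N := (commutant M).
Local Notation Re := (@complex.Re R).

Lemma commutant_id : N idfun.
Proof.
rewrite (_ : idfun = (fun v => 1 *: v)); first exact: (commutant_scalar vnM).
by apply/funext => v; rewrite scale1r.
Qed.

Lemma commutant_add x y : N x -> N y -> N (x + y).
Proof. by move=> Nx Ny; rewrite -[x]scale1r; exact: (commutant_lin vnM). Qed.

Lemma commutant_zero : N 0.
Proof.
rewrite (_ : 0 = (fun v => 0 *: v)); first exact: (commutant_scalar vnM).
by apply/funext => v; rewrite scale0r.
Qed.

Lemma commutant_scale l x : N x -> N (l *: x).
Proof.
by move=> Nx; rewrite -[_ *: _]addr0; apply: (commutant_lin vnM) => //; exact: commutant_zero.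
Qed.

Variable phi : (H -> H) -> R[i].
Hypothesis phi_lin : forall (l : R[i]) x y, N x -> N y ->
  phi (l *: x + y) = l * phi x + phi y.
Hypothesis phi_pos : forall x, N x -> (forall v, 0 <= ip (x v) v) -> 0 <= phi x.
Variables (n : nat) (c : 'I_n -> H).
Local Notation W := ('I_n -> H).
Local Notation Wb := (power_form Hb n).
Hypothesis phi_le : forall x y, N x -> N y -> adjoint_of ip x y ->
  Re (phi (y \o x)) <= Wb (diag_op x c) (diag_op x c).

Let phiD x y : N x -> N y -> phi (x + y) = phi x + phi y.
Proof. by move=> Nx Ny; rewrite -[x in LHS]scale1r phi_lin// mul1r. Qed.
Let phi0 : phi 0 = 0.
Proof. by apply: (addIr (phi 0)); rewrite -phiD ?add0r//; exact: commutant_zero. Qed.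
Let phiZ l x : N x -> phi (l *: x) = l * phi x.
Proof.
move=> Nx; rewrite -[_ *: _]addr0 phi_lin//; last exact: commutant_zero.
by rewrite phi0 addr0.
Qed.

Let st_exists : {st : (H -> H) -> (H -> H) |
  forall x, N x -> N (st x) /\ adjoint_of ip x (st x)}.
Proof.
apply: cid; suff /choice[f fP] : forall x, exists y, N x -> N y /\ adjoint_of ip x y.
  by exists f.
move=> x.
have [Nx|nNx] := pselect (N x); last by exists x.
by have [y Ny xy] := commutant_adjoint vnM Nx; exists y.
Qed.
Let st := sval st_exists.
Let stN x : N x -> N (st x). Proof. by move=> /(svalP st_exists)[]. Qed.
Let stP x v w : N x -> ip (x v) w = ip v (st x w).
Proof. by move=> /(svalP st_exists)[_]; exact. Qed.
Let stP' x v w : N x -> ip (st x v) w = ip v (x w).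
Proof. by move=> Nx; rewrite (ip_sym ip) -stP// -(ip_sym ip). Qed.

Let st_uniq x y : N x -> (forall v w, ip (x v) w = ip v (y w)) -> st x = y.
Proof.
move=> Nx h; apply/funext => w; apply: (form_ext (hform_hilbert ip)) => v.
by rewrite !hformE -h stP.
Qed.

Let st_comb l x y : N x -> N y -> st (x + l *: y) = st x + Num.conj l *: st y.
Proof.
move=> Nx Ny; apply: st_uniq.
  by apply: commutant_add => //; exact: commutant_scale.
move=> v w.
have -> : (x + l *: y) v = x v + l *: y v by [].
have -> : (st x + Num.conj l *: st y) w = st x w + Num.conj l *: st y w by [].
rewrite linearDl linearDr linearZl_LR linearZr_LR /= !stP//.
by rewrite conjCK.
Qed.

Let st_id : st idfun = idfun.
Proof. by apply: st_uniq => //; exact: commutant_id. Qed.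

Let Nss x y : N x -> N y -> N (st x \o y).
Proof. by move=> Nx Ny; apply: commutant_comp => //; exact: stN. Qed.

Let phi_ge0 x : N x -> 0 <= phi (st x \o x).
Proof.
move=> Nx; apply: phi_pos; first exact: Nss.
by move=> v /=; rewrite stP'// -ip_norm exprn_ge0.
Qed.

Let phi_expand l x y : N x -> N y ->
  phi (st (x + l *: y) \o (x + l *: y)) =
  phi (st x \o x) + l * phi (st x \o y) + Num.conj l * phi (st y \o x) +
    Num.conj l * l * phi (st y \o y).
Proof.
move=> Nx Ny; rewrite st_comb//.
have -> : (st x + Num.conj l *: st y) \o (x + l *: y) =
  (Num.conj l * l) *: (st y \o y) + (Num.conj l *: (st y \o x) +
    (l *: (st x \o y) + (st x \o x))).
  apply/funext => v.
  have -> : ((st x + Num.conj l *: st y) \o (x + l *: y)) v =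
    st x (x v + l *: y v) + Num.conj l *: st y (x v + l *: y v) by [].
  have -> : ((Num.conj l * l) *: (st y \o y) + (Num.conj l *: (st y \o x) +
    (l *: (st x \o y) + (st x \o x)))) v = (Num.conj l * l) *: st y (y v) +
     (Num.conj l *: st y (x v) + (l *: st x (y v) + st x (x v))) by [].
  have sxl := commutant_linear (stN Nx); have syl := commutant_linear (stN Ny).
  rewrite !(linearD_of _ _ sxl) !(linearD_of _ _ syl).
  rewrite !(linearZ_of _ _ sxl) !(linearZ_of _ _ syl) scalerDr scalerA.
  by rewrite addrC [X in X + _]addrC [X in _ + X]addrC -addrA.
rewrite !phi_lin//; try (by apply: Nss).
- by ring.
- by apply: (commutant_lin vnM); exact: Nss.
- by apply: (commutant_lin vnM); [exact: Nss|apply: (commutant_lin vnM); exact: Nss].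
Qed.

Let phi_sym x y : N x -> N y -> Re (phi (st x \o y)) = Re (phi (st y \o x)).
Proof.
move=> Nx Ny.
have Nxy : N (x + 'i%C *: y) by apply: commutant_add => //; exact: commutant_scale.
have := ger0_Im (phi_ge0 Nxy); rewrite phi_expand//.
have := ger0_Im (phi_ge0 Nx); have := ger0_Im (phi_ge0 Ny); rewrite conjcE.
case: (phi (st x \o x)) (phi (st y \o y)) (phi (st x \o y)) (phi (st y \o x)) =>
  [a b] [a' b'] [p q] [p' q'] /=; move=> -> ->; lra.
Qed.

Let phi_cs x y : N x -> N y ->
  Re (phi (st x \o y)) ^+ 2 <= Re (phi (st x \o x)) * Re (phi (st y \o y)).
Proof.
move=> Nx Ny; rewrite mulrC; apply: quadratic_disc => [|t].
  by have := phi_ge0 Ny; rewrite lecE => /andP[].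
have Nxy : N (x + t%:C%C *: y) by apply: commutant_add => //; exact: commutant_scale.
have := phi_ge0 Nxy; rewrite lecE => /andP[_]; rewrite phi_expand//.
have := phi_sym Nx Ny; rewrite conjcE.
case: (phi (st x \o x)) (phi (st y \o y)) (phi (st x \o y)) (phi (st y \o x)) =>
  [a b] [a' b'] [p q] [p' q'] /= ->; congr (_ <= _); ring.
Qed.

Let phi_le' x : N x -> Re (phi (st x \o x)) <= rnorm Wb (diag_op x c) ^+ 2.
Proof.
by move=> Nx; rewrite sqr_rnorm; apply: phi_le => //; [exact: stN|move=> v w; exact: stP].
Qed.

Let Wh : hilbert Wb. Proof. exact/power_hilbert/hform_hilbert. Qed.

Let adjW x u v : N x -> Wb (diag_op x u) v = Wb u (diag_op (st x) v).
Proof.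
move=> Nx; apply: diag_op_adjoint => v' w'.
by rewrite !hformE stP.
Qed.
Let adjW' x u v : N x -> Wb (diag_op (st x) u) v = Wb u (diag_op x v).
Proof. by move=> Nx; rewrite rf_sym -adjW// rf_sym. Qed.

Let phi_bound x y : N x -> N y ->
  `|Re (phi (st x \o y))| <= rnorm Wb (diag_op x c) * rnorm Wb (diag_op y c).
Proof.
move=> Nx Ny.
rewrite -(@ler_pXn2r _ 2)// ?nnegrE ?mulr_ge0 ?rnorm_ge0// real_normK ?num_real//.
apply: le_trans (phi_cs Nx Ny) _; rewrite exprMn.
have := phi_ge0 Nx; have := phi_ge0 Ny; rewrite !lecE => /andP[_ y0] /andP[_ x0].
by apply: ler_pM => //; exact: phi_le'.
Qed.

Let NN : real_subspace inC N.
Proof.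
split; [exact: commutant_zero|exact: commutant_add|].
by move=> r x; exact: commutant_scale.
Qed.

Let evc (x : H -> H) : W := diag_op x c.
Let evcL : rlinear inC evc.
Proof. by split=> *; apply/funext => j. Qed.

Let D : set W := [set evc x | x in N].
Let DD : real_subspace inC D.
Proof.
split; first by exists 0; [exact: commutant_zero|apply/funext => j].
  move=> _ _ [x Nx <-] [y Ny <-]; exists (x + y); first exact: commutant_add.
  by rewrite evcL.1.
move=> r _ [x Nx <-]; exists (inC r *: x); first exact: commutant_scale.
by rewrite evcL.2.
Qed.

Let riesz (f : (H -> H) -> R) (C : R) :
  (forall x y, N x -> N y -> f (x + y) = f x + f y) ->
  (forall r x, N x -> f (inC r *: x) = r * f x) ->
  (forall x, N x -> f x ^+ 2 <= C * Wb (evc x) (evc x)) ->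
  exists2 u, adherent (a := Wb) D u & forall x, N x -> Wb (evc x) u = f x.
Proof.
move=> fD fZ fC.
have [x [Nx xc xf]] := riesz_sequence (a := pullback_form Wb evcL) NN fD fZ fC.
have [|u xu] := Wh.2 (evc \o x).
  move=> e /xc[m mP]; exists m => i j mi mj /=.
  by rewrite -(rlinearB _ _ evcL); exact: mP.
exists u; first by exists (evc \o x) => // k; exists (x k).
move=> y Ny; apply: (cvg_seq_unique (rlim_formr (w := evc y) xu)).
exact: xf.
Qed.

Let adh_uniq u v : adherent (a := Wb) D u -> adherent (a := Wb) D v ->
  (forall x, N x -> Wb (evc x) u = Wb (evc x) v) -> u = v.
Proof.
move=> Du Dv h; apply/eqP; rewrite -subr_eq0; apply/eqP.
apply: (adherent_eq0 Wh (real_subspaceB (adherent_subspace DD) Du Dv)).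
by move=> _ [x Nx <-]; rewrite rfBr h// subrr.
Qed.

Let adh_diag z u : N z -> adherent (a := Wb) D u -> adherent (a := Wb) D (diag_op z u).
Proof.
move=> Nz; have [C zC] := diag_op_bounded ip n Nz.
apply: (adherent_op (diag_op_linear n Nz) zC) => _ [x Nx <-].
by exists (z \o x) => //; exact: commutant_comp.
Qed.

Let cauchy_schwarz_adh u (C : R) : 0 <= C -> adherent (a := Wb) D u ->
  (forall x, N x -> Wb (evc x) u <= C * rnorm Wb (evc x)) -> rnorm Wb u <= C.
Proof.
move=> C0 [x Dx xu] h.
have h1 : Wb u u <= C * rnorm Wb u.
  have l1 := rlim_forml (w := u) xu.
  have l2 : (fun k => C * rnorm Wb (x k)) @ \oo --> C * rnorm Wb u.
    apply: cvgM; first exact: cvg_cst.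
    apply: continuous_cvg; first exact: sqrt_continuous.
    exact: rlim_form.
  rewrite -subr_ge0; apply: (cvg_seq_lb (cvgB l2 l1)) => k /=.
  by rewrite subr_ge0; have [y Ny <-] := Dx k; exact: h.
have [->//|u0] := eqVneq (rnorm Wb u) 0.
have up : 0 < rnorm Wb u by rewrite lt_neqAle eq_sym u0 rnorm_ge0.
by rewrite -(ler_pM2r up) -expr2 sqr_rnorm.
Qed.

(** A Radon-Nikodym theorem. Let elements of [N] act diagonally on tuples.
    By Cauchy-Schwarz for the form [phi (y* x)], the value [phi x] is a bounded
    functional of [x c], so [Re (phi x)] is the product of [x c] with some [d]
    in the closure of [N c]. The map [x c |-> x d] commutes with [N]; it is
    symmetric and positive since [phi] is positive, and contractive since [phi]
    is dominated by [c]. Extended by continuity, and by 0 on the complement, it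
    is an operator [T] with a square root [g], and the vector [g c] represents
    [phi]. *)
Lemma positive_functional_vector : exists zeta : 'I_n -> H,
  forall x, N x -> phi x = \sum_j ip (x (zeta j)) (zeta j).
Proof.
have N1 := commutant_id.
have phi1x x : N x -> Re (phi (st idfun \o x)) = Re (phi x) by rewrite st_id.
have [||x Nx|d Dd dP] := @riesz (fun x => Re (phi x)) (rnorm Wb c ^+ 2).
- by move=> x y Nx Ny; rewrite phiD// (reD CC).
- by move=> r x Nx; rewrite phiZ// (re_inKM CC).
- rewrite -phi1x// -(sqr_rnorm Wb (evc x)) -exprMn -real_normK ?num_real//.
  rewrite ler_pXn2r ?nnegrE ?mulr_ge0 ?rnorm_ge0//.
  exact: phi_bound.
(* [d] represents [phi] against the orbit of [c]; the next facts say that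
   [x c |-> x d] is symmetric, contractive and positive. *)
have dxy x y : N x -> N y -> Wb (evc x) (diag_op y d) = Re (phi (st y \o x)).
  move=> Nx Ny; rewrite -adjW'// -[diag_op _ (evc x)]/(evc (st y \o x)) dP//.
  exact: Nss.
have d_le x : N x -> rnorm Wb (diag_op x d) <= rnorm Wb (evc x).
  move=> Nx; apply: cauchy_schwarz_adh; [exact: rnorm_ge0|exact: adh_diag|].
  move=> y Ny; rewrite dxy//; apply: le_trans (ler_norm _) _.
  exact: phi_bound.
have d_le2 x : N x -> rnorm Wb (diag_op x d) ^+ 2 <= Re (phi (st x \o x)).
  move=> Nx; have p0 : 0 <= Re (phi (st x \o x)).
    by have := phi_ge0 Nx; rewrite lecE => /andP[].
  rewrite -[leRHS]sqr_sqrtr// ler_pXn2r ?nnegrE ?rnorm_ge0 ?sqrtr_ge0//.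
  apply: cauchy_schwarz_adh; [exact: sqrtr_ge0|exact: adh_diag|].
  move=> y Ny; rewrite dxy//; apply: le_trans (ler_norm _) _.
  rewrite -(@ler_pXn2r _ 2)// ?nnegrE ?mulr_ge0 ?rnorm_ge0 ?sqrtr_ge0//.
  rewrite real_normK ?num_real// exprMn sqr_sqrtr//.
  by apply: le_trans (phi_cs Nx Ny) _; rewrite ler_wpM2l// phi_le'.
have /choice[T TP] : forall v, exists u, adherent (a := Wb) D u /\
    forall x, N x -> Wb (evc x) u = Wb (diag_op x d) v.
  move=> v; have [||x Nx|u Du uP] := @riesz (fun x => Wb (diag_op x d) v) (Wb v v).
  - by move=> x y Nx Ny; rewrite -rfDl; congr (Wb _ v); apply/funext.
  - by move=> r x Nx; rewrite -rfZl; congr (Wb _ v); apply/funext.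
  - apply: le_trans (cauchy_schwarz_sqr _ _ _) _; rewrite mulrC ler_wpM2l ?rf_ge0//.
    by rewrite -!sqr_rnorm ler_pXn2r ?nnegrE ?rnorm_ge0//; exact: d_le.
  - by exists u.
have TE x v : N x -> Wb (evc x) (T v) = Wb (diag_op x d) v by case: (TP v) => _; exact.
have DT v : adherent (a := Wb) D (T v) by case: (TP v).
have [_ AA AZ] := adherent_subspace (a := Wb) DD.
have TL : rlinear inC T.
  split=> [u v|r u]; apply: adh_uniq => //; try (by [apply: AA|apply: AZ]).
    by move=> x Nx; rewrite !rfDr !TE// rfDr.
  by move=> x Nx; rewrite !rfZr !TE// rfZr.
have Tb : rbounded Wb Wb 1 T.
  move=> v; rewrite mul1r; apply: cauchy_schwarz_adh; [exact: rnorm_ge0|exact: DT|].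
  move=> x Nx; rewrite TE//; apply: le_trans (ler_norm _) _.
  apply: le_trans (cauchy_schwarz _ _ _) _; rewrite mulrC ler_wpM2l ?rnorm_ge0//.
  exact: d_le.
have Tev x : N x -> T (evc x) = diag_op x d.
  move=> Nx; apply: adh_uniq => //; first exact: adh_diag.
  by move=> y Ny; rewrite TE// dxy// rf_sym dxy// phi_sym.
have [P PP] := projection_exists Wh DD.
have TP' v : T (P v) = T v.
  apply: adh_uniq => // x Nx; rewrite !TE//.
  by rewrite (proj_formr PP)//; exact: adh_diag.
have Tsym_adh u v : adherent (a := Wb) D u -> Wb (T u) v = Wb u (T v).
  move=> [x Dx xu].
  apply: (cvg_seq_unique _ (rlim_forml (w := T v) xu)).
  have -> : (fun k => Wb (x k) (T v)) = (fun k => Wb (T (x k)) v).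
    by apply/funext => k; have [y Ny <-] := Dx k; rewrite TE// Tev.
  exact: (rlim_forml (rlim_op TL Tb xu)).
have Tsym u v : Wb (T u) v = Wb u (T v).
  rewrite -(TP' u) Tsym_adh; last exact: (PP u).1.
  by rewrite (proj_sym PP) (proj_id Wh DD PP).
have Tcontr v : Wb (T v) (T v) <= Wb (T v) v.
  rewrite -(proj_formr PP v (DT v)) -(TP' v).
  have [x Dx xu] := (PP v).1; have Txu := rlim_op TL Tb xu.
  rewrite -subr_ge0; apply: (cvg_seq_lb (cvgB (rlim_form Txu xu) (rlim_form Txu Txu))).
  move=> k; rewrite subr_ge0; have [y Ny yk] := Dx k.
  rewrite -[_ <= _]/(Wb (T (x k)) (T (x k)) <= Wb (T (x k)) (x k)) -yk.
  by rewrite Tev// -sqr_rnorm [leRHS]rf_sym dxy//; exact: d_le2.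
have [g [gL gs gg gcomm]] := square_root Wh TL Tsym Tcontr.
have Tcomm z v : N z -> T (diag_op z v) = diag_op z (T v).
  move=> Nz; apply: adh_uniq => //; first exact: adh_diag.
  move=> x Nx; rewrite TE// -(adjW' _ _ Nz) -(adjW' _ _ Nz).
  by rewrite -[diag_op (st z) (evc x)]/(evc (st z \o x)) TE//; exact: Nss.
have gz z v : N z -> g (diag_op z v) = diag_op z (g v).
  move=> Nz; have [C zC] := diag_op_bounded ip n Nz.
  by apply: (gcomm _ _ (diag_op_linear n Nz) zC) => w; exact: Tcomm.
exists (g c) => x Nx; apply: ip_ext => l.
have Nlx : N (l *: x) by exact: commutant_scale.
rewrite -phiZ// -(dP _ Nlx).
have -> : d = T (evc idfun) by rewrite Tev.
rewrite -gg -gs /evc gz// power_formE mulr_sumr (big_morph Re (reD CC) (re0 CC)).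
by apply: eq_bigr => j _; rewrite hformE /diag_op -linearZl_LR.
Qed.

End PositiveFunctional.

(** * Complex sequences and topologies of pointwise convergence *)

Section ComplexLimits.
Context {R : realType}.
Local Notation C := (R[i]^o).
Local Notation Re := (@complex.Re R).
Local Notation Im := (@complex.Im R).

Lemma Re_norm_le (z : R[i]) : `|Re z| <= Re `|z|.
Proof.
have := normc_ge_Re z; rewrite -[X in _ <= X]RRe_real ?normr_real//.
by rewrite lecR.
Qed.

Lemma ReB (x y : R[i]) : Re (x - y) = Re x - Re y.
Proof. by case: x y => [a b] [c d]. Qed.

Lemma ltc_Re (e : R[i]) : 0 < e -> 0 < Re e /\ (Re e)%:C%C = e.
Proof.
move=> e0; have ee : (Re e)%:C%C = e by apply: RRe_real; exact: gtr0_real.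
by split=> //; rewrite -ltcR ee.
Qed.

Lemma norm_RRe (z : R[i]) : `|z| = (Re `|z|)%:C%C.
Proof. by rewrite RRe_real// normr_real. Qed.

Lemma Re_norm_ge0 (z : R[i]) : 0 <= Re `|z|.
Proof. by rewrite -lecR -norm_RRe normr_ge0. Qed.

Lemma Re_norm_eq0 (z : R[i]) : Re `|z| <= 0 -> z = 0.
Proof.
move=> z0; apply/eqP; rewrite -normr_eq0 norm_RRe.
by have /eqP -> : Re `|z| == 0 by rewrite eq_le z0 Re_norm_ge0.
Qed.

Lemma cvg_Re (z : nat -> C) (l : C) : z @ \oo --> l ->
  (fun n => Re (z n)) @ \oo --> Re l.
Proof.
move=> zl; apply/cvgrPdist_le => e e0.
have /cvgrPdist_le/(_ e%:C%C) := zl; rewrite ltcR => /(_ e0).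
apply: filterS => n; rewrite norm_RRe lecR; apply: le_trans.
by rewrite -ReB; exact: Re_norm_le.
Qed.

Lemma norm_le_ReIm (z : R[i]) : Re `|z| <= `|Re z| + `|Im z|.
Proof.
rewrite normc_def /= -[leRHS]ger0_norm ?addr_ge0// -sqrtr_sqr.
rewrite ler_wsqrtr// sqrrD !real_normK ?num_real//.
by rewrite lerD2r lerDl mulrn_wge0// mulr_ge0.
Qed.

Lemma cvg_ReIm (z : nat -> C) (a b : R) :
  (fun n => Re (z n)) @ \oo --> a -> (fun n => Im (z n)) @ \oo --> b ->
  z @ \oo --> (Complex a b : C).
Proof.
move=> za zb; apply/cvgrPdist_le => e /ltc_Re[e0 <-].
have e20 : 0 < Re e / 2 by rewrite divr_gt0.
have /cvgrPdist_le/(_ _ e20) ha := za; have /cvgrPdist_le/(_ _ e20) hb := zb.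
near=> n; rewrite norm_RRe lecR; apply: le_trans (norm_le_ReIm _) _.
have h1 : `|a - Re (z n)| <= Re e / 2 by near: n.
have h2 : `|b - Im (z n)| <= Re e / 2 by near: n.
by move: h1 h2; case: (z n) => c d /=; lra.
Unshelve. all: by end_near. Qed.

Lemma complex_lim (z : nat -> C) (l : C) : z @ \oo --> l -> limn z = l.
Proof.
move=> zl; apply: (@cvg_lim C _ nat \oo _ z l zl).
exact: (@norm_hausdorff R[i] C).
Qed.

Lemma complex_lim_lin (f g : nat -> C) (l : R[i]) : cvgn f -> cvgn g ->
  (fun n => l *: f n + g n) @ \oo --> (l *: limn f + limn g : C).
Proof.
move=> fc gc; apply: (@cvgD R[i] C); last exact: gc.
apply: (@cvgZl_tmp R[i] C _ \oo _ l f); exact: fc.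
Qed.

Lemma complex_cvg_lin (T : Type) (F : set_system T) {FF : Filter F} (f g : T -> C)
    (l a b : R[i]) : f @ F --> (a : C) -> g @ F --> (b : C) ->
  (fun x => l * f x + g x : C) @ F --> (l * a + b : C).
Proof.
move=> fa gb; apply: (@cvgD R[i] C); last exact: gb.
by apply: (@cvgZl_tmp R[i] C _ F _ l f); exact: fa.
Qed.

Lemma complex_cvg_sum (T : Type) (F : set_system T) {FF : Filter F} (I : Type)
    (r : seq I) (f : I -> T -> C) (l : I -> R[i]) :
  (forall i, f i @ F --> (l i : C)) ->
  (fun x => \sum_(i <- r) f i x : C) @ F --> (\sum_(i <- r) l i : C).
Proof.
move=> fl; elim: r => [|i r IH].
  rewrite big_nil; under eq_fun do rewrite big_nil.
  exact: (@cvg_cst C).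
rewrite big_cons; under eq_fun do rewrite big_cons.
by apply: (@cvgD R[i] C); [exact: fl|exact: IH].
Qed.

Lemma Re_sum (I : Type) (r : seq I) (P : pred I) (f : I -> R[i]) :
  Re (\sum_(i <- r | P i) f i) = \sum_(i <- r | P i) Re (f i).
Proof. exact: (big_morph Re (reD (@complex_scalars R))). Qed.

Lemma Im_sum (I : Type) (r : seq I) (P : pred I) (f : I -> R[i]) :
  Im (\sum_(i <- r | P i) f i) = \sum_(i <- r | P i) Im (f i).
Proof. by apply: (big_morph Im) => // -[a b] [c d]. Qed.

Lemma Im_norm_le (z : R[i]) : `|Im z| <= Re `|z|.
Proof.
rewrite Im_Re normrN; apply: le_trans (Re_norm_le _) _.
by rewrite normrM (_ : `|'i%C| = 1 :> R[i]) ?mul1r// normc_def /= expr0n expr1n add0r sqrtr1.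
Qed.

Lemma cvg_complex_series (f : nat -> C) (h : nat -> R) :
  (forall k, Re `|f k| <= h k) -> cvgn (series h) -> cvgn (series f).
Proof.
move=> fh hc.
have h0 k : 0 <= h k by apply: le_trans (fh k); rewrite -lecR -norm_RRe normr_ge0.
have hb (g : nat -> R) : (forall k, `|g k| <= h k) -> cvgn (series g).
  move=> gh; apply: (@normed_cvg _ R^o).
  exact: series_le_cvg gh hc.
have /cvg_ex[a aP] := hb (fun k => Re (f k)) (fun k => le_trans (Re_norm_le _) (fh k)).
have /cvg_ex[b bP] := hb (fun k => Im (f k)) (fun k => le_trans (Im_norm_le _) (fh k)).
apply/cvg_ex; exists (Complex a b); apply: cvg_ReIm.
  by under eq_fun do rewrite /series /= Re_sum.
by under eq_fun do rewrite /series /= Im_sum.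
Qed.

End ComplexLimits.

Section InitialPointwise.
Context {S : choiceType} {I : Type} {T : topologicalType}.
Variable w : S -> {ptws I -> T}.
Local Notation W := (initial_topology w).

Lemma cvg_initial_ptws (F : set_system S) (x0 : S) : Filter F ->
  (forall i, (fun x => w x i) @ F --> w x0 i) -> F --> (x0 : W).
Proof.
move=> FF h A /= [_ [[B oB <-] Bx0] BA].
rewrite nbhs_filterE; apply: filterS BA _.
suff wF : w @ F --> (w x0 : {ptws I -> T}).
  by apply: (wF B); exact: open_nbhs_nbhs.
apply/cvg_sup => i D /= [_ [[E oE <-] Ex0] ED].
rewrite nbhs_filterE; apply: filterS ED _.
by apply: h; exact: open_nbhs_nbhs.
Qed.

Lemma initial_ptws_coord (i : I) : continuous ((fun x => w x i) : W -> T).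
Proof.
move=> x A Ax.
apply: (@initial_continuous S {ptws I -> T} w x ((fun f => f i) @^-1` A)).
have pc : nbhs (w x : {ptws I -> T}) --> (w x : {ptws I -> T}) by exact: cvg_id.
move/cvg_sup: pc => /(_ i); apply.
exact: (@initial_continuous _ T (fun f : {ptws I -> T} => f i) (w x) A Ax).
Qed.

End InitialPointwise.

(** * Functionals continuous for the weak operator topology *)

Section WeakTopologies.
Context {R : realType} {H : completeNormedModType R[i]}.
Variable ip : inner_product (@Num.conj R[i]) H.
Variable M : set (H -> H).
Hypothesis vnM : von_neumann_algebra ip M.
Local Notation inC := (real_complex R).
Local Notation CC := (@complex_scalars R).
Local Notation nrm := (re_norm (re := @complex.Re R)).
Local Notation Hb := (hform ip).
Local Notation N := (commutant M).
Local Notation Re := (@complex.Re R).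
Local Notation C := (R[i]^o).
Local Notation sq := (@square_summable R H).

Lemma ip_norm_le u v : Re `|ip u v| <= nrm u * nrm v.
Proof.
have [z0|z0] := eqVneq (ip u v) 0.
  by rewrite z0 normr0 mulr_ge0 ?(nrm_ge0 CC).
pose l := (Num.conj (ip u v)) / `|ip u v|.
have nz : `|ip u v| != 0 by rewrite normr_eq0.
have l1 : `|l| = 1 by rewrite normrM normfV norm_conjC normr_id divff.
have <- : Hb (l *: u) v = Re `|ip u v|.
  rewrite hformE linearZl_LR /= /l mulrAC mulrC [Num.conj _ * _]mulrC -normCK expr2.
  by rewrite mulKf.
apply: le_trans (ler_norm _) _; apply: le_trans (cauchy_schwarz _ _ _) _.
rewrite !rnorm_hform; have -> // : nrm (l *: u) = nrm u.
by rewrite /re_norm normrZ l1 mul1r.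
Qed.

Lemma commutant_val (x : set_type N) : N (val x).
Proof. exact: set_mem (valP x). Qed.

Lemma square_summableD u v (l : R[i]) : sq u -> sq v -> sq (fun k => u k + l *: v k).
Proof.
move=> su sv; pose c := (Re `|l|) ^+ 2; have c_ge0 : 0 <= c by exact: sqr_ge0.
apply: (@series_le_cvg _ _ (fun k => 2 * (Re `|u k|) ^+ 2 + (2 * c) * (Re `|v k|) ^+ 2)).
- by move=> k; rewrite sqr_ge0.
- move=> k /=; apply: addr_ge0; apply: mulr_ge0; rewrite ?sqr_ge0//. exact: mulr_ge0.
- move=> k.
  have h := nrmD CC (u k) (l *: v k).
  have e : nrm (l *: v k) = Re `|l| * nrm (v k).
    apply: complexI; rewrite (inK_nrm CC) normrZ rmorphM.
    by rewrite (inK_nrm CC) (inK_re CC).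
  rewrite e in h; rewrite -/(nrm (u k + _)) -/(nrm (u k)) -/(nrm (v k)) /c.
  have h0 := nrm_ge0 CC (u k + l *: v k).
  have : nrm (u k + l *: v k) ^+ 2 <= (nrm (u k) + Re `|l| * nrm (v k)) ^+ 2.
    by rewrite ler_pXn2r ?nnegrE// (le_trans h0).
  move=> h2; apply: le_trans h2 _.
  by have := sqr_ge0 (nrm (u k) - Re `|l| * nrm (v k)); nra.
- have := is_cvg_seriesD (is_cvg_seriesZ (k := 2) su) (is_cvg_seriesZ (k := 2 * c) sv).
  by [].
Qed.

Lemma pairing_cvg x u v : N x -> sq u -> sq v ->
  cvgn (series (fun k => ip (x (u k)) (v k) : C)).
Proof.
move=> [/(bounded_opP CC)[_ [c c0 xc]] _] su sv.
apply: (@cvg_complex_series _ _ (fun k => c * (Re `|u k|) ^+ 2 + c * (Re `|v k|) ^+ 2)).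
  move=> k; apply: le_trans (ip_norm_le _ _) _; rewrite -mulrDr.
  rewrite -/(nrm (u k)) -/(nrm (v k)).
  apply: (@le_trans _ _ (c * (nrm (u k) * nrm (v k)))).
    by rewrite mulrA ler_wpM2r ?(nrm_ge0 CC).
  rewrite ler_wpM2l//; have := nrm_ge0 CC (u k); have := nrm_ge0 CC (v k).
  by have := sqr_ge0 (nrm (u k) - nrm (v k)); nra.
exact: (is_cvg_seriesD (is_cvg_seriesZ (k := c) su) (is_cvg_seriesZ (k := c) sv)).
Qed.

Definition pairing (u v : nat -> H) (x : H -> H) : R[i] :=
  limn (series (fun k => ip (x (u k)) (v k) : C)).

Lemma pairing_lin u v : sq u -> sq v -> forall (l : R[i]) x y, N x -> N y ->
  pairing u v (l *: x + y) = l * pairing u v x + pairing u v y.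
Proof.
move=> su sv l x y Nx Ny; rewrite /pairing.
have -> : (fun k => ip ((l *: x + y) (u k)) (v k) : C) =
    l *: (fun k => ip (x (u k)) (v k) : C) + (fun k => ip (y (u k)) (v k) : C).
  apply/funext => k; have -> : (l *: x + y) (u k) = l *: x (u k) + y (u k) by [].
  by rewrite linearDl linearZl_LR.
have cx := pairing_cvg Nx su sv; have cy := pairing_cvg Ny su sv.
rewrite -(complex_lim (complex_lim_lin (l := l) cx cy)).
by rewrite seriesD seriesZ.
Qed.

Lemma pairing_continuous u v : sq u -> sq v ->
  continuous ((fun x => pairing u v (val x)) : weak_star ip N -> C).
Proof.
move=> su sv.
pose p : set_type (sq `*` sq) := SigSub (mem_set (conj su sv : (sq `*` sq) (u, v))).
exact: (initial_ptws_coord (w := @weak_star_coord R H ip N) (i := p)).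
Qed.

Lemma ip_wot_continuous a b :
  continuous ((fun x => ip (val x a) b) : wot ip N -> C).
Proof. exact: (initial_ptws_coord (w := @wot_coord R H ip N) (i := (a, b))). Qed.

Lemma Re_pairing x u v : N x -> sq u -> sq v ->
  (fun n => \sum_(0 <= k < n) Hb (x (u k)) (v k)) @ \oo --> Re (pairing u v x).
Proof.
move=> Nx su sv; have /cvg_Re := pairing_cvg Nx su sv.
by under eq_fun do rewrite /series /= Re_sum.
Qed.

Definition commutant0 : set_type N := SigSub (mem_set (commutant_zero vnM)).

(** Continuity at 0 for the weak operator topology bounds [phi] by 1 on a set
    defined by finitely many inequalities [|ip (x a) b| < e]; by homogeneity
    this becomes an estimate of [phi] by the sum of these moduli. Finite sets of
    such inequalities generate a filter that converges to 0, which gives the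
    basic neighbourhoods of 0. *)
Lemma weak_star_functional_bound (phi : (H -> H) -> R[i]) :
  weak_star_eq_wot ip N ->
  (forall (l : R[i]) x y, N x -> N y -> phi (l *: x + y) = l * phi x + phi y) ->
  continuous ((fun x => phi (val x)) : weak_star ip N -> C) ->
  exists (s : seq (H * H)) (c : R), 0 <= c /\ forall x, N x ->
    Re `|phi x| <= c * \sum_(p <- s) Re `|ip (x p.1) p.2|.
Proof.
move=> eqT phi_lin phi_cont.
have N0 := commutant_zero vnM.
have phi0 : phi 0 = 0.
  by have := phi_lin (-1) 0 0 N0 N0; rewrite scaleN1r addNr mulN1r addNr.
have phiZ l x : N x -> phi (l *: x) = l * phi x.
  by move=> Nx; rewrite -[_ *: _]addr0 phi_lin// phi0 addr0.
pose U : set (set_type N) := [set x | Re `|phi (val x)| < 1].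
have U0 : nbhs (commutant0 : wot ip N) U.
  have : nbhs (commutant0 : weak_star ip N) U.
    have /cvgrPdist_lt/(_ 1 ltr01) := phi_cont commutant0.
    apply: filterS => x; rewrite /U /= phi0 sub0r normrN norm_RRe.
    by rewrite (_ : 1 = inC 1)// ltcR.
  rewrite !nbhsE => -[B [oB B0] BU]; exists B => //.
  by split=> //; apply/eqT.
(* The filter generated by finitely many inequalities at a time. *)
pose F : set_system (set_type N) := [set A | exists (s : seq (H * H)) (e : R),
  0 < e /\ forall x : set_type N,
    (forall p, p \in s -> Re `|ip (val x p.1) p.2| < e) -> A x].
have FF : Filter F.
  split.
  - by exists [::], 1; split.
  - move=> A B [s [e [e0 sA]]] [t [d [d0 tB]]].
    exists (s ++ t), (Num.min e d); split; first by rewrite lt_min e0 d0.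
    move=> x h; split.
      apply: sA => p ps; have := h p; rewrite mem_cat ps lt_min => /(_ isT).
      by case/andP.
    apply: tB => p pt; have := h p; rewrite mem_cat pt orbT lt_min => /(_ isT).
    by case/andP.
  - move=> A B AB [s [e [e0 sA]]]; exists s, e; split=> // x h.
    exact/AB/sA.
have Fc : F --> (commutant0 : wot ip N).
  apply: (@cvg_initial_ptws _ _ _ (@wot_coord R H ip N) F commutant0 FF).
  move=> [a b]; apply/cvgrPdist_lt => d /ltc_Re[d0 dE].
  exists [:: (a, b)], (Re d); split=> // x /(_ (a, b)).
  rewrite inE eqxx => /(_ isT) /= h.
  have -> : wot_coord ip commutant0 (a, b) = 0 by exact: linear0l.
  by rewrite sub0r normrN norm_RRe -dE ltcR.
have [s [e [e0 sU]]] := Fc U U0.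
have S0 x : 0 <= \sum_(p <- s) Re `|ip (x p.1) p.2|.
  by apply: sumr_ge0 => p _; rewrite -lecR -norm_RRe normr_ge0.
exists s, (2 / e); split=> [|x Nx]; first by rewrite divr_ge0// ltW.
set S := \sum_(p <- s) _.
have scale (t : R) : 0 < t -> t * S < e -> t * Re `|phi x| < 1.
  move=> t0 tS.
  have Ntx : N (t%:C%C *: x) by apply: (commutant_scale vnM).
  have sUx := sU (SigSub (mem_set Ntx)).
  have normt (z : R[i]) : Re `|t%:C%C * z| = t * Re `|z|.
    by rewrite normrM normc_def /= expr0n addr0 sqrtr_sqr gtr0_norm// mul0r subr0.
  rewrite -normt -phiZ//; apply: sUx => p ps.
  rewrite -[_ < _]/(Re `|ip (t%:C%C *: x p.1) p.2| < e) linearZl_LR normt.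
  apply: le_lt_trans tS.
  rewrite ler_wpM2l ?(ltW t0)// /S (big_rem p)//= lerDl.
  by apply: sumr_ge0 => q _; rewrite -lecR -norm_RRe normr_ge0.
apply/ler_addgt0Pr => d d0.
pose S' := 2 / e * S + d.
have S'0 : 0 < S' by rewrite ltr_wpDl// mulr_ge0 ?S0// divr_ge0// ltW.
have Se : S'^-1 * S < e.
  rewrite mulrC ltr_pdivrMr// /S' mulrDr mulrA mulrCA mulfV ?gt_eqF// mulr1.
  by have := S0 x; rewrite -/S; have := mulr_gt0 e0 d0; lra.
have := scale _ _ Se; rewrite invr_gt0 => /(_ S'0).
by rewrite mulrC ltr_pdivrMr// mul1r => /ltW.
Qed.

End WeakTopologies.

(** * The implications between the topological conditions *)

Section Main.
Context {R : realType} {H : completeNormedModType R[i]}.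
Variable ip : inner_product (@Num.conj R[i]) H.
Variable M : set (H -> H).
Hypothesis vnM : von_neumann_algebra ip M.
Local Notation inC := (real_complex R).
Local Notation CC := (@complex_scalars R).
Local Notation nrm := (re_norm (re := @complex.Re R)).
Local Notation Hb := (hform ip).
Local Notation N := (commutant M).
Local Notation Re := (@complex.Re R).
Local Notation C := (R[i]^o).
Local Notation sq := (@square_summable R H).

Lemma invariant_projection (D : set H) (P : H -> H) :
  real_subspace inC D -> (forall x v, M x -> D v -> D (x v)) ->
  projects_onto (a := Hb) D P -> N P.
Proof.
move=> DD DM PP; have Hh := hform_hilbert ip.
have Pcomm x v : M x -> P (x v) = x (P v).
  move=> Mx; have [y My xy] := vna_adj vnM Mx.
  have [xL [c _ xc]] := bounded_op_rbounded ip (vna_bounded vnM Mx).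
  have /(adjoint_hform ip _ (vn_linear vnM Mx)) adj := xy.
  apply: (proj_commute Hh DD PP (S' := y) xL xc).
  - by move=> u w; rewrite rf_sym -adj rf_sym.
  - by move=> w; exact: DM.
  - by move=> w; exact: DM.
split; last by move=> x Mx; apply/funext => v /=; exact: Pcomm.
apply/(bounded_opP CC); split.
  move=> l u v; rewrite (proj_linear Hh DD PP).1.
  rewrite -[l *: u]/((l *: idfun : H -> H) u) Pcomm//.
  exact: (vn_scale vnM l (vna_one vnM)).
by exists 1 => // v; have := proj_le PP v; rewrite !rnorm_hform.
Qed.

Lemma finite_module_span_subspace n (zeta : 'I_n -> H) :
  real_subspace inC (finite_module_span M zeta).
Proof.
split.
- by exists (fun=> 0); [move=> j; exact: (vn_zero vnM)|rewrite big1].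
- move=> _ _ [x Mx <-] [y My <-]; exists (fun j => x j + y j).
    by move=> j; exact: (vn_add vnM).
  by rewrite -big_split.
- move=> r _ [x Mx <-]; exists (fun j => inC r *: x j).
    by move=> j; exact: (vn_scale vnM).
  by rewrite scaler_sumr.
Qed.

Lemma finite_module_span_invariant n (zeta : 'I_n -> H) x v : M x ->
  finite_module_span M zeta v -> finite_module_span M zeta (x v).
Proof.
move=> Mx [y My <-]; exists (fun j => x \o y j).
  by move=> j; exact: (vna_mul vnM).
have xl := vn_linear vnM Mx.
by rewrite (big_morph x (fun u v => linearD_of u v xl) (linear0_of xl)).
Qed.

Lemma finite_module_span_generator n (zeta : 'I_n -> H) i :
  finite_module_span M zeta (zeta i).
Proof.
exists (fun j => if j == i then idfun else 0).
  by move=> j; case: ifP => _; [exact: (vna_one vnM)|exact: (vn_zero vnM)].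
rewrite (bigD1 i)//= eqxx big1 ?addr0// => j /negbTE ->.
by [].
Qed.

Lemma adherent_closure (D : set H) v : adherent (a := Hb) D v -> closure D v.
Proof.
move=> [x Dx /rlimP xv]; apply/(closure_nrm CC) => e e0.
have e20 : 0 < e / 2 by rewrite divr_gt0.
have [m mP] := xv _ e20; exists (x m) => //.
rewrite (nrm_distC (re := Re)) -(rnorm_hform ip); apply: le_lt_trans (mP m (leqnn m)) _.
by rewrite ltr_pdivrMr// ltr_pMr// ltr1n.
Qed.

Lemma square_summable_rescaling (xi : nat -> H) :
  exists t : nat -> R, (forall k, 0 < t k) /\ sq (fun k => inC (t k) *: xi k).
Proof.
exists (fun k => 2^-1 ^+ k / (1 + nrm (xi k))).
have n0 k := nrm_ge0 CC (xi k).
have d0 k : 0 < 1 + nrm (xi k) by rewrite ltr_wpDr.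
have t0 k : 0 < 2^-1 ^+ k / (1 + nrm (xi k)) by rewrite divr_gt0// exprn_gt0.
split=> //.
apply: (@series_le_cvg _ _ (geometric 1 4^-1)).
- by move=> k; rewrite sqr_ge0.
- by move=> k; rewrite /= mul1r exprn_ge0.
- move=> k; rewrite /= mul1r.
  have -> : 4^-1 ^+ k = (2^-1 ^+ k) ^+ 2 :> R.
    by rewrite -exprM mulnC exprM; congr (_ ^+ _); field.
  rewrite -/(nrm _) ler_pXn2r ?nnegrE ?exprn_ge0 ?(nrm_ge0 CC)//.
  rewrite (nrmZ CC) gtr0_norm// mulrAC ler_pdivrMr// ler_wpM2l ?exprn_ge0//.
  by rewrite lerDr.
- by apply: is_cvg_geometric_series; rewrite ger0_norm// invf_lt1// ltr1n.
Qed.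

(** After rescaling, [x |-> sum_k ip (x (u k)) (u k)] is weak* continuous, so
    it is bounded by finitely many products [ip (x a) b]. Let [P] be the
    projection onto the closed [M]-module generated by the vectors [a]. It
    belongs to the commutant, [q = 1 - P] annihilates the [a], hence
    [sum_k |q (u k)|^2 = 0] and every [u k] is in that module. *)
Lemma weak_star_eq_wot_finitely_generated :
  weak_star_eq_wot ip N -> sequences_finitely_generated M.
Proof.
move=> eqT xi; have Hh := hform_hilbert ip.
have [t [t0 su]] := square_summable_rescaling xi.
set u := (fun k => _) in su.
have [s [c [c0 sP]]] := weak_star_functional_bound vnM eqT
  (pairing_lin ip (M := M) su su) (pairing_continuous (ip := ip) (M := M) su su).
pose zeta (j : 'I_(size s).+1) : H := nth 0 [seq p.1 | p <- s] j.
exists (size s).+1, zeta; split=> // k.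
set D := finite_module_span M zeta.
have DD := finite_module_span_subspace zeta.
have [P PP] := projection_exists Hh DD.
have NP : N P.
  by apply: (invariant_projection DD _ PP) => x v; exact: finite_module_span_invariant.
pose q : H -> H := (-1) *: P + idfun.
have qE v : q v = v - P v by rewrite -scaleN1r addrC.
have Nq : N q by apply: (commutant_lin vnM) => //; exact: (commutant_id vnM).
have q0 : pairing ip u u q = 0.
  apply: Re_norm_eq0.
  apply: le_trans (sP q Nq) _; rewrite big1_seq ?mulr0// => p /andP[_ ps].
  have -> : q p.1 = 0.
    rewrite qE; apply/eqP; rewrite subr_eq0 eq_sym; apply/eqP.
    apply: (proj_id Hh DD PP); apply: adherent_sub.
    have ip1 : (index p s < (size s).+1)%N by rewrite ltnS ltnW// index_mem.
    have -> : p.1 = zeta (Ordinal ip1).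
      by rewrite /zeta (nth_map p) ?index_mem// nth_index.
    exact: finite_module_span_generator.
  by rewrite linear0l normr0.
have qq v : Hb (q v) v = Hb (q v) (q v).
  have orth : Hb (P v) (v - P v) = 0 by apply: (proj_orth PP v (PP v).1).
  by rewrite qE [RHS](rfBr Hb) [Hb (v - P v) (P v)]rf_sym orth subr0.
have lim0 := Re_pairing (ip := ip) Nq su su; rewrite q0 /= in lim0.
have quk : q (u k) = 0.
  apply Hh; apply/eqP; rewrite eq_le rf_ge0 andbT.
  have lim1 : (fun m => \sum_(0 <= i < m + k.+1) Hb (q (u i)) (u i)) @ \oo --> (0 : R).
    by rewrite (cvg_shiftn k.+1 (fun n => \sum_(0 <= i < n) Hb (q (u i)) (u i))).
  apply: (cvg_seq_lb lim1) => m.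
  rewrite (bigD1_seq k) ?iota_uniq//; last by rewrite mem_index_iota/= addnS ltnS leq_addl.
  rewrite -[X in _ <= X]/(Hb (q (u k)) (u k) + _) [X in X + _]qq lerDl.
  by apply: sumr_ge0 => i _; rewrite qq rf_ge0.
have ql := commutant_linear Nq.
have : q (xi k) = 0.
  have -> : xi k = inC (t k)^-1 *: u k.
    by rewrite /u scalerA -rmorphM mulVf ?gt_eqF// rmorph1 scale1r.
  by rewrite (linearZ_of _ _ ql) quk scaler0.
rewrite qE => /eqP; rewrite subr_eq0 => /eqP xP.
by apply: adherent_closure; rewrite xP; exact: (PP _).1.
Qed.

(** If [|phi x| <= d * sum_s |ip (x a) b|], then for [y] the adjoint of [x]
    [phi (y x)] is at most [d] times the sum of the [|x a|^2] and [|x b|^2],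
    which is the square norm of the amplified [x] at a multiple of the tuple of
    all [a] and [b]; [positive_functional_vector] applies. *)
Lemma weak_star_eq_wot_finite_sums :
  weak_star_eq_wot ip N -> normal_positive_finite_sums ip N.
Proof.
move=> eqT phi [phi_lin phi_pos phi_cont].
have [s [d [d0 sP]]] := weak_star_functional_bound vnM eqT phi_lin phi_cont.
(* [c] lists the [a] and the [b], scaled so that its square norm absorbs [d]. *)
pose L := [seq p.1 | p <- s] ++ [seq p.2 | p <- s].
pose c (j : 'I_(size L)) : H := inC (Num.sqrt d) *: nth 0 L j.
exists (size L).
have [|z zP] := @positive_functional_vector _ _ ip M vnM phi phi_lin phi_pos _ c;
  last by exists z.
move=> x y Nx Ny xy.
have xl := commutant_linear Nx.
have Nyx : N (y \o x) by exact: commutant_comp.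
apply: le_trans (ler_norm _) _; apply: le_trans (Re_norm_le _) _.
apply: le_trans (sP _ Nyx) _.
have -> : power_form Hb (size L) (diag_op x c) (diag_op x c) =
    d * \sum_(v <- L) nrm (x v) ^+ 2.
  rewrite power_formE (big_nth 0) big_mkord mulr_sumr; apply: eq_bigr => j _.
  rewrite /diag_op /c (linearZ_of _ _ xl) rfZl rfZr mulrA -expr2 sqr_sqrtr//.
  by rewrite -(rnorm_hform ip) sqr_rnorm.
rewrite ler_wpM2l// /L big_cat /= !big_map -big_split /=; apply: ler_sum => p _.
have -> : ip (y (x p.1)) p.2 = ip (x p.1) (x p.2).
  by rewrite (ip_sym ip) -xy -(ip_sym ip).
apply: le_trans (ip_norm_le _ _ _) _.
have := nrm_ge0 CC (x p.1); have := nrm_ge0 CC (x p.2).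
by have := sqr_ge0 (nrm (x p.1) - nrm (x p.2)); nra.
Qed.

Lemma pairing_normal_positive u : sq u ->
  normal_positive_functional ip N (pairing ip u u).
Proof.
move=> su; split.
- exact: pairing_lin.
- move=> x Nx x0.
  have xr v : ip (x v) v = (Hb (x v) v)%:C%C.
    by rewrite hformE RRe_real// ger0_real.
  have lR := Re_pairing (ip := ip) Nx su su.
  have -> : pairing ip u u x = (Re (pairing ip u u x))%:C%C.
    have lC := pairing_cvg (ip := ip) Nx su su.
    rewrite {1}/pairing; apply: complex_lim; apply: cvg_ReIm.
      exact: (cvg_Re lC).
    rewrite [X in X @ _ --> _](_ : _ = fun=> 0); first exact: cvg_cst.
    by apply/funext => n; rewrite /series /= Im_sum big1// => k _; rewrite xr.
  rewrite ler0c; apply: (cvg_seq_lb lR) => n; apply: sumr_ge0 => k _.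
  by rewrite -ler0c -xr.
- exact: pairing_continuous.
Qed.

Lemma pairing_expand x u v (l : R[i]) : N x -> sq u -> sq v ->
  pairing ip (fun k => u k + l *: v k) (fun k => u k + l *: v k) x =
  pairing ip u u x + Num.conj l * pairing ip u v x + l * pairing ip v u x
   + l * Num.conj l * pairing ip v v x.
Proof.
move=> Nx su sv.
have xl := commutant_linear Nx.
have cuu := pairing_cvg (ip := ip) Nx su su; have cuv := pairing_cvg (ip := ip) Nx su sv.
have cvu := pairing_cvg (ip := ip) Nx sv su; have cvv := pairing_cvg (ip := ip) Nx sv sv.
have h1 := complex_lim_lin (l := l * Num.conj l) cvv cuu.
pose proof (complex_cvg_lin (l := l) cvu h1) as h2.
pose proof (complex_cvg_lin (l := Num.conj l) cuv h2) as h3.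
rewrite /pairing; transitivity (Num.conj l * pairing ip u v x + (l * pairing ip v u x +
   (l * Num.conj l * pairing ip v v x + pairing ip u u x))); last by rewrite /pairing; ring.
apply: complex_lim; apply: cvg_trans h3; apply: near_eq_cvg; apply: nearW => n.
rewrite /series /= !scaler_sumr !mulr_sumr -!big_split; apply: eq_bigr => k _ /=.
rewrite (linearD_of _ _ xl) (linearZ_of _ _ xl) linearDl !linearDr /=.
rewrite !linearZl_LR !linearZr_LR /= -[(l * Num.conj l) *: _]/(l * Num.conj l * _).
rewrite -[Num.conj l *: _]/(Num.conj l * _). ring.
Qed.

Lemma pairing_polarization x u v : N x -> sq u -> sq v ->
  pairing ip u v x = 2^-1 *
    (pairing ip (fun k => u k + 1 *: v k) (fun k => u k + 1 *: v k) x
     + 'i%C * pairing ip (fun k => u k + 'i%C *: v k) (fun k => u k + 'i%C *: v k) x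
     - (1 + 'i%C) * (pairing ip u u x + pairing ip v v x)).
Proof.
move=> Nx su sv.
have s1 := square_summableD (l := 1) su sv; have si := square_summableD (l := 'i%C) su sv.
rewrite !pairing_expand// conjC1.
have ii : 'i%C * 'i%C = -1 :> R[i] by rewrite -expr2 sqr_i.
have -> : Num.conj ('i%C : R[i]) = - 'i%C by apply/eqP; rewrite eq_complex /= oppr0 !eqxx.
set a := pairing ip u v x; set b := pairing ip v u x.
set A := pairing ip u u x; set B := pairing ip v v x.
transitivity (2^-1 * (a * (1 - 'i%C * 'i%C) + b * (1 + 'i%C * 'i%C)
   - 'i%C * B * (1 + 'i%C * 'i%C))); last by ring.
by rewrite ii; field.
Qed.

Lemma square_summable_single a : sq (fun k => if k == 0%N then a else 0).
Proof.
apply: (@series_le_cvg _ _ (geometric ((nrm a) ^+ 2) 2^-1)).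
- by move=> k; rewrite sqr_ge0.
- by move=> k; rewrite /= mulr_ge0 ?sqr_ge0 ?exprn_ge0.
- case=> [|k] /=; first by rewrite expr0 mulr1.
  by rewrite -/(nrm _) (nrm0 CC) expr0n mulr_ge0 ?sqr_ge0 ?exprn_ge0.
- by apply: is_cvg_geometric_series; rewrite ger0_norm// invf_lt1// ltr1n.
Qed.

Lemma pairing_single (x : set_type N) a b :
  pairing ip (fun k => if k == 0%N then a else 0) (fun k => if k == 0%N then b else 0)
    (val x) = ip (val x a) b.
Proof.
apply: complex_lim; rewrite -cvg_shiftS.
rewrite (_ : (fun n => _) = fun=> ip (val x a) b); first exact: (@cvg_cst C).
apply/funext => n; rewrite /series /= big_nat_recl//= big1 ?addr0// => k _.
exact: linear0r.
Qed.

(** By polarization every coordinate of the weak* topology is a combination of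
    normal positive functionals, hence of vector functionals, and is continuous
    for the weak operator topology. Conversely [ip (x a) b] is the coordinate
    given by two sequences with a single nonzero term. *)
Lemma finite_sums_weak_star_eq_wot :
  normal_positive_finite_sums ip N -> weak_star_eq_wot ip N.
Proof.
move=> fin.
have vec_cont n (z : 'I_n -> H) :
    continuous ((fun x => \sum_j ip (val x (z j)) (z j)) : wot ip N -> C).
  move=> x; apply: complex_cvg_sum => [|j]; [exact: nbhs_filter|exact: ip_wot_continuous].
have diag_cont u : sq u -> continuous ((fun x => pairing ip u u (val x)) : wot ip N -> C).
  move=> su; have [n [z zP]] := fin _ (pairing_normal_positive su).
  rewrite (_ : (fun x => _) = (fun x => \sum_j ip (val x (z j)) (z j)))//.
  by apply/funext => x; rewrite zP//; exact: commutant_val.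
have pair_cont u v : sq u -> sq v ->
    continuous ((fun x => pairing ip u v (val x)) : wot ip N -> C).
  move=> su sv.
  have s1 := square_summableD (l := 1) su sv; have si := square_summableD (l := 'i%C) su sv.
  move=> x.
  pose proof (complex_cvg_lin (l := 1) (diag_cont _ su x) (diag_cont _ sv x)) as h0.
  pose proof (complex_cvg_lin (l := 'i%C) (diag_cont _ si x) (diag_cont _ s1 x)) as h1.
  pose proof (complex_cvg_lin (l := - (1 + 'i%C)) h0 h1) as h2.
  pose proof (complex_cvg_lin (l := 2^-1) h2 (cvg_cst (0 : C))) as h3.
  have E (y : set_type N) : pairing ip u v (val y) = 2^-1 * (- (1 + 'i%C) *
      (1 * pairing ip u u (val y) + pairing ip v v (val y)) +
      ('i%C * pairing ip (fun k => u k + 'i%C *: v k) (fun k => u k + 'i%C *: v k) (val y)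
       + pairing ip (fun k => u k + 1 *: v k) (fun k => u k + 1 *: v k) (val y))) + 0.
    by rewrite (pairing_polarization (commutant_val y) su sv); ring.
  rewrite /continuous_at E.
  rewrite (@funext _ _ (fun y : set_type N => pairing ip u v (val y)) _ E).
  exact: h3.
have id1 : continuous (idfun : wot ip N -> weak_star ip N).
  move=> x; apply: (@cvg_initial_ptws _ _ _ (@weak_star_coord R H ip N)) => [|p].
    by apply: fmap_filter; exact: nbhs_filter.
  have [sp1 sp2] := set_mem (valP p).
  exact: (pair_cont _ _ sp1 sp2).
have id2 : continuous (idfun : weak_star ip N -> wot ip N).
  move=> x; apply: (@cvg_initial_ptws _ _ _ (@wot_coord R H ip N)) => [|[a b]].
    by apply: fmap_filter; exact: nbhs_filter.
  pose u k := if k == 0%N then a else 0; pose v k := if k == 0%N then b else 0.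
  have su := square_summable_single (a := a); have sv := square_summable_single (a := b).
  have -> : (fun y : set_type N => wot_coord ip y (a, b)) = (fun y => pairing ip u v (val y)).
    by apply/funext => y; rewrite pairing_single.
  have -> : wot_coord ip x (a, b) = pairing ip u v (val x) by rewrite pairing_single.
  exact: pairing_continuous su sv x.
move=> U; split=> oU.
  by have /continuousP h := id1; exact: (h U oU).
by have /continuousP h := id2; exact: (h U oU).
Qed.

End Main.

Local Open Scope complex_scope.

Theorem theorem5p1 (R : realType) (H : completeNormedModType R[i])
    (ip : inner_product (@Num.conj R[i]) H) (M : set (H -> H))
    (vnM : von_neumann_algebra ip M) :
  [/\ weak_star_eq_wot ip (commutant M) <->
        normal_positive_finite_sums ip (commutant M),
      weak_star_eq_wot ip (commutant M) -> sequences_finitely_generated M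
    & sequences_finitely_generated M -> intertwiners_automatically_bounded M].
Proof.
split.
- split; first exact: weak_star_eq_wot_finite_sums.
  exact: finite_sums_weak_star_eq_wot.
- exact: (weak_star_eq_wot_finitely_generated vnM).
- exact: (finitely_generated_automatically_bounded vnM).
Qed.
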